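(* Suppose $F/\mathbb{Q}_p$ is totally ramified and non-trivial, and let $\chi$ be a character of $B(\mathcal{O}/\mathfrak{m}^2)$. The principal series $I_2(\chi)$ has $2p$ Jordan-Hölder constituents (counted with multiplicity), parametrized by types $(I,\gamma)$, where $I\subseteq\{0\}$ and $\gamma\in\{0,1,\dots,p-1\}$ (all such pairs being types), the constituent parametrized by $(I,\gamma)$ being $L(I,\gamma)$. Moreover, $I_2(\chi)$ has finitely many $\mathrm{GL}_2(\mathcal{O}/\mathfrak{m}^2)$-submodules. If $\chi$ is odd, then the submodules of $I_2(\chi)$ with irreducible cosocle are exactly the submodules $V_{(I,\gamma)}$. The multiset of Jordan-Hölder constituents of $V_{(I,\gamma)}$ is $\{L(I',\gamma'):(I',\gamma')\le_\chi(I,\gamma)\}$.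
   Context: Let $p\ge5$ be a prime, $F/\mathbb{Q}_p$ a finite extension with valuation ring $\mathcal{O}$, maximal ideal $\mathfrak{m}$, uniformizer $\varpi$, ramification index $e$, and residue field $k$ of cardinality $q=p^f$ (in the totally ramified non-trivial case $f=1$, $k=\mathbb{F}_p$, $e\ge2$, and $\mathbb{Z}/f\mathbb{Z}=\{0\}$). All representations are over an extension field $E$ of $k$. $B\le\mathrm{GL}_2$ is the upper triangular subgroup. Every $\lambda\in\mathcal{O}/\mathfrak{m}^2$ is written uniquely as $\lambda=[\lambda_0]+[\lambda_1]\varpi$ with $\lambda_i\in k$, $[\cdot]$ being the Teichmüller lift. Let $\eta:B(k)\to k^\times$ be $\begin{pmatrix}a&b\\0&d\end{pmatrix}\mapsto ad^{-1}$. A character $\chi$ of $B(\mathcal{O}/\mathfrak{m}^2)$ (it factors through $B(k)$) is odd if $\chi\eta^i$ does not factor through the determinant for any $i\in\mathbb{Z}/(q-1)\mathbb{Z}$. Monoid. $\widetilde{\mathbb{N}}$ is the quotient monoid of $(\mathbb{N}\cup\{0\},+)$ by: $a\sim b$ iff $a=b=0$, or $a,b>0$ and $a\equiv b\bmod q-1$ (so $x^\alpha$ makes sense for $x\in k$, with $0^0=1$). Each $\alpha\in\widetilde{\mathbb{N}}$ contains a unique integer $\sum_{i=0}^{f-1}\alpha_ip^i$ with digits $0\le\alpha_i\le p-1$, so for $f=1$ one identifies $\widetilde{\mathbb{N}}$ with $\{0,\dots,p-1\}$; indices are in $\mathbb{Z}/f\mathbb{Z}$. $\widetilde{\mathbb{N}}\setminus\{0\}$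 is identified with $\mathbb{Z}/(q-1)\mathbb{Z}$. Write $\alpha\preceq\beta$ iff $\alpha_i\le\beta_i$ for all $i$; then $\beta\ominus\alpha$ has digits $\beta_i-\alpha_i$. For $a\ne0$, $a-b$ is the unique $c\in\widetilde{\mathbb{N}}\setminus\{0\}$ with $b+c=a$. Carry sets. For $\alpha,\beta\in\widetilde{\mathbb{N}}$, $I(\alpha,\beta)\subseteq\mathbb{Z}/f\mathbb{Z}$ is the unique subset such that for all $i$: $\alpha_i+\beta_i\le p-1$ if $i-1,i\notin I(\alpha,\beta)$; $\alpha_i+\beta_i\le p-2$ if $i-1\in I(\alpha,\beta)$, $i\notin I(\alpha,\beta)$; $\alpha_i+\beta_i\ge p$ if $i-1\notin I(\alpha,\beta)$, $i\in I(\alpha,\beta)$; $\alpha_i+\beta_i\ge p-1$ if $i-1,i\in I(\alpha,\beta)$; and $I(\alpha,\beta)=\varnothing$ if $\alpha_i+\beta_i=p-1$ for all $i$. Representation and basis. Uniquely $\chi=\det^s\cdot\chi_r$ with $s,r\in\mathbb{Z}/(q-1)\mathbb{Z}$, where $\det$ is followed by reduction to $k^\times$ and $\chi_r\begin{pmatrix}a&b\\0&d\end{pmatrix}=(d\bmod\mathfrak{m})^r$; view $r\in\widetilde{\mathbb{N}}\setminus\{0\}$. $I_2(\chi)=\mathrm{Ind}_{B(\mathcal{O}/\mathfrak{m}^2)}^{\mathrm{GL}_2(\mathcal{O}/\mathfrak{m}^2)}\chi$ is the space of functions $\varphi$ with $\varphi(bg)=\chi(b)\varphi(g)$, under right translation;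 it is identified with $\det^s\otimes I_2(\chi_r)$ via $\det(g)^s\varphi(g)\leftrightarrow\varphi(g)$. In $I_2(\chi_r)$, $g\otimes v$ is the function supported on $B(\mathcal{O}/\mathfrak{m}^2)g^{-1}$ with value $\chi_r(b)v$ at $bg^{-1}$. For $(j_0,j_1)\in\widetilde{\mathbb{N}}^2$ put $f_{(j_0,j_1)}=\sum_{\lambda\in\mathcal{O}/\mathfrak{m}^2}\begin{pmatrix}\lambda&1\\1&0\end{pmatrix}\otimes\lambda_0^{j_0}\lambda_1^{j_1}$, and $f_{(\infty,j_1)}=wf_{(0,j_1)}$ with $w=\begin{pmatrix}0&1\\1&0\end{pmatrix}$ acting on $I_2(\chi_r)$. With $\Theta=(\widetilde{\mathbb{N}}\cup\{\infty\})\times\widetilde{\mathbb{N}}$, the set $\mathcal{B}=\{f_{(j_0,j_1)}:(j_0,j_1)\in\Theta\}$ is a basis of $I_2(\chi_r)$, hence of $I_2(\chi)$. Types. Let $\le_r$ be the smallest preorder on $\Theta$ such that, for $m\in\{0,\dots,f-1\}$ and $j_1\in\widetilde{\mathbb{N}}$: (1) $(j_0\ominus p^m,j_1)\le_r(j_0,j_1)$ if $j_0\in\widetilde{\mathbb{N}}$, $p^m\preceq j_0$; (2) $(j_0,j_1\ominus p^m)\le_r(j_0,j_1)$ if $j_0\in\widetilde{\mathbb{N}}$, $p^m\preceq j_1$; (3) $(j_0+p^m,j_1\ominus p^m)\le_r(j_0,j_1)$ if $j_0\in\widetilde{\mathbb{N}}$, $p^m\preceq j_1$; (4) $(r-2j_1-j_0,j_1)\le_r(j_0,j_1)$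 if $j_0\notin\{0,\infty\}$; (5) $(r-2j_1,j_1\ominus p^m)\le_r(\infty,j_1)$ if $p^m\preceq j_1$; (6) $((r-2j_1)\ominus p^m,j_1)\le_r(\infty,j_1)$ if $p^m\preceq r-2j_1$; (7) $(0,j_1)\le_r(\infty,j_1)$ and $(\infty,j_1)\le_r(0,j_1)$. Two elements are equivalent if each is $\le_r$ the other. A type is an equivalence class; $\le_r$ induces a partial order on types, denoted $\le_\chi$. The class of $(j_0,j_1)$ is encoded by the pair $(I(j_0',r-2j_1-j_0'),j_1)$ for any representative $(j_0',j_1)$ with $j_0'\in\widetilde{\mathbb{N}}$; this encoding is well defined and injective, and types are written as such pairs $(I,\gamma)$. $V_{(I,\gamma)}$ is the span of the $f_{(j_0,j_1)}\in\mathcal{B}$ with type of $(j_0,j_1)$ $\le_\chi(I,\gamma)$; these are $\mathrm{GL}_2(\mathcal{O}/\mathfrak{m}^2)$-submodules when $e\ge2$. Put $L(I,\gamma)=V_{(I,\gamma)}/\sum_{(I',\gamma')<_\chi(I,\gamma)}V_{(I',\gamma')}$. *)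

(* Defs.v *)
From HB Require Import structures.
From mathcomp Require Import all_boot all_order all_fingroup all_algebra all_field.

Set Implicit Arguments.
Unset Strict Implicit.
Unset Printing Implicit Defensive.

Import Order.TTheory GRing.Theory Num.Theory.
Local Open Scope ring_scope.

(* Normalised discrete valuations; the value at 0 is irrelevant, and [val_ge]
   below treats 0 as having infinite valuation. *)
Record valuation (F : fieldType) := Valuation {
  vfun :> F -> int;
  vfunM : forall x y, x != 0 -> y != 0 -> vfun (x * y) = vfun x + vfun y;
  vfunD : forall x y, x != 0 -> y != 0 -> x + y != 0 ->
    Num.min (vfun x) (vfun y) <= vfun (x + y);
  vfun_unif : exists2 x, x != 0 & vfun x = 1 }.

Definition val_ge (F : fieldType) (v : valuation F) (n : int) (x : F) : bool :=
  (x == 0) || (n <= v x).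

(* x != 0 is needed because the value of v at 0 is arbitrary. *)
Definition is_uniformizer (F : fieldType) (v : valuation F) (x : F) : Prop :=
  x != 0 /\ v x = 1.

Definition padic_val (p : nat) (x : rat) : int :=
  (logn p `|numq x|%N)%:Z - (logn p `|denq x|%N)%:Z.

Definition val_cvg (F : fieldType) (v : valuation F) (u : nat -> F) (l : F) :=
  forall n : nat, exists N : nat, forall i : nat, (N <= i)%N ->
    val_ge v n%:Z (u i - l).

Definition val_cauchy (F : fieldType) (v : valuation F) (u : nat -> F) :=
  forall n : nat, exists N : nat, forall i j : nat, (N <= i)%N -> (N <= j)%N ->
    val_ge v n%:Z (u i - u j).

(* (K, v) is the completion of the field of rational numbers at the p-adic
   valuation: this is the definition of Q_p, up to unique isomorphism. *)
Definition is_padic_field (p : nat) (K : fieldType) (v : valuation K) : Prop :=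
  [/\ [pchar K] =i pred0,
      forall x : rat, x != 0 -> v (ratr x) = padic_val p x,
      forall (x : K) (n : nat), exists y : rat, val_ge v n%:Z (x - ratr y)
    & forall u : nat -> K, val_cauchy v u -> exists l, val_cvg v u l].

Section ValuationRing.
Variables (F : fieldType) (v : valuation F).

Definition valring_pred : {pred F} := [pred x | val_ge v 0 x].

Lemma vfun1 : v 1 = 0.
Proof.
have := vfunM v (oner_neq0 F) (oner_neq0 F).
by rewrite mulr1 => /eqP; rewrite -subr_eq0 opprD addNKr oppr_eq0 => /eqP.
Qed.

Lemma vfunN x : v (- x) = v x.
Proof.
have [->|x0] := eqVneq x 0; first by rewrite oppr0.
have n0 : - 1 != 0 :> F by rewrite oppr_eq0 oner_neq0.
have := vfunM v n0 n0; rewrite mulrNN mulr1 vfun1 => h.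
have {}h : v (-1) = 0 by move/eqP: h; rewrite eq_sym -mulr2n mulrn_eq0 => /eqP.
by rewrite -mulN1r (vfunM v n0 x0) h add0r.
Qed.

Lemma valring_subring : subring_closed valring_pred.
Proof.
split=> [|x y|x y]; rewrite !inE /val_ge.
- by rewrite vfun1 lexx orbT.
- have [->|x0] := eqVneq x 0.
    by rewrite sub0r oppr_eq0 vfunN => _.
  have [->|y0] := eqVneq y 0; first by rewrite subr0 (negPf x0).
  move=> /= vx vy; have [//|xy0] := eqVneq (x - y) 0.
  have y0' : - y != 0 by rewrite oppr_eq0.
  apply: le_trans (vfunD v x0 y0' xy0).
  by rewrite vfunN le_min vx vy.
- have [->|x0] := eqVneq x 0; first by rewrite mul0r eqxx.
  have [->|y0] := eqVneq y 0; first by rewrite mulr0 eqxx.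
  by move=> /= vx vy; rewrite (vfunM v x0 y0) addr_ge0 ?orbT.
Qed.

HB.instance Definition _ :=
  GRing.isSubringClosed.Build F valring_pred valring_subring.

Record valring := Valring { valring_val : F; _ : valring_val \in valring_pred }.
HB.instance Definition _ := [isSub for valring_val].
HB.instance Definition _ := [Choice of valring by <:].
HB.instance Definition _ := [SubChoice_isSubComNzRing of valring by <:].

(* Q, together with pi, is the quotient of the valuation ring by the n-th power
   {x | n <= v x} of its maximal ideal. *)
Definition is_quotient_by_power (n : nat) (Q : nzRingType)
    (pi : valring -> Q) : Prop :=
  (forall a : Q, exists x, pi x = a) /\
  (forall x, pi x = 0 <-> val_ge v n%:Z (val x)).

(* The Teichmueller lift: the multiplicative section (with [0] = 0) of the
   reduction map rho to the residue field. *)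
Definition is_teichmuller (k : fieldType) (rho : valring -> k)
    (teich : k -> valring) : Prop :=
  [/\ teich 0 = 0, teich 1 = 1,
      forall x y, teich (x * y) = teich x * teich y
    & forall x, rho (teich x) = x].

End ValuationRing.

Section Types.
Local Open Scope nat_scope.
Variables p f : nat.
Let q := p ^ f.

(* The quotient monoid of the natural numbers, through the representatives
   0, ..., q - 1; [nclass n] is the class of n. *)
Definition Ntilde := 'I_q.-1.+1.

Definition nclass (n : nat) : Ntilde :=
  inord (if n == 0 then 0 else (n.-1 %% q.-1).+1).

Definition nadd (a b : Ntilde) : Ntilde := nclass (a + b).

(* For a != 0: the nonzero c such that b + c = a. *)
Definition nsub (a b : Ntilde) : Ntilde := nclass (a + q.-1 - b).

Definition digit (a : Ntilde) (i : nat) : nat := (a %/ p ^ i) %% p.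

Definition npreceq (a b : Ntilde) : bool :=
  [forall i : 'I_f, digit a i <= digit b i].

(* For a preceq b; written [b ominus a] on paper. *)
Definition nominus (b a : Ntilde) : Ntilde :=
  nclass (\sum_(i < f) (digit b i - digit a i) * p ^ i).

(* [ord_pred i] is i - 1 in Z/fZ. *)
Definition is_carry_set (a b : Ntilde) (I : {set 'I_f}) : bool :=
  [forall i : 'I_f,
     let d := digit a i + digit b i in
     match ord_pred i \in I, i \in I with
     | false, false => d <= p - 1
     | true, false => d <= p - 2
     | false, true => p <= d
     | true, true => p - 1 <= d
     end]
  && ([forall i : 'I_f, digit a i + digit b i == p - 1] ==> (I == set0)).

Definition carry_set (a b : Ntilde) : {set 'I_f} :=
  odflt set0 [pick I | is_carry_set a b I].

(* [None] stands for infinity. *)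
Definition Theta := (option Ntilde * Ntilde)%type.

Variable r : Ntilde.

(* r - 2 j1 *)
Definition rm2 (j1 : Ntilde) : Ntilde := nsub r (nadd j1 j1).

(* The generating relations; the preorder is their reflexive transitive closure.
   The relation (0, j1) <= (infinity, j1) is the last alternative of the [else]
   branch, its converse the last one of the [then] branch. *)
Definition below (x y : Theta) : bool :=
  let j1 := y.2 in
  if y.1 is Some j0 then
    [|| [exists m : 'I_f, let e := nclass (p ^ m) in
           npreceq e j0 && (x == (Some (nominus j0 e), j1))],
        [exists m : 'I_f, let e := nclass (p ^ m) in
           npreceq e j1 && (x == (Some j0, nominus j1 e))],
        [exists m : 'I_f, let e := nclass (p ^ m) in
           npreceq e j1 && (x == (Some (nadd j0 e), nominus j1 e))],
        (j0 != ord0) && (x == (Some (nsub (rm2 j1) j0), j1))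
      | (j0 == ord0) && (x == (None, j1))]
  else
    [|| [exists m : 'I_f, let e := nclass (p ^ m) in
           npreceq e j1 && (x == (Some (rm2 j1), nominus j1 e))],
        [exists m : 'I_f, let e := nclass (p ^ m) in
           npreceq e (rm2 j1) && (x == (Some (nominus (rm2 j1) e), j1))]
      | x == (Some ord0, j1)].

Definition leT (x y : Theta) : bool := connect below x y.

Definition equivT (x y : Theta) : bool := leT x y && leT y x.

Definition tcode := ({set 'I_f} * Ntilde)%type.

(* The equivalence class of x is encoded by T. *)
Definition has_type (x : Theta) (T : tcode) : bool :=
  [exists j0 : Ntilde,
     equivT x (Some j0, T.2) && (T.1 == carry_set j0 (nsub (rm2 T.2) j0))].

Definition le_type (T T' : tcode) : bool :=
  [exists x, exists y, [&& has_type x T, has_type y T' & leT x y]].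

Definition lt_type (T T' : tcode) : bool := (T != T') && le_type T T'.

End Types.

Section Modules.
Variables (gT : finGroupType) (E : fieldType).

Local Notation funsp := {ffun gT -> E^o}.

Definition rtrans (g : gT) (phi : funsp) : funsp := [ffun h => phi (h * g)%g].

Definition gstable (U : {vspace funsp}) : Prop :=
  forall g phi, phi \in U -> rtrans g phi \in U.

Definition submodule_of (M U : {vspace funsp}) : Prop :=
  gstable U /\ (U <= M)%VS.

(* The pair (U, W) stands for the subquotient U / W. *)
Definition subquot := ({vspace funsp} * {vspace funsp})%type.

Definition is_subquot (X : subquot) : Prop :=
  gstable X.1 /\ submodule_of X.1 X.2.

Definition irreducible (X : subquot) : Prop :=
  [/\ is_subquot X, X.2 != X.1
    & forall N, submodule_of X.1 N -> (X.2 <= N)%VS -> N = X.2 \/ N = X.1].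

(* Every linear map X.1 / X.2 -> Y.1 / Y.2 is induced by an endomorphism of the
   ambient space; the four clauses say that f maps X.1 into Y.1, that the
   induced map is well defined and injective, surjective, and equivariant. *)
Definition subquot_iso (X Y : subquot) : Prop :=
  [/\ is_subquot X, is_subquot Y & exists f : 'End(funsp),
    [/\ (f @: X.1 <= Y.1)%VS,
        forall u, u \in X.1 -> (f u \in Y.2) = (u \in X.2),
        (Y.1 <= f @: X.1 + Y.2)%VS
      & forall g u, u \in X.1 -> f (rtrans g u) - rtrans g (f u) \in Y.2]].

(* The i-th factor of the chain 0 = c_0 <= c_1 <= ... given by c. *)
Definition factor (c : seq {vspace funsp}) (i : nat) : subquot :=
  (nth 0%VS (0%VS :: c) i.+1, nth 0%VS (0%VS :: c) i).

Definition composition_series (U : {vspace funsp}) (c : seq {vspace funsp}) :=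
  last 0%VS c = U /\ forall i, (i < size c)%N -> irreducible (factor c i).

(* The multiset of Jordan-Hoelder constituents of U (up to isomorphism) is the
   multiset given by l. *)
Definition JH_constituents (U : {vspace funsp}) (l : seq subquot) : Prop :=
  exists c l', [/\ composition_series U c, perm_eq l l', size l' = size c
    & forall i, (i < size c)%N ->
        subquot_iso (factor c i) (nth (0%VS, 0%VS) l' i)].

(* R is the radical of U, the intersection of the maximal submodules of U. *)
Definition is_radical (U R : {vspace funsp}) : Prop :=
  forall x, x \in R <-> x \in U /\ forall N, irreducible (U, N) -> x \in N.

(* The cosocle of U is U modulo its radical. *)
Definition irreducible_cosocle (U : {vspace funsp}) : Prop :=
  exists2 R, is_radical U R & irreducible (U, R).

End Modules.

Section PrincipalSeries.
Variables p f : nat.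
(* A plays the role of O/m^2, tau that of the Teichmueller lift to O/m^2, and w
   that of the class of the uniformizer. *)
Variables (A : finComUnitRingType) (k : finFieldType) (red : {rmorphism A -> k}).
Variables (tau : k -> A) (w : A).
Variables (E : fieldType) (iota : {rmorphism k -> E}).

Local Notation GL := {'GL_2[A]}.
Local Notation V := {ffun GL -> E^o}.

Definition glmx (g : GL) : 'M[A]_2 := GLval g.

Definition borel : {set GL} := [set g : GL | glmx g 1 0 == 0].

Definition redE (a : A) : E := iota (red a).

Definition is_character (chi : GL -> E) : Prop :=
  chi 1%g = 1 /\ {in borel &, forall b b', chi (b * b')%g = chi b * chi b'}.

Definition eta (b : GL) : E := redE (glmx b 0 0) / redE (glmx b 1 1).

Definition factors_through_det (psi : GL -> E) : Prop :=
  exists theta : A -> E, {in borel, forall b, psi b = theta (\det (glmx b))}.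

Definition odd_character (chi : GL -> E) : Prop :=
  forall i : nat, ~ factors_through_det (fun b => chi b * eta b ^+ i).

Definition detE (g : GL) : E := redE (\det (glmx g)).

Definition chi_ (r : Ntilde p f) (b : GL) : E := redE (glmx b 1 1) ^+ r.

(* The pair (s, r) of nonzero elements of Ntilde such that
   chi = det^s * chi_r on the Borel subgroup. *)
Definition char_exponents (chi : GL -> E) : Ntilde p f * Ntilde p f :=
  odflt (ord0, ord0) [pick sr : Ntilde p f * Ntilde p f |
    [&& sr.1 != ord0, sr.2 != ord0
      & [forall b in borel, chi b == detE b ^+ sr.1 * chi_ sr.2 b]]].

Definition char_s (chi : GL -> E) : Ntilde p f := (char_exponents chi).1.
Definition char_r (chi : GL -> E) : Ntilde p f := (char_exponents chi).2.

(* Its kernel is the induced space, see [mem_principal_series]. *)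
Definition ind_defect (chi : GL -> E) (phi : V) :
    {ffun GL * GL -> E^o} :=
  [ffun bg => if bg.1 \in borel
              then phi (bg.1 * bg.2)%g - chi bg.1 * phi bg.2 else 0].

Definition principal_series (chi : GL -> E) : {vspace V} :=
  lker (linfun (ind_defect chi)).

Lemma mem_principal_series (chi : GL -> E) (phi : V) :
  phi \in principal_series chi <->
  {in borel, forall b g, phi (b * g)%g = chi b * phi g}.
Proof.
have lin : linear (ind_defect chi).
  move=> a u v; apply/ffunP=> -[b g]; rewrite !ffunE /=.
  case: ifP => _; last by rewrite scaler0 addr0.
  rewrite -![_ *: _]/(_ * _) mulrBr mulrDr opprD !addrA.
  congr (_ - _); rewrite mulrCA -!addrA; congr (_ + _); exact: addrC.
pose lm := GRing.isLinear.Build _ _ _ _ (ind_defect chi) lin.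
pose L : {linear V -> {ffun GL * GL -> E^o}} := HB.pack (ind_defect chi) lm.
rewrite memv_ker (lfunE L); split.
  move=> /eqP/ffunP h b bB g; move: (h (b, g)); rewrite !ffunE /= bB.
  by move/eqP; rewrite subr_eq0 => /eqP.
move=> h; apply/eqP/ffunP=> -[b g]; rewrite !ffunE /=.
by case: ifP => // bB; rewrite h ?subrr.
Qed.

Definition antidiag_mx (l : A) : 'M[A]_2 :=
  \matrix_(i, j) if (i == 0) && (j == 0) then l
                 else if (i == 1) && (j == 1) then 0 else 1.

Lemma antidiag_mx_unit l : antidiag_mx l \is a GRing.unit.
Proof.
rewrite -[_ \is a _]/(_ \in unitmx) unitmxE (expand_det_row _ 0) !big_ord_recl.
rewrite big_ord0 /cofactor !det_mx11 !mxE /= !mulr0 !mulr1 mul1r add0r addr0.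
by rewrite /bump /= expr1 unitrN1.
Qed.

Definition antidiag (l : A) : GL := FinRing.unit _ (antidiag_mx_unit l).

(* g (x) v in Ind(chi_r): b g^-1 |-> chi_r(b) v *)
Definition tens (r : Ntilde p f) (g : GL) (v : E) : V :=
  [ffun h => if (h * g)%g \in borel then chi_ r (h * g)%g * v else 0].

(* The basis vectors of Ind(chi_r); the sum over l in O/m^2 is a sum over the
   pairs (l0, l1) with l = [l0] + [l1] varpi. *)
Definition fbasis_r (r : Ntilde p f) (x : Theta p f) : V :=
  let fin (j0 j1 : Ntilde p f) : V :=
    \sum_(l0 : k) \sum_(l1 : k)
      tens r (antidiag (tau l0 + tau l1 * w)) (iota (l0 ^+ j0 * l1 ^+ j1)) in
  if x.1 is Some j0 then fin j0 x.2
  else rtrans (antidiag 0) (fin ord0 x.2).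

(* The same vectors seen in Ind(chi), through phi |-> det^s phi. *)
Definition fbasis (chi : GL -> E) (x : Theta p f) : V :=
  [ffun g => detE g ^+ char_s chi * fbasis_r (char_r chi) x g].

Definition le_chi (chi : GL -> E) (T T' : tcode p f) : bool :=
  le_type (char_r chi) T T'.

Definition lt_chi (chi : GL -> E) (T T' : tcode p f) : bool :=
  lt_type (char_r chi) T T'.

Definition is_type (chi : GL -> E) (T : tcode p f) : Prop :=
  exists x : Theta p f, has_type (char_r chi) x T.

Definition Vsub (chi : GL -> E) (T : tcode p f) : {vspace V} :=
  <<[seq fbasis chi x | x in
      [pred x : Theta p f |
        [exists T', has_type (char_r chi) x T' && le_chi chi T' T]]]>>%VS.

Definition Lsub (chi : GL -> E) (T : tcode p f) : subquot GL E :=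
  (Vsub chi T, \sum_(T' | lt_chi chi T' T) Vsub chi T')%VS.

End PrincipalSeries.

(* Main.v *)
(* O/m^2 is the ring of dual numbers over k. A function in I_2(chi_r) is a
   function of the bottom row of g, which up to scaling by 1 + m has coordinates
   (X, Y, D): (X, Y) is its reduction and D the determinant of (X, Y) and of the
   infinitesimal part. So I_2(chi) is det^s times the functions X^l Y^i D^j with
   l + i + 2 j = r mod p - 1; GL_2(k) acts linearly on (X, Y) and by det on D, and
   1 + m M_2 translates D by the binary quadratic forms in (X, Y). The basis
   vectors f_x are such monomials up to sign, and the preorder on Theta compares
   both the exponent of D and the weighted degree l + i + 2 j, hence the V_(I, gamma)
   are spanned by weighted homogeneous polynomials and are submodules.
   A submodule is graded by the exponent of D: if the leading coefficient of one of
   its elements generates the layer of weighted degree n, then translations put the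
   lower layers of degree n in it too, and the remaining lower terms have the wrong
   torus weight. Hence a submodule is a sum of layers, of which there are finitely
   many, and these are V_(I, gamma)'s unless r is even. *)
From HB Require Import structures.
Require Import Defs.
From mathcomp Require Import all_boot all_order all_fingroup all_algebra all_solvable all_field.
From mathcomp Require Import zify ring.

Set Implicit Arguments.
Unset Strict Implicit.
Unset Printing Implicit Defensive.

Import Order.TTheory GRing.Theory Num.Theory.
Local Open Scope ring_scope.

(** * Types and weighted degrees *)

(** A positive exponent of X or Y matters only modulo p - 1, so a form of degree d > 0 in X, Y is,
    as a function, also one of degree d + p - 1. Hence each power D^j contributes exactly two
    constituents: the forms of the least positive degree congruent to r - 2 j, and the quotient of
    all functions of that weight by them; I tells the two apart. The obstacle is degree 0. Since X
    and Y never vanish together, 1 = X^(p-1) + Y^(p-1) - X^(p-1) Y^(p-1); so a pure power of D is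
    not a basis vector, yet it spans a layer of its own when r is even, and every statement on
    submodules has to watch for it. The group acts only through elements of its group algebra: power
    sums over k extract from one-parameter families the operators X d/dY, X^2 d/dD and XY d/dD,
    whose integer coefficients are invertible because the exponents they differentiate stay below p.
    The assumption e > 1 makes p vanish in O/m^2, and this is why Teichmueller representatives are
    additive there. *)

Section Exponents.
Local Open Scope nat_scope.
Variables (p : nat) (p_ge5 : 5 <= p).
Local Notation N := (Ntilde p 1).
Local Notation Th := (Theta p 1).

(** On k the powers with exponents [n] and [red_exp n] agree; 0 is kept apart from p - 1 because 0^0
    = 1. Plain naturals keep the arithmetic within reach of [lia]. *)
Definition red_exp (n : nat) : nat := if n == 0 then 0 else (n.-1 %% p.-1).+1.

Lemma red_exp_le n : red_exp n <= n.
Proof.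
rewrite /red_exp; case: n => // n /=.
by rewrite ltnS leq_mod.
Qed.

Lemma red_exp_max n : red_exp n <= p.-1.
Proof. by rewrite /red_exp; case: n => // n /=; rewrite ltn_pmod //; lia. Qed.

Lemma red_exp_gt0 n : (0 < red_exp n) = (0 < n).
Proof. by rewrite /red_exp; case: n. Qed.

Lemma red_exp_decomp n : exists c, n = red_exp n + c * p.-1.
Proof.
rewrite /red_exp; case: n => [|n]; first by exists 0.
by exists (n %/ p.-1); rewrite /= {1}(divn_eq n p.-1); lia.
Qed.

Lemma red_exp_small n : n <= p.-1 -> red_exp n = n.
Proof. by rewrite /red_exp; case: n => // n /= h; rewrite modn_small. Qed.

Lemma red_expD n : 0 < n -> red_exp (n + p.-1) = red_exp n.
Proof.
rewrite /red_exp; case: n => // n _.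
by rewrite addSn /= modnDr.
Qed.

Lemma red_exp_large n : p.-1 < n -> red_exp n = red_exp (n - p.-1).
Proof. by move=> h; rewrite -(red_expD (n := n - p.-1)) ?subnK //; lia. Qed.

Lemma modP_uniq a b :
  0 < a <= p.-1 -> 0 < b <= p.-1 -> a = b %[mod p.-1] -> a = b.
Proof.
move=> /andP[a0 aP] /andP[b0 bP] h.
have : red_exp a = red_exp b.
  rewrite /red_exp !gtn_eqF //; congr _.+1.
  case: a b a0 b0 {aP bP} h => // a [] // b _ _ h /=.
  by apply/eqP; rewrite -(eqn_modDr 1) !addn1; apply/eqP.
by rewrite !red_exp_small.
Qed.

Lemma red_exp_mod n : red_exp n = n %[mod p.-1].
Proof. by have [c {2}->] := red_exp_decomp n; rewrite addnC modnMDl. Qed.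

Lemma ntilde_lt (x : N) : x < p.
Proof.
have h m : m < (p ^ 1).-1.+1 -> m < p by rewrite expn1; lia.
exact: h (ltn_ord x).
Qed.

Lemma val_nclass n : nclass p 1 n = red_exp n :> nat.
Proof.
rewrite /nclass inordK; first by rewrite /red_exp expn1.
have := red_exp_max n; rewrite /red_exp expn1; lia.
Qed.

Lemma val_nadd (x y : N) : nadd x y = red_exp (x + y) :> nat.
Proof. exact: val_nclass. Qed.

Lemma val_nsub (x y : N) : nsub x y = red_exp (x + p.-1 - y) :> nat.
Proof. exact: val_nclass. Qed.

Lemma digit_f1 (x : N) (i : 'I_1) : digit x i = x.
Proof.
by rewrite ord1 /digit expn0 divn1 modn_small // ntilde_lt.
Qed.

Lemma npreceq_f1 (x y : N) : npreceq x y = (x <= y).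
Proof.
apply/forallP/idP => [/(_ ord0)|h i]; by rewrite !digit_f1.
Qed.

Lemma val_nominus (x y : N) : nominus y x = y - x :> nat.
Proof.
rewrite val_nclass big_ord1 !digit_f1 expn0 muln1 red_exp_small //.
by have := ntilde_lt y; lia.
Qed.

Definition ntilde1 : N := nclass p 1 1.
Lemma val_ntilde1 : ntilde1 = 1 :> nat.
Proof. by rewrite val_nclass red_exp_small //; lia. Qed.

Definition nord (i : nat) : N := inord i.
Lemma val_nord i : i < p -> nord i = i :> nat.
Proof. by move=> h; rewrite inordK // expn1; lia. Qed.

Variable r : N.
Hypothesis r0 : 0 < r.

(* [aexp j] represents [r - 2 j] by an integer between 1 and p - 1. *)
Definition aexp (j : nat) : nat := red_exp (r + p.-1 - red_exp (j + j)).

Lemma val_rm2 (j : N) : rm2 r j = aexp j :> nat.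
Proof. by rewrite val_nsub val_nadd. Qed.

Lemma aexp_gt0 j : 0 < aexp j.
Proof. by rewrite red_exp_gt0; have := red_exp_max (j + j); lia. Qed.

Lemma aexp_le j : aexp j <= p.-1.
Proof. exact: red_exp_max. Qed.

Lemma aexp_mod j : aexp j + j.*2 = r %[mod p.-1].
Proof.
rewrite /aexp -addnn -modnDml red_exp_mod modnDml -modnDmr -(red_exp_mod (j + j)).
rewrite modnDmr subnK ?modnDr //.
by have := red_exp_max (j + j); lia.
Qed.

(** Raising the layer by one lowers r - 2 j by 2. So the smaller weighted degree [aexp j + j.*2] of
    a layer is constant in [j] except for a jump by p - 1 whenever the representative leaves its
    range. *)
Lemma aexpS j :
  aexp j = if aexp j.+1 + 2 <= p.-1 then aexp j.+1 + 2
           else aexp j.+1 + 2 - p.-1.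
Proof.
have h1 := aexp_gt0 j; have h2 := aexp_le j.
have h3 := aexp_gt0 j.+1; have h4 := aexp_le j.+1.
have key : aexp j = aexp j.+1 + 2 %[mod p.-1].
  apply/eqP; rewrite -(eqn_modDr j.*2); apply/eqP; rewrite aexp_mod.
  by have -> : aexp j.+1 + 2 + j.*2 = aexp j.+1 + j.+1.*2; [lia|rewrite aexp_mod].
case: ifP => h; apply: modP_uniq => //; try lia.
rewrite key -[in LHS](subnK (n := aexp j.+1 + 2) (m := p.-1)) ?modnDr //; lia.
Qed.

Lemma aexp_pred j : 0 < j ->
  aexp (j - 1) = if aexp j + 2 <= p.-1 then aexp j + 2 else aexp j + 2 - p.-1.
Proof. by case: j => // j _; rewrite subn1; exact: aexpS. Qed.

Lemma aexp_eq j n : n + j.*2 = r %[mod p.-1] -> 0 < n -> red_exp n = aexp j.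
Proof.
move=> h n0; apply: modP_uniq.
- by rewrite red_exp_gt0 n0 red_exp_max.
- by rewrite aexp_gt0 aexp_le.
rewrite red_exp_mod; apply/eqP; rewrite -(eqn_modDr j.*2); apply/eqP.
by rewrite h aexp_mod.
Qed.

(* The vector of index [x] is, up to sign, the monomial
   [X ^ xexp x * Y ^ yexp x * D ^ x.2] of weighted degree [wdeg x],
   where D has weight 2. *)
Definition yexp (x : Th) : nat := if x.1 is Some i then i : nat else aexp x.2.
Definition xexp (x : Th) : nat :=
  if x.1 is Some i then nsub (rm2 r x.2) i : nat else 0.
Definition wdeg (x : Th) : nat := xexp x + yexp x + x.2.*2.

Lemma xexpE (i j : N) :
  xexp (Some i, j) = if i < aexp j then aexp j - i else aexp j + p.-1 - i.
Proof.
rewrite /xexp /= val_nsub val_rm2.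
have h1 := aexp_gt0 j; have h2 := aexp_le j; have h3 := ntilde_lt i.
case: ifP => h; last by rewrite red_exp_small //; lia.
by rewrite red_exp_large ?red_exp_small //; lia.
Qed.

Lemma xexp_gt0 (i j : N) : 0 < xexp (Some i, j).
Proof.
rewrite xexpE; have := aexp_gt0 j; have := ntilde_lt i.
by case: ifP; lia.
Qed.

Lemma wdegS (i j : N) : wdeg (Some i, j) =
  (if i < aexp j then aexp j else aexp j + p.-1) + j.*2.
Proof.
rewrite /wdeg xexpE /yexp /=.
have h2 := aexp_le j; have h3 := ntilde_lt i.
by case: ifP => h; lia.
Qed.

Lemma wdegN (j : N) : wdeg (None, j) = aexp j + j.*2.
Proof. by []. Qed.

Lemma wdeg_mod x : wdeg x = r %[mod p.-1].
Proof.
case: x => [[i|] j]; last by rewrite wdegN aexp_mod.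
rewrite wdegS; case: ifP => _; rewrite ?aexp_mod //.
by rewrite addnAC modnDr aexp_mod.
Qed.

Definition le_wdeg (x y : Th) : bool := (x.2 <= y.2) && (wdeg x <= wdeg y).

Lemma le_wdeg_refl : reflexive le_wdeg.
Proof. by move=> x; rewrite /le_wdeg !leqnn. Qed.

Lemma le_wdeg_trans : transitive le_wdeg.
Proof. by move=> y x z; rewrite /le_wdeg; lia. Qed.

(** The relations trade Y for X, trade D for X^2 or XY, or exchange X and Y. None of this changes
    the weighted degree, and reducing the exponents afterwards can only lower it. *)
Lemma below_le_wdeg x y : below r x y -> le_wdeg x y.
Proof.
case: y => [[i|] j]; rewrite /below /=.
  have h1 := aexp_gt0 j; have h2 := aexp_le j; have h3 := ntilde_lt i.
  case/orP => [/existsP[m]|/or4P[/existsP[m]|/existsP[m]||]].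
  - rewrite ord1 expn0 npreceq_f1 val_ntilde1 => /andP[hi /eqP->].
    rewrite /le_wdeg leqnn !wdegS val_nominus val_ntilde1.
    by repeat case: ifP => ?; lia.
  - rewrite ord1 expn0 npreceq_f1 val_ntilde1 => /andP[hi /eqP->].
    rewrite /le_wdeg /= !wdegS val_nominus val_ntilde1.
    have := aexp_pred hi.
    by repeat case: ifP => ?; lia.
  - rewrite ord1 expn0 npreceq_f1 val_ntilde1 => /andP[hi /eqP->].
    rewrite /le_wdeg /= !wdegS val_nominus val_ntilde1 val_nadd val_ntilde1.
    have := aexp_pred hi.
    have : red_exp (i + 1) = if i + 1 == p then 1 else i + 1.
      case: eqP => h; last by rewrite red_exp_small //; lia.
      by rewrite red_exp_large ?red_exp_small; lia.
    by move=> ->; case: (i + 1 =P p) => ?; repeat case: ifP => ?; lia.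
  - case/andP => hi /eqP->; rewrite /le_wdeg leqnn !wdegS.
    rewrite -[nat_of_ord (nsub _ _)]/(xexp (Some i, j)) xexpE.
    have {}hi : nat_of_ord i != 0 by [].
    by case: (ltnP i (aexp j)) => ?; repeat case: ifP => ?; lia.
  - case/andP => /eqP-> /eqP->; rewrite /le_wdeg leqnn wdegN wdegS /=.
    by case: ifP => ?; lia.
have h1 := aexp_gt0 j; have h2 := aexp_le j.
case/or3P => [/existsP[m]|/existsP[m]|].
- rewrite ord1 expn0 npreceq_f1 val_ntilde1 => /andP[hi /eqP->].
  rewrite /le_wdeg /= wdegN wdegS val_nominus val_ntilde1 val_rm2.
  have := aexp_pred hi.
  by repeat case: ifP => ?; lia.
- rewrite ord1 expn0 npreceq_f1 val_ntilde1 => /andP[hi /eqP->].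
  rewrite /le_wdeg leqnn wdegN wdegS val_nominus val_ntilde1 val_rm2.
  by case: ifP => ?; lia.
move/eqP->; rewrite /le_wdeg leqnn wdegN wdegS /=.
by case: ifP => ?; lia.
Qed.

Lemma below_pred (i i' j : N) : i = i'.+1 :> nat -> below r (Some i', j) (Some i, j).
Proof.
move=> h; rewrite /below /=; apply/orP; left; apply/existsP; exists ord0.
rewrite expn0 npreceq_f1 val_ntilde1 h /=; apply/eqP; congr (Some _, _).
by apply: val_inj; rewrite /= val_nominus val_ntilde1 h subn1.
Qed.

Lemma below_layer (i j j' : N) : j = j'.+1 :> nat -> below r (Some i, j') (Some i, j).
Proof.
move=> h; rewrite /below /=; apply/orP; right; apply/or4P; apply: Or41; apply/existsP; exists ord0.
rewrite expn0 npreceq_f1 val_ntilde1 h /=; apply/eqP; congr (_, _).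
by apply: val_inj; rewrite /= val_nominus val_ntilde1 h subn1.
Qed.

Lemma below_swap (i i' j : N) :
  i != ord0 -> i' = xexp (Some i, j) :> nat -> below r (Some i', j) (Some i, j).
Proof.
move=> i0 h; rewrite /below /=; apply/orP; right; apply/or4P; apply: Or43; rewrite i0 /=.
by apply/eqP; congr (Some _, _); apply: val_inj.
Qed.

Lemma below_0inf (j : N) : below r (None, j) (Some ord0, j).
Proof. by rewrite /below /= !eqxx !orbT. Qed.

Lemma below_inf_pred (i j : N) : aexp j = i.+1 -> below r (Some i, j) (None, j).
Proof.
move=> h; rewrite /below /=; apply/or3P; apply: Or32; apply/existsP; exists ord0.
rewrite expn0 npreceq_f1 val_ntilde1 val_rm2 h /=; apply/eqP; congr (Some _, _).
by apply: val_inj; rewrite /= val_nominus val_ntilde1 val_rm2 h subn1.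
Qed.

Lemma below_inf_layer (i j j' : N) : j = j'.+1 :> nat -> aexp j = i :> nat ->
  below r (Some i, j') (None, j).
Proof.
move=> h ha; rewrite /below /=; apply/or3P; apply: Or31; apply/existsP; exists ord0.
rewrite expn0 npreceq_f1 val_ntilde1 h /=; apply/eqP; congr (Some _, _); last first.
  by apply: val_inj; rewrite /= val_nominus val_ntilde1 h subn1.
by apply: val_inj; rewrite /= val_rm2.
Qed.

Local Notation le x y := (leT r x y).

Lemma leT_trans y x z : le x y -> le y z -> le x z.
Proof. exact: connect_trans. Qed.

Lemma leT_below x y : below r x y -> le x y.
Proof. exact: connect1. Qed.

Lemma leT_desc (j : N) (i i' : N) : i' <= i -> le (Some i', j) (Some i, j).
Proof.
have [n] := ubnP (i - i'); elim: n i => // n IH i hn hi.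
have [h|h] := eqVneq (i' : nat) i; first by rewrite (val_inj h); exact: connect0.
have hp := ntilde_lt i.
have hv : nord i.-1 = i.-1 :> nat by rewrite val_nord //; lia.
apply: (leT_trans (y := (Some (nord i.-1), j))).
  by apply: IH; lia.
by apply/leT_below/below_pred; lia.
Qed.

Lemma leT_inf (x : Th) (j : N) : x.2 = j -> wdeg x <= aexp j + j.*2 -> le x (None, j).
Proof.
have h1 := aexp_gt0 j; have h2 := aexp_le j.
case: x => [[i|] j'] /= -> ; last by move=> _; exact: connect0.
rewrite wdegS; case: ifP => hi hw; last by lia.
have hv : nord (aexp j).-1 = (aexp j).-1 :> nat by rewrite val_nord //; lia.
apply: (leT_trans (y := (Some (nord (aexp j).-1), j))).
  by apply: leT_desc; lia.
by apply/leT_below/below_inf_pred; lia.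
Qed.

Lemma leT_layer x y : x.2 = y.2 -> wdeg x <= wdeg y -> le x y.
Proof.
case: y => [[i|] j] /= hx hw; last exact: leT_inf.
have h1 := aexp_gt0 j; have h2 := aexp_le j; have h3 := ntilde_lt i.
move: hw; rewrite wdegS; case: ifP => hi hw.
  apply: (leT_trans (y := (None, j))); first by apply: leT_inf.
  apply: (leT_trans (y := (Some ord0, j))); last exact: leT_desc.
  exact/leT_below/below_0inf.
have hm : nord p.-1 = p.-1 :> nat by rewrite val_nord //; lia.
have ha : nord (aexp j) = aexp j :> nat by rewrite val_nord //; lia.
(* The index [aexp j] has p - 1 as exponent of X, so the swap relation leads from it to the index p
   - 1, from which all the others descend. *)
have top : le (Some (nord p.-1), j) (Some i, j).
  apply: (leT_trans (y := (Some (nord (aexp j)), j))); last by apply: leT_desc; lia.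
  apply/leT_below/below_swap; first by rewrite -val_eqE /= ha; lia.
  by rewrite hm xexpE ha ltnn; lia.
apply: leT_trans top.
case: x hx {hw} => [[i'|] j'] /= ->; first by apply: leT_desc; have := ntilde_lt i'; lia.
apply: (leT_trans (y := (Some ord0, j))); first exact/leT_below/below_0inf.
exact: leT_desc.
Qed.

Lemma wdeg_max x : wdeg x <= aexp x.2 + p.-1 + x.2.*2.
Proof. by case: x => [[i|] j]; rewrite ?wdegS ?wdegN /=; try case: ifP => _; lia. Qed.

Lemma wdeg_cases x :
  wdeg x = aexp x.2 + x.2.*2 \/ wdeg x = aexp x.2 + p.-1 + x.2.*2.
Proof. by case: x => [[i|] j]; rewrite ?wdegS ?wdegN /=; try case: ifP => _; lia. Qed.

Lemma leT_wdeg x y : le x y = le_wdeg x y.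
Proof.
apply/idP/idP.
  move/connectP=> [s]; elim: s x => [|z s IH] x /= => [_ ->|/andP[xz zs] hy].
    exact: le_wdeg_refl.
  by apply: le_wdeg_trans (IH _ zs hy); exact: below_le_wdeg.
case/andP => h2 hw.
have [n] := ubnP (y.2 - x.2); elim: n y h2 hw => // n IH y h2 hw hn.
have [h|h] := eqVneq (x.2 : nat) y.2; first by apply: leT_layer => //; exact: val_inj.
have hlt : x.2 < y.2 by lia.
have hpy := ntilde_lt y.2.
set j' := nord y.2.-1; have hj' : j' = y.2.-1 :> nat by rewrite val_nord //; lia.
have hS : y.2 = j'.+1 :> nat by lia.
have h1 := aexp_gt0 y.2; have h2' := aexp_le y.2.
have h3 := aexp_gt0 j'; have h4 := aexp_le j'.
have hx1 := wdeg_max x; have h5 := aexp_gt0 x.2; have h6 := aexp_le x.2.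
have aS : aexp j' = if aexp y.2 + 2 <= p.-1 then aexp y.2 + 2
                    else aexp y.2 + 2 - p.-1 by rewrite hS; exact: aexpS.
(* Go down one layer: look for y' in the layer of y at which a generating relation leads to layer
   [j'] without falling below the degree of x. *)
suff [y' [z [ey el hz hzw]]] : exists y' z : Th, [/\ y'.2 = y.2 /\ wdeg y' <= wdeg y,
    below r z y', z.2 = j' & wdeg x <= wdeg z].
  case: ey => ey1 ey2.
  apply: (leT_trans (y := z)); first by apply: IH => //; rewrite hz; lia.
  by apply: leT_trans (leT_layer ey1 ey2); exact: leT_below.
(* The larger of the two degrees of a layer does not decrease from layer [x.2] up to layer [j']. *)
have xmax : wdeg x <= aexp j' + p.-1 + j'.*2.
  have hc : forall d a : nat, x.2 + d = a -> aexp x.2 <= aexp a + d.*2.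
    elim=> [|d IHd] a; first by rewrite addn0 => ->; rewrite addn0.
    rewrite addnS => hda; case: a hda => // a [hda].
    have := IHd _ hda; have := aexpS a; have := aexp_gt0 a.+1; case: ifP => _; lia.
  have := hc (j' - x.2) j'; have -> : x.2 + (j' - x.2) = j' by lia.
  by move=> /(_ erefl); lia.
have hv : nord p.-1 = p.-1 :> nat by rewrite val_nord //; lia.
have hva : nord (aexp y.2) = aexp y.2 :> nat by rewrite val_nord //; lia.
case: (wdeg_cases y) => hy; last first.
  exists (Some (nord p.-1), y.2), (Some (nord p.-1), j'); split=> //.
  - by split=> //; rewrite wdegS hv; case: ifP; lia.
  - exact: below_layer.
  - by rewrite wdegS hv; case: ifP; lia.
have [hsmall|hbig] := leqP (aexp y.2 + 2) p.-1.
  exists (Some ord0, y.2), (Some ord0, j'); split=> //.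
  - by split=> //; rewrite wdegS /=; case: ifP; lia.
  - exact: below_layer.
  - by rewrite wdegS /=; move: aS; rewrite hsmall; case: ifP; lia.
(* Here the representative wraps around: the smaller degree of the layer of y equals the larger one
   of layer [j'], and it is reached by replacing one D by X^2 in the vector at infinity. *)
exists (None, y.2), (Some (nord (aexp y.2)), j'); split=> //.
- by split=> //; rewrite wdegN; lia.
- exact: below_inf_layer.
- by rewrite wdegS hva; move: aS; rewrite leqNgt hbig /=; case: ifP; lia.
Qed.

(** A nonempty I records a carry, which is the extra p - 1 in the degree. *)
Definition wdegT (T : tcode p 1) : nat :=
  aexp T.2 + (if T.1 == set0 then 0 else p.-1) + T.2.*2.

Definition le_wdegT (T T' : tcode p 1) : bool :=
  (T.2 <= T'.2) && (wdegT T <= wdegT T').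

Definition type_of (x : Th) : tcode p 1 :=
  (if wdeg x == aexp x.2 + x.2.*2 then set0 else setT, x.2).

Lemma set1_cases (I : {set 'I_1}) : I = set0 \/ I = setT.
Proof.
have [->|[i]] := set_0Vmem I; first by left.
rewrite ord1 => h; right; apply/setP=> k.
by rewrite ord1 h inE.
Qed.

Lemma setT_neq0 : ([set: 'I_1] == set0) = false.
Proof. by apply/negP => /eqP/setP/(_ ord0); rewrite !inE. Qed.

Lemma wdegT_type_of x : wdegT (type_of x) = wdeg x.
Proof.
rewrite /wdegT /type_of /=.
by case: (wdeg_cases x) => h; case: (wdeg x =P _) => h'; rewrite ?eqxx ?setT_neq0; lia.
Qed.

Lemma wdegT_inj (T T' : tcode p 1) : T.2 = T'.2 -> wdegT T = wdegT T' -> T = T'.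
Proof.
case: T T' => [I j] [I' j'] /= ->; rewrite /wdegT /=.
by case: (set1_cases I) => ->; case: (set1_cases I') => ->;
  rewrite ?eqxx ?setT_neq0 // => h; exfalso; lia.
Qed.

Lemma le_wdegT_anti T T' : le_wdegT T T' -> le_wdegT T' T -> T = T'.
Proof.
rewrite /le_wdegT => /andP[h1 h2] /andP[h3 h4]; apply: wdegT_inj; last by lia.
by apply: val_inj => /=; lia.
Qed.

Lemma le_wdegE x y : le_wdeg x y = le_wdegT (type_of x) (type_of y).
Proof. by rewrite /le_wdeg /le_wdegT !wdegT_type_of. Qed.

(** With a single digit, the digit sum is [aexp j] or [aexp j + p.-1]. Only the value p - 1 fits
    both carry sets, and it is settled by the convention that I is then empty. *)
Lemma carry_setE (i j : N) :
  carry_set i (nsub (rm2 r j) i) = (type_of (Some i, j)).1.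
Proof.
rewrite /carry_set /type_of /= wdegS.
have h1 := aexp_gt0 j; have h2 := aexp_le j; have h3 := ntilde_lt i.
have hx := xexpE i j; rewrite /xexp /= in hx.
have ch I : is_carry_set i (nsub (rm2 r j) i) I =
    (I == if i < aexp j then set0 else setT).
  have dE : digit i (@ord0 0) + digit (nsub (rm2 r j) i) (@ord0 0) =
     if i < aexp j then aexp j else aexp j + p.-1.
    by rewrite !digit_f1 hx; case: ifP => h; lia.
  rewrite /is_carry_set.
  have allE (P : pred 'I_1) : [forall k, P k] = P ord0.
    by apply/forallP/idP => [/(_ ord0)|h k] //; rewrite ord1.
  rewrite !allE [ord_pred _]ord1 dE.
  case: (set1_cases I) => ->; rewrite !inE ?setT_neq0 ?eqxx;
    by case: ifP => h; rewrite ?eqxx ?[set0 == _]eq_sym ?setT_neq0; lia.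
case: pickP => [I|/(_ (if i < aexp j then set0 else setT))]; rewrite ch ?eqxx //.
by move/eqP=> -> /=; case: ifP => h; case: eqP => //; lia.
Qed.

Lemma has_typeE x T : has_type r x T = (T == type_of x).
Proof.
apply/existsP/eqP => [[i /andP[/andP[h1 h2] /eqP h3]]|->].
  rewrite !leT_wdeg !le_wdegE in h1 h2.
  have -> := le_wdegT_anti h1 h2.
  by rewrite [LHS]surjective_pairing h3 carry_setE.
have hr : reflexive (equivT r) by move=> y; rewrite /equivT /leT connect0.
case: x => [[i|] j].
  by exists i; rewrite hr carry_setE eqxx.
(* The index 0 is a finite representative of the class of infinity: these are X^a D^j and Y^a
   D^j. *)
exists ord0; rewrite [(type_of _).2]/= carry_setE /equivT !leT_wdeg /le_wdeg.
have h1 := aexp_gt0 j; rewrite wdegN wdegS h1 !leqnn /=; apply/eqP.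
by rewrite /type_of wdegN wdegS h1 /=.
Qed.

Lemma type_of_surj T : exists x, type_of x = T.
Proof.
case: T => I j; have h1 := aexp_gt0 j; have h2 := aexp_le j.
have [->|->] := set1_cases I.
  by exists (None, j); rewrite /type_of /= wdegN eqxx.
have hv : nord p.-1 = p.-1 :> nat by rewrite val_nord //; lia.
exists (Some (nord p.-1), j); rewrite /type_of /= wdegS hv.
case: ifP => // h; exfalso; move: h; case: ifP => h; lia.
Qed.

Lemma le_typeE T T' : le_type r T T' = le_wdegT T T'.
Proof.
apply/existsP/idP => [[x /existsP[y /and3P[]]]|].
  by rewrite !has_typeE leT_wdeg le_wdegE => /eqP-> /eqP->.
have [x hx] := type_of_surj T; have [y hy] := type_of_surj T'.
move=> h; exists x; apply/existsP; exists y.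
by rewrite !has_typeE hx hy !eqxx leT_wdeg le_wdegE hx hy.
Qed.

Definition down_closed (D : {pred tcode p 1}) : Prop :=
  forall T T', le_wdegT T' T -> T \in D -> T' \in D.
Definition below_type (T : tcode p 1) : {pred tcode p 1} := [pred T' | le_wdegT T' T].
Definition strictly_below (T : tcode p 1) : {pred tcode p 1} := [pred T' | (T' != T) && le_wdegT T' T].
Lemma le_wdegT_refl T : le_wdegT T T.
Proof. by rewrite /le_wdegT !leqnn. Qed.

Lemma le_wdegT_trans T T' T'' : le_wdegT T T' -> le_wdegT T' T'' -> le_wdegT T T''.
Proof.
move=> /andP[h1 h2] /andP[h3 h4].
by rewrite /le_wdegT (leq_trans h1 h3) (leq_trans h2 h4).
Qed.

Lemma down_below T : down_closed (below_type T).
Proof. by move=> T1 T2 h1 h2; exact: le_wdegT_trans h1 h2. Qed.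

Lemma down_strict T : down_closed (strictly_below T).
Proof.
move=> T1 T2 h1 /andP[h2 h3]; rewrite inE (le_wdegT_trans h1 h3) andbT.
apply: contra h2 => /eqP e; rewrite e in h1; apply/eqP.
exact: (le_wdegT_anti h3 h1).
Qed.

(** A linear extension of the order on types; it allows types to be added or removed one at a
    time. *)
Definition rankT (T : tcode p 1) : nat := (T.2).*2 + (T.1 != set0).

Lemma rankT_le T T' : le_wdegT T T' -> (rankT T <= rankT T')%N.
Proof.
rewrite /le_wdegT /rankT /wdegT => /andP[].
rewrite leq_eqVlt => /orP[/eqP e|h _]; last by case: (_ == _); case: (_ == _) => /=; lia.
rewrite e; do 2 case: (_ == set0) => //=; lia.
Qed.

Lemma rankT_inj : injective rankT.
Proof.
move=> T T' h; have e : T.2 = T'.2.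
  by apply: val_inj; move: h; rewrite /rankT /=; do 2 case: (_ == set0) => /=; lia.
apply: (wdegT_inj) => //; move: h; rewrite /rankT /wdegT e.
by do 2 case: (_ == set0) => //=; lia.
Qed.

End Exponents.

Arguments rankT {p} T.

(* [A] is the ring of dual numbers over [k] with [w] for epsilon, as is O/m^2
   when e > 1. *)
Record dual_numbers (A : finComUnitRingType) (k : finFieldType)
    (red : {rmorphism A -> k}) (tau : k -> A) (w : A) : Prop := DualNumbers {
  tau1 : tau 1 = 1;
  tauM : {morph tau : x y / x * y};
  tauD : {morph tau : x y / x + y};
  red_tau : cancel tau red;
  sqr_w : w * w = 0;
  tau_w_inj : forall c, tau c * w = 0 -> c = 0;
  dual_decomp : forall a, exists c, a = tau (red a) + tau c * w }.

(** * Dual numbers and coordinates on the bottom row *)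

Section DualNumbers.
Variables (A : finComUnitRingType) (k : finFieldType) (red : {rmorphism A -> k}).
Variables (tau : k -> A) (w : A) (dA : dual_numbers red tau w).

Lemma tau0 : tau 0 = 0.
Proof. by apply: (addrI (tau 0)); rewrite -(tauD dA) !addr0. Qed.

Lemma tauN x : tau (- x) = - tau x.
Proof. by apply: (addrI (tau x)); rewrite -(tauD dA) !subrr tau0. Qed.

Definition eps (a : A) : k := odflt 0 [pick c | a == tau (red a) + tau c * w].

Lemma epsE a : a = tau (red a) + tau (eps a) * w.
Proof.
rewrite {1}/eps; case: pickP => [c /eqP //|h].
by have [c hc] := dual_decomp dA a; have := h c; rewrite -hc eqxx.
Qed.

Lemma red_w : red w = 0.
Proof.
have : red w * red w = 0 by rewrite -rmorphM (sqr_w dA) rmorph0.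
by move/eqP; rewrite mulf_eq0 orbb => /eqP.
Qed.

Lemma eps_uniq a b c : a = tau b + tau c * w -> eps a = c.
Proof.
move=> h.
have hb : red a = b by rewrite h rmorphD rmorphM red_w mulr0 addr0 (red_tau dA).
have : tau (eps a) * w = tau c * w.
  by apply: (addrI (tau (red a))); rewrite -epsE hb.
move/eqP; rewrite -subr_eq0 -mulrBl -tauN -(tauD dA) => /eqP/(tau_w_inj dA).
by move/eqP; rewrite subr_eq0 => /eqP.
Qed.

Lemma epsD a b : eps (a + b) = eps a + eps b.
Proof.
apply: (@eps_uniq _ (red a + red b)).
by rewrite {1}(epsE a) {1}(epsE b) !(tauD dA); ring.
Qed.

Lemma epsM a b : eps (a * b) = red a * eps b + eps a * red b.
Proof.
apply: (@eps_uniq _ (red a * red b)).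
rewrite {1}(epsE a) {1}(epsE b) !(tauD dA, tauM dA).
have h : tau (eps a) * w * (tau (eps b) * w) = 0.
  by rewrite mulrACA (sqr_w dA) mulr0.
rewrite mulrDl !mulrDr h; ring.
Qed.

Lemma epsN a : eps (- a) = - eps a.
Proof.
by apply: (@eps_uniq _ (- red a)); rewrite {1}(epsE a) !tauN; ring.
Qed.

Lemma eps_tau c : eps (tau c) = 0.
Proof. by apply: (@eps_uniq _ c); rewrite tau0 mul0r addr0. Qed.

Lemma eps_tau_w c : eps (tau c * w) = c.
Proof. by apply: (@eps_uniq _ 0); rewrite tau0 add0r. Qed.

Lemma red_tau_w c : red (tau c * w) = 0.
Proof. by rewrite rmorphM red_w mulr0. Qed.

Lemma eps0 : eps 0 = 0.
Proof. by rewrite -{1}tau0 eps_tau. Qed.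

Lemma eps1 : eps 1 = 0.
Proof. by rewrite -(tau1 dA) eps_tau. Qed.

Lemma dual_eq a b : red a = red b -> eps a = eps b -> a = b.
Proof. by move=> h1 h2; rewrite (epsE a) (epsE b) h1 h2. Qed.

Lemma unit_red a : (a \is a GRing.unit) = (red a != 0).
Proof.
apply/idP/idP => [|h]; first by move/(rmorph_unit red); rewrite unitfE.
apply/unitrPr; exists (tau (red a)^-1 - tau (eps a / red a ^+ 2) * w).
apply: dual_eq.
  by rewrite rmorphM rmorphB red_tau_w (red_tau dA) subr0 rmorph1 divff.
rewrite epsM !epsD epsN rmorphD rmorphN red_tau_w (red_tau dA) eps_tau eps_tau_w eps1.
by field.
Qed.

Definition mx2 (a b c d : A) : 'M[A]_2 :=
  \matrix_(i, j) if i == 0 then (if j == 0 then a else b)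
                 else (if j == 0 then c else d).

Lemma det2 (M : 'M[A]_2) : \det M = M 0 0 * M 1 1 - M 0 1 * M 1 0.
Proof.
rewrite (expand_det_row _ 0) !big_ord_recl big_ord0 /cofactor !det_mx11 !mxE /=.
rewrite addr0 /bump /= expr0 expr1 mul1r.
have -> : lift (0 : 'I_2) (0 : 'I_1) = 1 by apply: val_inj.
have -> : lift (1 : 'I_2) (0 : 'I_1) = 0 by apply: val_inj.
by rewrite mulN1r mulrN.
Qed.

Local Notation GL := {'GL_2[A]}.

Lemma glmxM (g h : GL) i j :
  glmx (g * h)%g i j = glmx g i 0 * glmx h 0 j + glmx g i 1 * glmx h 1 j.
Proof.
rewrite /glmx GL_MxE mxE !big_ord_recl big_ord0 addr0.
by have -> : lift (0 : 'I_2) (0 : 'I_1) = 1 by apply: val_inj.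
Qed.

Lemma glmx1 (i j : 'I_2) : glmx (1%g : GL) i j = (i == j)%:R.
Proof. by rewrite /glmx GL_1E mxE. Qed.

Lemma glmx_inj : injective (@glmx A).
Proof. by move=> g h e; apply: val_inj. Qed.

Lemma glmx_eq (g h : GL) : glmx g 0 0 = glmx h 0 0 -> glmx g 0 1 = glmx h 0 1 ->
  glmx g 1 0 = glmx h 1 0 -> glmx g 1 1 = glmx h 1 1 -> g = h.
Proof.
move=> h1 h2 h3 h4; apply: glmx_inj; apply/matrixP=> i j.
have cs (l : 'I_2) : l = 0 \/ l = 1.
  by case: l => [[|[|l]] hl] //; [left|right]; apply: val_inj.
by case: (cs i) => ->; case: (cs j) => ->.
Qed.

Lemma det_glmx_unit (g : GL) : \det (glmx g) \is a GRing.unit.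
Proof. by rewrite -unitmxE; exact: (valP g). Qed.

Lemma red_det_neq0 (g : GL) : red (\det (glmx g)) != 0.
Proof. by rewrite -unit_red det_glmx_unit. Qed.

Lemma bottom_row_neq0 (g : GL) : (red (glmx g 1 0) != 0) || (red (glmx g 1 1) != 0).
Proof.
rewrite -negb_and; apply/negP => /andP[/eqP h1 /eqP h2].
have := red_det_neq0 g.
by rewrite det2 rmorphB !rmorphM h1 h2 !mulr0 subr0 eqxx.
Qed.

(** The identity stands in for a singular matrix, so that families such as [torus] are defined on
    all of k. *)
Definition gl2 (a b c d : A) : GL := insubd (1%g : GL) (mx2 a b c d).

Lemma glmx_gl2 a b c d : red a * red d - red b * red c != 0 ->
  glmx (gl2 a b c d) = mx2 a b c d.
Proof.
move=> h; rewrite /glmx /gl2 /insubd; case: insubP => [u _ -> //|/negP[]].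
rewrite -[_ \is a _]/(_ \in unitmx) unitmxE det2 !mxE /=.
by rewrite unit_red rmorphB !rmorphM.
Qed.

Variables (E : fieldType) (iota : {rmorphism k -> E}).

Definition Xc (g : GL) : E := iota (red (glmx g 1 0)).
Definition Yc (g : GL) : E := iota (red (glmx g 1 1)).
Definition dcoord (g : GL) : k :=
  red (glmx g 1 0) * eps (glmx g 1 1) - eps (glmx g 1 0) * red (glmx g 1 1).
Definition Dc (g : GL) : E := iota (dcoord g).

Local Notation dt g := (detE red iota g).
Local Notation rE a := (iota (red a)).
Local Notation eE a := (iota (eps a)).

Lemma detEM (g h : GL) : dt (g * h)%g = dt g * dt h.
Proof. by rewrite /detE /redE /glmx GL_MxE det_mulmx !rmorphM. Qed.

Lemma XcM (g h : GL) :
  Xc (g * h)%g = rE (glmx h 0 0) * Xc g + rE (glmx h 1 0) * Yc g.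
Proof. by rewrite /Xc /Yc glmxM !(rmorphD, rmorphM); ring. Qed.

Lemma YcM (g h : GL) :
  Yc (g * h)%g = rE (glmx h 0 1) * Xc g + rE (glmx h 1 1) * Yc g.
Proof. by rewrite /Xc /Yc glmxM !(rmorphD, rmorphM); ring. Qed.

(** The infinitesimal part of the row of [g * h] is that of [g] times the reduction of [h], plus the
    reduced row of [g] times the infinitesimal part of [h]. The first summand contributes the
    determinant factor, the second the quadratic form. *)
Lemma DcM (g h : GL) : Dc (g * h)%g = dt h * Dc g +
   ((rE (glmx h 0 0) * Xc g + rE (glmx h 1 0) * Yc g) *
      (eE (glmx h 0 1) * Xc g + eE (glmx h 1 1) * Yc g)
    - (eE (glmx h 0 0) * Xc g + eE (glmx h 1 0) * Yc g) *
      (rE (glmx h 0 1) * Xc g + rE (glmx h 1 1) * Yc g)).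
Proof.
rewrite /Dc /dcoord /Xc /Yc /detE /redE det2 !glmxM !(epsD, epsM).
by rewrite !(rmorphD, rmorphN, rmorphM); ring.
Qed.

End DualNumbers.

(** * Power sums *)

Section PrimeField.
Variables (p : nat) (p_prime : prime p) (k : finFieldType) (hk : #|k| = p).

Lemma expf_prime_card (c : k) : c != 0 -> c ^+ p.-1 = 1.
Proof.
move=> c0; apply: (mulfI c0); rewrite -exprS prednK ?prime_gt0 // mulr1.
by rewrite -hk expf_card.
Qed.

Lemma natr_prime_card : p%:R = 0 :> k.
Proof.
have /= [q q_pr q_ch] := finPcharP k.
suff -> : p = q by apply/eqP; move: q_ch; rewrite inE => /andP[].
have [n] : exists n, #|k| = (q ^ n)%N by eexists; exact: card_primeChar q_ch.
rewrite hk => h; apply/esym/prime_nt_dvdP => //.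
  by apply/eqP => h'; move: q_pr; rewrite h'.
rewrite h; case: n h => [h|n _]; last by rewrite expnS dvdn_mulr.
by move: p_prime; rewrite h.
Qed.

Lemma pchar_prime_card : p \in [pchar k].
Proof. by rewrite inE p_prime natr_prime_card eqxx. Qed.

Lemma sum_expf (m : nat) :
  \sum_(c : k) c ^+ m = if (0 < m)%N && (p.-1 %| m)%N then - 1 else 0.
Proof.
have p1 := prime_gt1 p_prime.
have sum1 : \sum_(c : k | c != 0) (1 : k) = -1.
  have : \sum_(c : k) (1 : k) = 0 by rewrite sumr_const hk natr_prime_card.
  rewrite (bigD1 (0 : k)) //= => /eqP; rewrite addrC addr_eq0 => /eqP ->.
  by [].
case: m => [|m] /=; first by rewrite sumr_const hk natr_prime_card.
rewrite (bigD1 (0 : k)) //= expr0n /= add0r.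
case: ifP => [/dvdnP[q ->]|hm].
  rewrite -sum1; apply: eq_bigr => c c0.
  by rewrite mulnC exprM expf_prime_card // expr1n.
(* Since X^d - 1 has at most d < p - 1 roots, some nonzero z is not one of them. Substituting z c
   for c multiplies the sum by a factor different from 1, so it is 0. *)
have [z z0 zm] : exists2 z : k, z != 0 & z ^+ (m.+1 %% p.-1) != 1.
  set d := (m.+1 %% p.-1)%N.
  have d0 : (0 < d)%N by rewrite lt0n; apply/negP => /eqP h; rewrite /dvdn -/d h in hm.
  have dlt : (d < p.-1)%N by rewrite ltn_pmod //; case: (p) p1 => [|[|]].
  have [z /andP[z0 zm]|h] := pickP [pred z : k | (z != 0) && (z ^+ d != 1)].
    by exists z.
  have Pn0 : 'X^d - 1 != 0 :> {poly k} by rewrite -size_poly_eq0 size_XnsubC.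
  have rt : all (root ('X^d - 1)) (enum [pred z : k | z != 0]).
    apply/allP => z; rewrite mem_enum inE => z0.
    have := h z; rewrite /= z0 /= => /negbFE/eqP hz.
    by rewrite /root !hornerE hz subrr.
  have := max_poly_roots Pn0 rt (enum_uniq _).
  rewrite size_XnsubC // -cardE.
  have -> : #|[pred z : k | z != 0]| = p.-1.
    have := cardC (pred1 (0 : k)); rewrite card1 hk => hc.
    by rewrite -hc add1n /=; apply: eq_card => x; rewrite !inE.
  by rewrite ltnS leqNgt dlt.
have zm' : z ^+ m.+1 != 1.
  by rewrite (divn_eq m.+1 p.-1) exprD mulnC exprM expf_prime_card // expr1n mul1r.
apply/eqP; have : (z ^+ m.+1 - 1) * \sum_(c : k | c != 0) c ^+ m.+1 = 0.
  rewrite mulrBl mul1r mulr_sumr; apply/eqP; rewrite subr_eq0; apply/eqP.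
  rewrite [RHS](reindex_onto (fun c => z * c) (fun c => z^-1 * c)) /=; last first.
    by move=> c _; rewrite mulVKf.
  apply: eq_big => [c|c _]; last by rewrite exprMn.
  by rewrite mulf_eq0 negb_or z0 mulKf // eqxx andbT.
by move/eqP; rewrite mulf_eq0 subr_eq0 (negPf zm').
Qed.

Variables (p_ge5 : (5 <= p)%N) (E : fieldType) (iota : {rmorphism k -> E}).

Lemma expr_red_exp (c : k) n : iota c ^+ n = iota c ^+ red_exp p n.
Proof.
rewrite -!rmorphXn; congr (iota _).
have [d hd] := red_exp_decomp p_ge5 n.
case: n hd => [|n] hd; first by [].
have h0 : (0 < red_exp p n.+1)%N by rewrite red_exp_gt0.
have [->|c0] := eqVneq c 0; first by rewrite !expr0n gtn_eqF.
by rewrite {1}hd exprD mulnC exprM expf_prime_card // expr1n mulr1.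
Qed.

Lemma natr_iota_neq0 n : (0 < n < p)%N -> n%:R != 0 :> E.
Proof.
case/andP=> n0 np; rewrite -(rmorph_nat iota) fmorph_eq0.
by rewrite -(dvdn_pcharf pchar_prime_card) gtnNdvd.
Qed.

Lemma sum_iota_exp (m : nat) :
  \sum_(c : k) iota c ^+ m = if (0 < m)%N && (p.-1 %| m)%N then - 1 else 0.
Proof.
under eq_bigr do rewrite -rmorphXn.
by rewrite -rmorph_sum sum_expf; case: ifP; rewrite ?rmorphN ?rmorph1 ?rmorph0.
Qed.

End PrimeField.

(** * Translations and the group algebra *)

Section Rtrans.
Variables (gT : finGroupType) (E : fieldType).
Local Notation V := {ffun gT -> E^o}.

Lemma rtransD (g : gT) (u v : V) : rtrans g (u + v) = rtrans g u + rtrans g v.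
Proof. by apply/ffunP=> x; rewrite !ffunE. Qed.

Lemma rtransZ (g : gT) a (u : V) : rtrans g (a *: u) = a *: rtrans g u.
Proof. by apply/ffunP=> x; rewrite !ffunE. Qed.

Lemma rtransN (g : gT) (u : V) : rtrans g (- u) = - rtrans g u.
Proof. by rewrite -scaleN1r rtransZ scaleN1r. Qed.

Lemma rtrans0 (g : gT) : rtrans g (0 : V) = 0.
Proof. by apply/ffunP=> x; rewrite !ffunE. Qed.

Lemma rtrans_sum (g : gT) I (s : seq I) (P : pred I) (F : I -> V) :
  rtrans g (\sum_(i <- s | P i) F i) = \sum_(i <- s | P i) rtrans g (F i).
Proof. exact: (big_morph _ (rtransD g) (rtrans0 g)). Qed.

Lemma gstableD (U W : {vspace V}) : gstable U -> gstable W -> gstable (U + W)%VS.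
Proof.
move=> hU hW g v /memv_addP[a aU [b bW ->]]; rewrite rtransD.
by apply: memv_add; [exact: hU|exact: hW].
Qed.

Lemma gstable0 : gstable (0%VS : {vspace V}).
Proof. by move=> g v; rewrite memv0 => /eqP ->; rewrite rtrans0 mem0v. Qed.

(** The action of an element of the group algebra; every stable subspace is closed under it. *)
Definition galg (I : finType) (d : I -> E) (h : I -> gT) (u : V) : V :=
  \sum_(c : I) d c *: rtrans (h c) u.

Variables (I : finType) (d : I -> E) (h : I -> gT).

Lemma galgD (u v : V) : galg d h (u + v) = galg d h u + galg d h v.
Proof.
by rewrite /galg -big_split; apply: eq_bigr => c _; rewrite rtransD scalerDr.
Qed.

Lemma galgZ a (u : V) : galg d h (a *: u) = a *: galg d h u.
Proof.
rewrite /galg scaler_sumr; apply: eq_bigr => c _.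
by rewrite rtransZ !scalerA mulrC.
Qed.

Lemma galg0 : galg d h 0 = 0.
Proof. by have := galgZ 0 0; rewrite !scale0r. Qed.

Lemma galg_mem (U : {vspace V}) u : gstable U -> u \in U -> galg d h u \in U.
Proof. by move=> hU hu; apply: memv_suml => c _; rewrite memvZ // hU. Qed.

End Rtrans.

(** * Monomials in the coordinates *)

Section Monomials.
Variables (p : nat) (p_prime : prime p) (p_ge5 : (5 <= p)%N).
Variables (A : finComUnitRingType) (k : finFieldType) (red : {rmorphism A -> k}).
Variables (tau : k -> A) (w : A) (dA : dual_numbers red tau w) (hk : #|k| = p).
Variables (E : fieldType) (iota : {rmorphism k -> E}) (s : nat).

Local Notation GL := {'GL_2[A]}.
Local Notation V := {ffun GL -> E^o}.
Local Notation xc g := (Xc red iota g).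
Local Notation yc g := (Yc red iota g).
Local Notation dc g := (Dc red tau w iota g).
Local Notation dt g := (detE red iota g).

Definition mono (l i j : nat) : V :=
  [ffun g => dt g ^+ s * (xc g ^+ l * yc g ^+ i * dc g ^+ j)].

Lemma mono_red_exp l i j : mono l i j = mono (red_exp p l) (red_exp p i) j.
Proof.
apply/ffunP=> g; rewrite !ffunE /Xc /Yc.
by rewrite -!(expr_red_exp p_prime hk p_ge5).
Qed.

Lemma mono_eq_mod l l' i i' j :
  red_exp p l = red_exp p l' -> red_exp p i = red_exp p i' -> mono l i j = mono l' i' j.
Proof. by move=> h1 h2; rewrite mono_red_exp h1 h2 -mono_red_exp. Qed.

Definition unip (c : k) : GL := gl2 1 (tau c) 0 1.
Definition trans_xx (c : k) : GL := gl2 1 (tau c * w) 0 1.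
Definition trans_xy (c : k) : GL := gl2 1 0 0 (1 + tau c * w).
Definition torus (c : k) : GL := gl2 1 0 0 (tau c).
Definition swap : GL := antidiag 0.

Lemma glmx_unip c : glmx (unip c) = mx2 1 (tau c) 0 1.
Proof. by rewrite (glmx_gl2 dA) // !rmorph1 rmorph0 mulr0 subr0 mulr1 oner_neq0. Qed.
Lemma glmx_trans_xx c : glmx (trans_xx c) = mx2 1 (tau c * w) 0 1.
Proof. by rewrite (glmx_gl2 dA) // !rmorph1 rmorph0 mulr0 subr0 mulr1 oner_neq0. Qed.
Lemma glmx_trans_xy c : glmx (trans_xy c) = mx2 1 0 0 (1 + tau c * w).
Proof.
rewrite (glmx_gl2 dA) // rmorphD !rmorph1 rmorph0 mulr0 subr0 (red_tau_w dA).
by rewrite addr0 mulr1 oner_neq0.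
Qed.
Lemma glmx_torus c : c != 0 -> glmx (torus c) = mx2 1 0 0 (tau c).
Proof.
by move=> c0; rewrite (glmx_gl2 dA) // rmorph1 rmorph0 mulr0 subr0 (red_tau dA) mul1r.
Qed.
Lemma glmx_swap : glmx swap = mx2 0 1 1 0.
Proof.
apply/matrixP=> i j; rewrite !mxE.
by case: i => [[|[|i]] hi] //; case: j => [[|[|j]] hj].
Qed.

Lemma dt_det2 (g : GL) : dt g = iota (red (glmx g 0 0)) * iota (red (glmx g 1 1))
   - iota (red (glmx g 0 1)) * iota (red (glmx g 1 0)).
Proof. by rewrite /detE /redE det2 !(rmorphB, rmorphM). Qed.

Ltac coords := rewrite ?(XcM, YcM, DcM dA, dt_det2, detEM);
  rewrite ?(glmx_unip, glmx_trans_xx, glmx_trans_xy, glmx_swap);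
  rewrite ?mxE /=;
  rewrite ?(red_tau dA, red_tau_w dA, eps_tau dA, eps_tau_w dA, eps0 dA, eps1 dA,
    epsD dA, rmorph1, rmorph0, rmorphD); try ring.

Lemma X_unip g c : xc (g * unip c)%g = xc g. Proof. by coords. Qed.
Lemma Y_unip g c : yc (g * unip c)%g = yc g + iota c * xc g. Proof. by coords. Qed.
Lemma D_unip g c : dc (g * unip c)%g = dc g. Proof. by coords. Qed.
Lemma dt_unip g c : dt (g * unip c)%g = dt g.
Proof. by rewrite detEM; coords. Qed.

Lemma X_trans_xx g c : xc (g * trans_xx c)%g = xc g. Proof. by coords. Qed.
Lemma Y_trans_xx g c : yc (g * trans_xx c)%g = yc g. Proof. by coords. Qed.
Lemma D_trans_xx g c : dc (g * trans_xx c)%g = dc g + iota c * xc g ^+ 2.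
Proof. by coords. Qed.
Lemma dt_trans_xx g c : dt (g * trans_xx c)%g = dt g.
Proof. by rewrite detEM; coords. Qed.

Lemma X_trans_xy g c : xc (g * trans_xy c)%g = xc g. Proof. by coords. Qed.
Lemma Y_trans_xy g c : yc (g * trans_xy c)%g = yc g. Proof. by coords. Qed.
Lemma D_trans_xy g c : dc (g * trans_xy c)%g = dc g + iota c * (xc g * yc g).
Proof. by coords. Qed.
Lemma dt_trans_xy g c : dt (g * trans_xy c)%g = dt g.
Proof. by rewrite detEM; coords. Qed.

Lemma X_swap g : xc (g * swap)%g = yc g. Proof. by coords. Qed.
Lemma Y_swap g : yc (g * swap)%g = xc g. Proof. by coords. Qed.
Lemma D_swap g : dc (g * swap)%g = - dc g. Proof. by coords. Qed.
Lemma dt_swap g : dt (g * swap)%g = - dt g.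
Proof. by rewrite detEM; coords. Qed.

Lemma rtrans_swap l i j : rtrans swap (mono l i j) = (-1) ^+ (s + j) *: mono i l j.
Proof.
apply/ffunP=> g; rewrite !ffunE X_swap Y_swap D_swap dt_swap.
by rewrite /GRing.scale /= [(- dt g) ^+ _]exprNn [(- dc g) ^+ _]exprNn exprD; ring.
Qed.

Lemma rtrans_torus c l i j : c != 0 ->
  rtrans (torus c) (mono l i j) = iota c ^+ (s + i + j) *: mono l i j.
Proof.
move=> c0; apply/ffunP=> g; rewrite !ffunE.
have -> : xc (g * torus c)%g = xc g by rewrite XcM glmx_torus //; coords.
have -> : yc (g * torus c)%g = iota c * yc g by rewrite YcM glmx_torus //; coords.
have h : dt (torus c) = iota c by rewrite dt_det2 glmx_torus //; coords.
have -> : dc (g * torus c)%g = iota c * dc g by rewrite (DcM dA) h glmx_torus //; coords.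
rewrite detEM h /GRing.scale /= !exprMn !exprD; ring.
Qed.

(** The range is p for every exponent, so that the expansion has the shape required by
    [lin_coefE]. *)
Lemma exprDn_prime (R : comNzRingType) (x y : R) n : (n < p)%N ->
  (x + y) ^+ n = \sum_(m < p) (x ^+ (n - m) * y ^+ m) *+ 'C(n, m).
Proof.
move=> np; rewrite exprDn (big_ord_widen p (fun m => (x ^+ (n - m) * y ^+ m) *+ 'C(n, m))) //.
rewrite [LHS]big_mkcond; apply: eq_bigr => i _.
by case: ifP => // h; rewrite bin_small //; lia.
Qed.

(* The coefficient of [c] in [c |-> rtrans (h c)]. *)
Definition lin_coef (h : k -> GL) : V -> V := galg (fun c => - iota c ^+ (p - 2)) h.

(** For m < p the exponent p - 2 + m is a positive multiple of p - 1 only if m = 1, so the power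
    sums annihilate all the other terms. *)
Lemma lin_coefE (h : k -> GL) (u : V) (v : nat -> V) :
  (forall c, rtrans (h c) u = \sum_(m < p) iota c ^+ m *: v m) -> lin_coef h u = v 1%N.
Proof.
move=> hu; rewrite /lin_coef /galg.
under eq_bigr => c _ do rewrite hu scaler_sumr.
have p1 : (1 < p)%N by lia.
rewrite exchange_big (bigD1 (Ordinal p1)) //= [X in _ + X]big1 ?addr0 => [|m hm].
  under eq_bigr => c _ do rewrite scalerA mulNr -exprD.
  rewrite -scaler_suml sumrN (sum_iota_exp p_prime hk) //.
  have -> : (p - 2 + 1 = p.-1)%N by lia.
  rewrite dvdnn andbT ifT; last by lia.
  by rewrite opprK scale1r.
under eq_bigr => c _ do rewrite scalerA mulNr -exprD.
rewrite -scaler_suml sumrN (sum_iota_exp p_prime hk) //.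
case: ifP => [|_]; last by rewrite oppr0 scale0r.
case/andP=> m0 /dvdnP[q hq]; move/eqP: hm; case; apply: val_inj => /=.
have := ltn_ord m.
by case: q hq => [|[|q]] hq; nia.
Qed.

(** On monomials whose exponents of Y and D are below p, these three are the differential operators
    X d/dY, X^2 d/dD and XY d/dD. *)
Definition opE : V -> V := lin_coef unip.
Definition opXX : V -> V := lin_coef trans_xx.
Definition opXY : V -> V := lin_coef trans_xy.

Lemma opE_mono l i j : (i < p)%N -> opE (mono l i j) = i%:R *: mono l.+1 i.-1 j.
Proof.
move=> ip; rewrite /opE.
rewrite (lin_coefE (v := fun m => 'C(i, m)%:R *: mono (l + m) (i - m) j)).
  by rewrite bin1 addn1 subn1.
move=> c; apply/ffunP=> g; rewrite !ffunE X_unip Y_unip D_unip dt_unip.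
rewrite exprDn_prime // sum_ffunE !(mulr_suml, mulr_sumr).
apply: eq_bigr => m _; rewrite !ffunE /GRing.scale /= exprMn exprD -mulr_natl; ring.
Qed.

Lemma opXX_mono l i j : (j < p)%N -> opXX (mono l i j) = j%:R *: mono l.+2 i j.-1.
Proof.
move=> jp; rewrite /opXX.
rewrite (lin_coefE (v := fun m => 'C(j, m)%:R *: mono (l + 2 * m) i (j - m))).
  by rewrite bin1 addn2 subn1.
move=> c; apply/ffunP=> g; rewrite !ffunE X_trans_xx Y_trans_xx D_trans_xx dt_trans_xx.
rewrite exprDn_prime // sum_ffunE !(mulr_suml, mulr_sumr).
apply: eq_bigr => m _; rewrite !ffunE /GRing.scale /= exprMn exprD exprM -mulr_natl.
ring.
Qed.

Lemma opXY_mono l i j : (j < p)%N -> opXY (mono l i j) = j%:R *: mono l.+1 i.+1 j.-1.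
Proof.
move=> jp; rewrite /opXY.
rewrite (lin_coefE (v := fun m => 'C(j, m)%:R *: mono (l + m) (i + m) (j - m))).
  by rewrite bin1 !addn1 subn1.
move=> c; apply/ffunP=> g; rewrite !ffunE X_trans_xy Y_trans_xy D_trans_xy dt_trans_xy.
rewrite exprDn_prime // sum_ffunE !(mulr_suml, mulr_sumr).
apply: eq_bigr => m _; rewrite !ffunE /GRing.scale /= !exprMn !exprD -mulr_natl.
ring.
Qed.

(* The exponent makes the coefficient vanish at [c = 0], where [torus c] is a
   junk value. *)
Definition weight_proj (n : nat) : V -> V :=
  galg (fun c => - iota c ^+ (n * (p - 2) + p.-1)) torus.

Lemma weight_proj_mono n l i j : weight_proj n (mono l i j) =
  if s + i + j == n %[mod p.-1] then mono l i j else 0.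
Proof.
rewrite /weight_proj /galg.
have P0 : (0 < p.-1)%N by lia.
under eq_bigr => c _.
  have -> : - iota c ^+ (n * (p - 2) + p.-1) *: rtrans (torus c) (mono l i j)
          = - iota c ^+ (n * (p - 2) + p.-1 + (s + i + j)) *: mono l i j.
    have [->|c0] := eqVneq c 0.
      by rewrite rmorph0 !expr0n !gtn_eqF ?oppr0 ?scale0r // !addn_gt0 P0 !orbT.
    by rewrite rtrans_torus // scalerA mulNr -exprD.
  over.
rewrite -scaler_suml sumrN (sum_iota_exp p_prime hk) // !addn_gt0 P0 orbT /=.
(* Modulo p - 1 the factor p - 2 is -1, so the power sum tests the difference of the two weights. *)
have -> : (p.-1 %| n * (p - 2) + p.-1 + (s + i + j))%N = (s + i + j == n %[mod p.-1]).
  rewrite /dvdn addnAC modnDr -(eqn_modDl (n * (p - 2))).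
  have -> : (n * (p - 2) + n = n * p.-1)%N by nia.
  by rewrite modnMl.
by case: ifP => _; rewrite ?opprK ?oppr0 ?scale1r ?scale0r.
Qed.

Lemma expr_mod_card c m n : c != 0 -> (m = n %[mod p.-1])%N -> iota c ^+ m = iota c ^+ n.
Proof.
move=> c0 h; rewrite (divn_eq m p.-1) (divn_eq n p.-1) h.
have hc q : iota c ^+ (q * p.-1) = 1.
  by rewrite mulnC exprM -rmorphXn (expf_prime_card p_prime hk) // rmorph1 expr1n.
by rewrite !exprD !hc.
Qed.

End Monomials.

(** * Subspaces spanned by parts of a free family *)

Section FreeFamily.
Variables (K : fieldType) (vT : vectType K) (I : finType) (b : I -> vT).

Definition sp (S : {set I}) : {vspace vT} := (\sum_(x in S) <[b x]>)%VS.

Lemma mem_sp x (S : {set I}) : x \in S -> b x \in sp S.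
Proof. by move=> xS; apply: (subvP (sumv_sup x xS (subvv _))); exact: memv_line. Qed.

Lemma spP u (S : {set I}) :
  u \in sp S <-> exists2 c : I -> K, u = \sum_x c x *: b x & forall x, x \notin S -> c x = 0.
Proof.
split=> [/memv_sumP[v hv ->]|[c -> hc]].
  have /fin_all_exists[c hcv] x : exists c, if x \in S then v x = c *: b x else c = 0.
    have [xS|_] := boolP (x \in S); last by exists 0.
    by have /vlineP[c ->] := hv x xS; exists c.
  exists c => [|x xS]; last by have := hcv x; rewrite (negPf xS).
  rewrite [LHS]big_mkcond /=; apply: eq_bigr => x _.
  by have := hcv x; case: ifP => // _ ->; rewrite scale0r.
apply: memv_suml => x _; have [xS|xS] := boolP (x \in S).
  by rewrite memvZ ?mem_sp.
by rewrite hc // scale0r mem0v.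
Qed.

Lemma sp_subP (S : {set I}) (U : {vspace vT}) :
  (forall x, x \in S -> b x \in U) -> (sp S <= U)%VS.
Proof. by move=> h; apply/subv_sumP => x xS; rewrite -memvE h. Qed.

Lemma spS (S S' : {set I}) : S \subset S' -> (sp S <= sp S')%VS.
Proof. by move=> /subsetP h; apply: sp_subP => x /h; exact: mem_sp. Qed.

Lemma spU (S S' : {set I}) : sp (S :|: S') = (sp S + sp S')%VS.
Proof.
apply/eqP; rewrite eqEsubv; apply/andP; split.
  apply: sp_subP => x; rewrite inE => /orP[] xS.
    by rewrite -[b x]addr0 memv_add ?mem_sp ?mem0v.
  by rewrite -[b x]add0r memv_add ?mem_sp ?mem0v.
by rewrite subv_add !spS ?subsetUl ?subsetUr.
Qed.

Lemma sp0 : sp set0 = 0%VS.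
Proof. by rewrite /sp big_set0. Qed.

Lemma sp_bigcup J (P : pred J) (r : seq J) (F : J -> {set I}) :
  sp (\bigcup_(i <- r | P i) F i) = (\sum_(i <- r | P i) sp (F i))%VS.
Proof. exact: (big_morph _ spU sp0). Qed.

Hypothesis b_free : forall c : I -> K, \sum_x c x *: b x = 0 -> forall x, c x = 0.

Lemma coord_uniq (c c' : I -> K) :
  \sum_x c x *: b x = \sum_x c' x *: b x -> c =1 c'.
Proof.
move=> h x; apply/eqP; rewrite -subr_eq0; apply/eqP.
apply: (b_free (c := fun x => c x - c' x)).
by under eq_bigr do rewrite scalerBl; rewrite sumrB h subrr.
Qed.

Lemma sp_coord (c : I -> K) (S : {set I}) :
  \sum_x c x *: b x \in sp S <-> forall x, x \notin S -> c x = 0.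
Proof.
split=> [/spP[c' h hc'] x xS|h]; first by rewrite (coord_uniq h) hc'.
by apply/spP; exists c.
Qed.

Lemma sp_basis (S : {set I}) x : (b x \in sp S) = (x \in S).
Proof.
apply/idP/idP => [|/mem_sp //].
have -> : b x = \sum_y (y == x)%:R *: b y.
  rewrite (bigD1 x) //= eqxx scale1r big1 ?addr0 // => y /negPf ->.
  by rewrite scale0r.
move/sp_coord => h; apply/negPn/negP => /h/eqP.
by rewrite eqxx oner_eq0.
Qed.

Lemma spI (S S' : {set I}) : (sp S :&: sp S')%VS = sp (S :&: S').
Proof.
apply/eqP; rewrite eqEsubv subv_cap !spS ?subsetIl ?subsetIr // !andbT.
apply/subvP => u; rewrite memv_cap => /andP[/spP[c -> hc] /sp_coord hc'].
apply/sp_coord => x; rewrite inE negb_and => /orP[]; [exact: hc|exact: hc'].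
Qed.

Lemma dim_spT : \dim (sp setT) = #|I|.
Proof.
have eqX : sp setT = <<codom_tuple b>>%VS.
  apply/eqP; rewrite eqEsubv; apply/andP; split.
    by apply: sp_subP => x _; apply: memv_span; exact: codom_f.
  by apply/span_subvP => u /codomP[x ->]; exact: mem_sp.
rewrite eqX; have /eqP -> : free (codom_tuple b); last by rewrite size_tuple.
apply/freeP => c hc i.
have : \sum_x c (enum_rank x) *: b x = 0.
  rewrite -[RHS]hc [RHS](reindex (@enum_rank I)) /=; last first.
    by exists enum_val => y _; rewrite ?enum_rankK ?enum_valK.
  by apply: eq_bigr => x _; rewrite (nth_map x) ?nth_enum_rank // -cardE ltn_ord.
by move/b_free/(_ (enum_val i)); rewrite enum_valK.
Qed.

End FreeFamily.

(** * * The second isomorphism theorem for subquotients *)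

Section SecondIso.
Variables (gT : finGroupType) (E : fieldType).

(** The endomorphism is a linear projection of [X.1] to [Y.1] along part of [X.2]. It need not be
    equivariant, but its defect lies both in [Y.1] and in [X.2], hence in [Y.2]. *)
Lemma second_iso (X Y : subquot gT E) : is_subquot X -> is_subquot Y ->
  X.1 = (Y.1 + X.2)%VS -> Y.2 = (Y.1 :&: X.2)%VS -> subquot_iso X Y.
Proof.
move=> hX hY h1 h2; split=> //.
pose f := addv_pi1 Y.1 X.2.
have fE u : u \in X.1 -> [/\ f u \in Y.1 & u - f u \in X.2].
  rewrite h1 => uX; split; first exact: memv_pi1.
  have := addv_pi1_pi2 uX; rewrite -/f => {1}<-.
  by rewrite addrC addKr; exact: memv_pi2.
have mX g u : u \in X.2 -> rtrans g u \in X.2 by case: hX => _ [h _]; exact: h.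
exists f; split.
- by apply/subvP => _ /memv_imgP[u uX ->]; case: (fE u uX).
- move=> u uX; have [fu fu'] := fE u uX; rewrite h2 memv_cap fu /=.
  apply/idP/idP => h; last by rewrite -(subrK u (f u)) memvD // -opprB memvN.
  by rewrite -(subrK (f u) u) memvD.
- apply/subvP => v vY.
  have vX : v \in X.1 by rewrite h1 -[v]addr0 memv_add ?mem0v.
  have [fv fv'] := fE v vX.
  rewrite -(subrK (f v) v) addrC memv_add ?memv_img // h2 memv_cap fv' andbT.
  by rewrite memvB.
- move=> g u uX.
  have guX : rtrans g u \in X.1 by case: hX => h _; exact: h.
  have [fu fu'] := fE u uX; have [fgu fgu'] := fE _ guX.
  rewrite h2 memv_cap; apply/andP; split.
    by rewrite memvB //; case: hY => h _; exact: h.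
  have -> : f (rtrans g u) - rtrans g (f u) =
      rtrans g (u - f u) - (rtrans g u - f (rtrans g u)).
    by rewrite rtransD rtransN opprB [RHS]addrC addrA subrK.
  by rewrite memvB // mX.
Qed.

End SecondIso.

(** * The monomial basis of the principal series *)

Section Basis.
Variables (p : nat) (p_prime : prime p) (p_ge5 : (5 <= p)%N).
Variables (A : finComUnitRingType) (k : finFieldType) (red : {rmorphism A -> k}).
Variables (tau : k -> A) (w : A) (dA : dual_numbers red tau w) (hk : #|k| = p).
Variables (E : fieldType) (iota : {rmorphism k -> E}) (s : nat).
Variables (r : Ntilde p 1) (r0 : (0 < r)%N).

Local Notation GL := {'GL_2[A]}.
Local Notation V := {ffun GL -> E^o}.
Local Notation N := (Ntilde p 1).
Local Notation Th := (Theta p 1).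
Local Notation xc g := (Xc red iota g).
Local Notation yc g := (Yc red iota g).
Local Notation dc g := (Dc red tau w iota g).
Local Notation dt g := (detE red iota g).
Local Notation mon := (mono red tau w iota s).

Definition bas (x : Th) : V := mon (xexp r x) (yexp r x) x.2.

Lemma big_Theta (M : nmodType) (F : Th -> M) :
  \sum_x F x = \sum_j F (None, j) + \sum_i \sum_j F (Some i, j).
Proof.
have -> : \sum_x F x = \sum_o \sum_j F (o, j).
  by rewrite pair_big; apply: eq_bigr => -[].
rewrite (bigD1 None) //=; congr (_ + _).
rewrite (reindex_omap (fun i : N => Some i) id) //=; last by case.
by apply: eq_bigl => i; rewrite eqxx.
Qed.

Lemma poly_fun_eq0 n (c : 'I_n -> E) : (n <= p)%N ->
  (forall t : k, \sum_j c j * iota t ^+ j = 0) -> forall j, c j = 0.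
Proof.
move=> np h.
pose P := \poly_(j < n) (oapp c 0 (insub j)).
have Pt t : P.[iota t] = 0.
  rewrite -[RHS](h t) horner_poly; apply: eq_bigr => j _.
  by rewrite valK.
have P0 : P = 0.
  apply/eqP/negPn/negP => Pn0.
  have rP : all (root P) (map iota (enum k)).
    by apply/allP => _ /mapP[t _ ->]; apply/rootP; exact: Pt.
  have uP : uniq (map iota (enum k)) by rewrite map_inj_uniq ?enum_uniq //; exact: fmorph_inj.
  have := max_poly_roots Pn0 rP uP.
  by rewrite size_map -cardE hk ltnNge (leq_trans (size_poly _ _)).
move=> j; have : P`_j = 0 by rewrite P0 coef0.
by rewrite coef_poly ltn_ord valK.
Qed.

(** [pt] and [ptinf] represent the Borel cosets, that is, the points of the projective line over A.
    The signs are chosen so that D takes the value t at both. *)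
Definition pt (u t : k) : GL := gl2 0 (-1) 1 (tau u + tau t * w).
Definition ptinf (t : k) : GL := gl2 1 0 (tau (- t) * w) 1.

Lemma glmx_pt u t : glmx (pt u t) = mx2 0 (-1) 1 (tau u + tau t * w).
Proof.
by rewrite (glmx_gl2 dA) // rmorphN !rmorph1 rmorph0 mul0r mulr1 sub0r opprK oner_neq0.
Qed.
Lemma glmx_ptinf t : glmx (ptinf t) = mx2 1 0 (tau (- t) * w) 1.
Proof.
by rewrite (glmx_gl2 dA) // !rmorph1 rmorph0 mul0r mulr1 subr0 oner_neq0.
Qed.

Lemma coords_pt u t :
  [/\ xc (pt u t) = 1, yc (pt u t) = iota u, dc (pt u t) = iota t & dt (pt u t) = 1].
Proof.
rewrite dt_det2 /Xc /Yc /Dc /dcoord glmx_pt !mxE /=.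
rewrite !(epsD dA, eps_tau dA, eps_tau_w dA, eps1 dA, rmorph1, rmorph0, rmorphD, rmorphN,
  red_tau dA, red_tau_w dA); split; ring.
Qed.

Lemma coords_ptinf t :
  [/\ xc (ptinf t) = 0, yc (ptinf t) = 1, dc (ptinf t) = iota t & dt (ptinf t) = 1].
Proof.
rewrite dt_det2 /Xc /Yc /Dc /dcoord glmx_ptinf !mxE /=.
rewrite !(epsD dA, eps_tau dA, eps_tau_w dA, eps1 dA, rmorph1, rmorph0, rmorphD, rmorphN,
  red_tau dA, red_tau_w dA); split; ring.
Qed.

Lemma bas_pt x u t :
  bas x (pt u t) = iota u ^+ yexp r x * iota t ^+ x.2.
Proof.
by rewrite ffunE; have [-> -> -> ->] := coords_pt u t; rewrite !expr1n !mul1r.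
Qed.

Lemma bas_ptinf x t :
  bas x (ptinf t) = if x.1 is None then iota t ^+ x.2 else 0.
Proof.
rewrite ffunE; have [-> -> -> ->] := coords_ptinf t; rewrite !expr1n mul1r mulr1.
case: x => [[i|] j] /=; last by rewrite expr0 mul1r.
by rewrite expr0n gtn_eqF ?mul0r // (xexp_gt0 p_ge5 r0).
Qed.

(** At the points [ptinf] only the vectors with index infinity survive, which isolates their
    coefficients. At the points [pt] the rest is a polynomial in u and t of degree at most p - 1 in
    each, vanishing on all of k x k. *)
Lemma bas_free (c : Th -> E) : \sum_x c x *: bas x = 0 -> forall x, c x = 0.
Proof.
move=> h.
have hev g : \sum_x c x * bas x g = 0.
  have e := congr1 (fun u : V => u g) h; rewrite /= sum_ffunE ffunE in e.
  by rewrite -[RHS]e; apply: eq_bigr => x _; rewrite !ffunE.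
have hN : ((p ^ 1).-1.+1 <= p)%N by rewrite expn1; lia.
have cN j : c (None, j) = 0.
  apply: (poly_fun_eq0 (c := fun j => c (None, j)) hN) => t.
  rewrite -[RHS](hev (ptinf t)) big_Theta [X in _ = _ + X]big1 ?addr0 => [|i _].
    by apply: eq_bigr => j' _; rewrite bas_ptinf.
  by rewrite big1 // => j' _; rewrite bas_ptinf mulr0.
suff cS j i : c (Some i, j) = 0 by case=> -[i|] j.
apply: (poly_fun_eq0 (c := fun i => c (Some i, j)) hN) => u.
apply: (poly_fun_eq0 (c := fun j => \sum_i c (Some i, j) * iota u ^+ i) hN) => t.
rewrite -[RHS](hev (pt u t)) big_Theta [X in _ = X + _]big1 ?add0r => [|j' _]; last first.
  by rewrite cN mul0r.
rewrite exchange_big; apply: eq_bigr => j' _; rewrite mulr_suml.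
by apply: eq_bigr => i' _; rewrite bas_pt mulrA.
Qed.

Variable chi : GL -> E.
Hypothesis chiE : {in borel A, forall b, chi b = dt b ^+ s * chi_ red iota r b}.

Lemma borel_coords (b g : GL) : b \in borel A ->
  [/\ xc (b * g)%g = iota (red (glmx b 1 1)) * xc g,
      yc (b * g)%g = iota (red (glmx b 1 1)) * yc g &
      dc (b * g)%g = iota (red (glmx b 1 1)) ^+ 2 * dc g].
Proof.
rewrite inE => /eqP b0; rewrite /Xc /Yc /Dc /dcoord !glmxM b0.
rewrite !mul0r !add0r !(epsM dA) !rmorphM !(rmorphD, rmorphB, rmorphM); split; ring.
Qed.

Lemma borel_diag_neq0 (b : GL) : b \in borel A ->
  red (glmx b 0 0) != 0 /\ red (glmx b 1 1) != 0.
Proof.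
rewrite inE => /eqP b0; have := red_det_neq0 dA b.
by rewrite det2 b0 mulr0 subr0 rmorphM mulf_eq0 negb_or => /andP.
Qed.

Lemma mono_principal l i j : (l + i + j.*2 = r %[mod p.-1])%N ->
  mon l i j \in principal_series chi.
Proof.
move=> h; apply/mem_principal_series => b bB g; rewrite !ffunE chiE //.
have [-> -> ->] := borel_coords g bB; rewrite detEM.
have [_ d0] := borel_diag_neq0 bB.
rewrite /chi_ /redE -(expr_mod_card p_prime hk iota d0 h) -addnn !exprMn !exprD.
ring.
Qed.

Lemma bas_principal x : bas x \in principal_series chi.
Proof. by apply: mono_principal; exact: wdeg_mod. Qed.

Lemma borel_divP (g h : GL) :
  (exists u : A, glmx g 1 0 = u * glmx h 1 0 /\ glmx g 1 1 = u * glmx h 1 1) ->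
  (g * h^-1)%g \in borel A.
Proof.
case=> u [h0 h1]; rewrite inE glmxM h0 h1 -!mulrA -mulrDr -glmxM mulgV glmx1.
by rewrite mulr0.
Qed.

Lemma principal_eq0 (phi : V) : phi \in principal_series chi ->
  (forall u t, phi (pt u t) = 0) -> (forall t, phi (ptinf t) = 0) -> phi = 0.
Proof.
move=> /mem_principal_series hphi h1 h2; apply/ffunP=> g; rewrite [RHS]ffunE.
have aux h : phi h = 0 -> (g * h^-1)%g \in borel A -> phi g = 0.
  by move=> h0 hB; rewrite -(mulgKV h g) hphi // h0 mulr0.
have [x0|] := boolP (red (glmx g 1 0) == 0).
  have := bottom_row_neq0 dA g; rewrite x0 /= => y0.
  have yU : glmx g 1 1 \is a GRing.unit by rewrite (unit_red dA).
  set q := glmx g 1 0 / glmx g 1 1.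
  apply: (aux (ptinf (- eps red tau w q))) => //; apply: borel_divP.
  exists (glmx g 1 1); rewrite glmx_ptinf !mxE /= mulr1; split=> //.
  have := epsE dA q; rewrite rmorphM (eqP x0) mul0r (tau0 dA) add0r opprK => <-.
  by rewrite mulrC divrK.
move=> x0; have xU : glmx g 1 0 \is a GRing.unit by rewrite (unit_red dA).
set q := glmx g 1 1 / glmx g 1 0.
apply: (aux (pt (red q) (eps red tau w q))) => //; apply: borel_divP.
exists (glmx g 1 0); rewrite glmx_pt !mxE /= mulr1; split=> //.
by rewrite -(epsE dA q) mulrC divrK.
Qed.

(** A dimension count: the basis vectors are free, and evaluation at the coset representatives
    embeds the principal series into a space whose dimension is their number. *)
Lemma principal_seriesE : principal_series chi = sp bas setT.
Proof.
apply/esym/eqP; rewrite eqEdim; apply/andP; split.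
  by apply: sp_subP => x _; exact: bas_principal.
rewrite (dim_spT bas_free).
(* The representatives are indexed by [Th] through an enumeration of k, so that both dimensions are
   literally [#|Th|]. *)
pose ev (phi : V) : {ffun Th -> E^o} := [ffun x : Th =>
  if x.1 is Some i then phi (pt (nth 0 (enum k) i) (nth 0 (enum k) x.2))
  else phi (ptinf (nth 0 (enum k) x.2))].
have lin : linear ev.
  by move=> a u v; apply/ffunP=> -[[i|] j]; rewrite !ffunE /= ?ffunE.
pose lm := GRing.isLinear.Build _ _ _ _ ev lin.
pose L : {linear V -> {ffun Th -> E^o}} := HB.pack ev lm.
have inj : (principal_series chi :&: lker (linfun L) = 0)%VS.
  apply/eqP; rewrite -subv0; apply/subvP => phi; rewrite memv_cap memv0 => /andP[hphi].
  rewrite memv_ker (lfunE L) => /eqP/ffunP hL; apply/eqP.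
  have idx (t : k) : exists j : N, nth 0 (enum k) j = t.
    have hj : (index t (enum k) < p)%N by rewrite -hk cardE index_mem mem_enum.
    by exists (nord p (index t (enum k))); rewrite val_nord // nth_index // mem_enum.
  apply: principal_eq0 => // [u t|t].
    have [i <-] := idx u; have [j <-] := idx t.
    by have := hL (Some i, j); rewrite !ffunE.
  have [j <-] := idx t.
  by have := hL (None, j); rewrite !ffunE.
rewrite -(limg_ker_dim (linfun L)) inj dimv0 add0n.
rewrite (leq_trans (dimvS (subvf _))) // dimvf /dim /= muln1.
by rewrite cardE.
Qed.

End Basis.

(** * * Submodules are closed under the preorder *)

Section Stability.
Variables (p : nat) (p_prime : prime p) (p_ge5 : (5 <= p)%N).
Variables (A : finComUnitRingType) (k : finFieldType) (red : {rmorphism A -> k}).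
Variables (tau : k -> A) (w : A) (dA : dual_numbers red tau w) (hk : #|k| = p).
Variables (E : fieldType) (iota : {rmorphism k -> E}) (s : nat).
Variables (r : Ntilde p 1) (r0 : (0 < r)%N).

Local Notation GL := {'GL_2[A]}.
Local Notation V := {ffun GL -> E^o}.
Local Notation N := (Ntilde p 1).
Local Notation mon := (mono red tau w iota s).
Local Notation wd := (wdeg r).
Local Notation ae := (aexp r).
Local Notation bs := (bas red tau w iota s r).
Local Notation sw := (swap A).

Lemma mono_Some l i (i' j : N) : red_exp p i = i' -> (0 < l)%N ->
  (l + i + j.*2 = r %[mod p.-1])%N -> mon l i j = bs (Some i', j).
Proof.
move=> hi l0 h; rewrite /bas; apply: (mono_eq_mod p_prime p_ge5 red tau w hk); last first.
  by rewrite hi /yexp /= red_exp_small //; have := ntilde_lt p_ge5 i'; lia.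
apply: (@modP_uniq p) => //.
- by rewrite red_exp_gt0 l0 red_exp_max.
- by rewrite red_exp_gt0 (xexp_gt0 p_ge5 r0) red_exp_max.
rewrite !red_exp_mod //; apply/eqP; rewrite -(eqn_modDr (i' + j.*2)); apply/eqP.
rewrite !addnA; transitivity ((l + i + j.*2) %% p.-1)%N.
  by apply/eqP; rewrite -hi !eqn_modDr eqn_modDl; apply/eqP/red_exp_mod.
by rewrite h -(wdeg_mod p_ge5 r0 (Some i', j)).
Qed.

Lemma mono_None i (j : N) : (0 < i)%N ->
  (i + j.*2 = r %[mod p.-1])%N -> mon 0 i j = bs (None, j).
Proof.
move=> i0 h; rewrite /bas; apply: (mono_eq_mod p_prime p_ge5 red tau w hk) => //.
rewrite (aexp_eq p_ge5 r0 h i0) /yexp /= red_exp_small //.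
exact: aexp_le.
Qed.

Lemma nordK (j : N) : nord p j = j.
Proof. by apply: val_inj; rewrite /= val_nord ?ntilde_lt. Qed.

(** Reducing the exponents gives a basis vector and can only lower the degree. The condition on
    [l + i] excludes the pure powers of D, which are not basis vectors. *)
Lemma mono_bas l i (j : N) : (0 < l + i)%N -> (l + i + j.*2 = r %[mod p.-1])%N ->
  exists2 x, mon l i j = bs x & x.2 = j /\ (wd x <= l + i + j.*2)%N.
Proof.
move=> li h; have [l0|l0] := posnP l.
  move: li h; rewrite l0 add0n => i0 h; exists (None, j); first exact: mono_None.
  split=> //; rewrite wdegN leq_add2r -(aexp_eq p_ge5 r0 h i0).
  exact: red_exp_le.
have hv : nord p (red_exp p i) = red_exp p i :> nat.
  by rewrite val_nord //; have := red_exp_max p_ge5 i; lia.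
exists (Some (nord p (red_exp p i)), j); first by apply: mono_Some.
split=> //; rewrite leq_add2r leq_add //; last by rewrite /yexp /= hv red_exp_le.
suff -> : xexp r (Some (nord p (red_exp p i)), j) = red_exp p l by apply: red_exp_le.
apply: (@modP_uniq p) => //.
- rewrite (xexp_gt0 p_ge5 r0) xexpE //; have := aexp_le p_ge5 r j.
  by have := ntilde_lt p_ge5 (nord p (red_exp p i)); case: ifP; lia.
- by rewrite red_exp_gt0 l0 red_exp_max.
apply/eqP; rewrite -(eqn_modDr (red_exp p i + j.*2)); apply/eqP.
rewrite !addnA; transitivity (r %% p.-1)%N.
  by have := wdeg_mod p_ge5 r0 (Some (nord p (red_exp p i)), j); rewrite /wdeg /yexp /= hv.
rewrite -h; apply/eqP; rewrite eqn_modDr; apply/eqP.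
by rewrite -[in RHS]modnDm !red_exp_mod // modnDm.
Qed.

(** The missing multiple of p - 1 is added to a positive exponent, which does not change the
    function. So a degree-n layer contains the basis vectors of smaller degree as well. *)
Lemma bas_mono x n : (wd x <= n)%N -> (n = r %[mod p.-1])%N ->
  exists l i, (l + i + x.2.*2 = n)%N /\ bs x = mon l i x.2.
Proof.
move=> hn hr.
have [c hc] : exists c, n = (wd x + c * p.-1)%N.
  have : (n == wd x %[mod p.-1])%N by rewrite hr wdeg_mod.
  by rewrite eqn_mod_dvd // => /dvdnP[c hc]; exists c; lia.
have [x0|x0] := posnP (xexp r x).
  exists 0%N, (yexp r x + c * p.-1)%N; split; first by rewrite hc /wdeg x0; lia.
  rewrite /bas; apply: (mono_eq_mod p_prime p_ge5 red tau w hk); first by rewrite x0.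
  have y0 : (0 < yexp r x)%N.
    case: x x0 {hn hc} => [[i|] j] x0; first by have := xexp_gt0 p_ge5 r0 i j; lia.
    exact: aexp_gt0.
  elim: c {hc} => [|c IH]; first by rewrite addn0.
  by rewrite IH mulSn [(p.-1 + _)%N]addnC addnA red_expD //; lia.
exists (xexp r x + c * p.-1)%N, (yexp r x); split; first by rewrite hc /wdeg; lia.
rewrite /bas; apply: (mono_eq_mod p_prime p_ge5 red tau w hk) => //.
elim: c {hc} => [|c IH]; first by rewrite addn0.
by rewrite IH mulSn [(p.-1 + _)%N]addnC addnA red_expD //; lia.
Qed.

Section Closed.
Variables (U : {vspace V}) (hU : gstable U).

Lemma lin_coef_mem h u : u \in U -> lin_coef p iota h u \in U.
Proof. exact: galg_mem. Qed.

Lemma scale_nat_mem n u : (0 < n < p)%N -> n%:R *: u \in U -> u \in U.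
Proof.
move=> hn; rewrite rpredZeq => /orP[|//].
by rewrite (negPf (natr_iota_neq0 p_prime hk iota hn)).
Qed.

Lemma opE_mem l i j : (0 < i < p)%N -> mon l i j \in U -> mon l.+1 i.-1 j \in U.
Proof.
move=> hi /(lin_coef_mem (unip tau)).
rewrite -/(opE p tau iota _) (opE_mono p_prime) //; last by case/andP: hi.
exact: scale_nat_mem.
Qed.

Lemma opXX_mem l i j : (0 < j < p)%N -> mon l i j \in U -> mon l.+2 i j.-1 \in U.
Proof.
move=> hi /(lin_coef_mem (trans_xx tau w)).
rewrite -/(opXX p tau w iota _) (opXX_mono p_prime) //; last by case/andP: hi.
exact: scale_nat_mem.
Qed.

Lemma opXY_mem l i j : (0 < j < p)%N -> mon l i j \in U -> mon l.+1 i.+1 j.-1 \in U.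
Proof.
move=> hi /(lin_coef_mem (trans_xy tau w)).
rewrite -/(opXY p tau w iota _) (opXY_mono p_prime) //; last by case/andP: hi.
exact: scale_nat_mem.
Qed.

Lemma swap_mem l i j : mon l i j \in U -> mon i l j \in U.
Proof. by move=> /(hU sw); rewrite (rtrans_swap dA) rpredZsign. Qed.

(** Every generating relation is an operation available in a stable subspace. In the order of the
    disjuncts: X d/dY, X^2 d/dD, XY d/dD and twice the swap for a finite index; X^2 d/dD, X d/dY and
    the swap for infinity. *)
Lemma bas_below x y : bs y \in U -> below r x y -> bs x \in U.
Proof.
have wy := wdeg_mod p_ge5 r0 y.
case: y wy => [[i|] j] wy hy; rewrite /below /=.
  have l0 := xexp_gt0 p_ge5 r0 i j; have ip := ntilde_lt p_ge5 i.
  have jp := ntilde_lt p_ge5 j.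
  have {}wy : (xexp r (Some i, j) + i + j.*2 = r %[mod p.-1])%N := wy.
  case/orP => [/existsP[m]|/or4P[/existsP[m]|/existsP[m]||]].
  - rewrite ord1 expn0 npreceq_f1 // val_ntilde1 // => /andP[hi /eqP->].
    rewrite -(@mono_Some (xexp r (Some i, j)).+1 i.-1) //.
    + by apply: opE_mem; rewrite ?hi.
    + by rewrite val_nominus // val_ntilde1 // subn1 red_exp_small //; lia.
    + by rewrite -wy; congr (_ %% _)%N; lia.
  - rewrite ord1 expn0 npreceq_f1 // val_ntilde1 // => /andP[hi /eqP->].
    rewrite -(@mono_Some (xexp r (Some i, j)).+2 i) //.
    + by rewrite val_nominus // val_ntilde1 // subn1; apply: opXX_mem; rewrite ?hi.
    + by rewrite red_exp_small //; lia.
    + by rewrite val_nominus // val_ntilde1 // -wy; congr (_ %% _)%N; lia.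
  - rewrite ord1 expn0 npreceq_f1 // val_ntilde1 // => /andP[hi /eqP->].
    rewrite -(@mono_Some (xexp r (Some i, j)).+1 i.+1) //.
    + by rewrite val_nominus // val_ntilde1 // subn1; apply: opXY_mem; rewrite ?hi.
    + by rewrite val_nadd // val_ntilde1 // addn1.
    + by rewrite val_nominus // val_ntilde1 // -wy; congr (_ %% _)%N; lia.
  - case/andP => hi /eqP->.
    have {}hi : nat_of_ord i != 0%N by [].
    rewrite -(@mono_Some i (xexp r (Some i, j))) //.
    + exact: swap_mem.
    + by rewrite red_exp_small // /xexp /=; have := ntilde_lt p_ge5 (nsub (rm2 r j) i); lia.
    + by rewrite lt0n.
    + by rewrite -wy; congr (_ %% _)%N; lia.
  - case/andP => /eqP i0 /eqP->.
    rewrite -(@mono_None (xexp r (Some i, j))) //.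
      by apply: swap_mem; move: hy; rewrite /bas /yexp i0.
    by rewrite -wy i0; congr (_ %% _)%N; rewrite /=; lia.
have ip := aexp_le p_ge5 r j; have a0 := aexp_gt0 p_ge5 r0 j; have jp := ntilde_lt p_ge5 j.
move: wy; rewrite wdegN => wy.
have {}hy : mon 0 (ae j) j \in U by [].
case/or3P => [/existsP[m]|/existsP[m]|].
- rewrite ord1 expn0 npreceq_f1 // val_ntilde1 // => /andP[hi /eqP->].
  rewrite -(@mono_Some 2 (ae j)) //.
  + by rewrite val_nominus // val_ntilde1 // subn1; apply: opXX_mem; rewrite ?hi.
  + by rewrite val_rm2 // red_exp_small.
  + by rewrite val_nominus // val_ntilde1 // -wy; congr (_ %% _)%N; lia.
- rewrite ord1 expn0 npreceq_f1 // val_ntilde1 // => /andP[hi /eqP->].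
  rewrite -(@mono_Some 1 (ae j).-1) //.
  + by apply: opE_mem => //; lia.
  + by rewrite val_nominus // val_ntilde1 // val_rm2 // subn1 red_exp_small //; lia.
  + by rewrite -wy; congr (_ %% _)%N; lia.
move/eqP->; rewrite -(@mono_Some (ae j) 0) ?addn0 //.
exact: swap_mem.
Qed.

Lemma bas_le x y : bs y \in U -> le_wdeg r x y -> bs x \in U.
Proof.
move=> hy; rewrite -leT_wdeg // => /connectP[q].
elim: q x => [|z q IH] x /= => [_ <- //|/andP[xz zq] hq].
by apply: bas_below xz; exact: IH zq hq.
Qed.

End Closed.
End Stability.

(** * Weighted homogeneous polynomials *)

Section Weighted.
Variables (p : nat) (p_prime : prime p) (p_ge5 : (5 <= p)%N).
Variables (A : finComUnitRingType) (k : finFieldType) (red : {rmorphism A -> k}).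
Variables (tau : k -> A) (w : A) (dA : dual_numbers red tau w) (hk : #|k| = p).
Variables (E : fieldType) (iota : {rmorphism k -> E}) (s : nat).
Variables (r : Ntilde p 1) (r0 : (0 < r)%N).

Local Notation GL := {'GL_2[A]}.
Local Notation V := {ffun GL -> E^o}.
Local Notation N := (Ntilde p 1).
Local Notation Th := (Theta p 1).
Local Notation xc g := (Xc red iota g).
Local Notation yc g := (Yc red iota g).
Local Notation dc g := (Dc red tau w iota g).
Local Notation dt g := (detE red iota g).
Local Notation mon := (mono red tau w iota s).
Local Notation wd := (wdeg r).
Local Notation ae := (aexp r).
Local Notation bs := (bas red tau w iota s r).

Definition pmul (u v : V) : V := [ffun g => u g * v g].

(* Weighted homogeneous polynomials in X, Y, D, of weights 1, 1, 2: total
   degree [n], and degree at most [m] in D. *)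
Inductive wpoly : nat -> nat -> V -> Prop :=
| wpoly0 n m : wpoly n m 0
| wpolyD n m a u v : wpoly n m u -> wpoly n m v -> wpoly n m (a *: u + v)
| wpolyM l i j m : (j <= m)%N ->
    wpoly (l + i + j.*2) m [ffun g => xc g ^+ l * yc g ^+ i * dc g ^+ j].

Lemma wpoly_mul n m n' m' u v :
  wpoly n m u -> wpoly n' m' v -> wpoly (n + n') (m + m') (pmul u v).
Proof.
move=> hu hv; elim: hu => {n m u} [n m|n m a u u' _ IH _ IH'|l i j m hj].
- have -> : pmul 0 v = 0 by apply/ffunP=> g; rewrite !ffunE mul0r.
  exact: wpoly0.
- have -> : pmul (a *: u + u') v = a *: pmul u v + pmul u' v.
    by apply/ffunP=> g; rewrite !ffunE mulrDl /GRing.scale /= mulrA.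
  exact: wpolyD.
elim: hv => {n' m' v} [n' m'|n' m' a v v' _ IH _ IH'|l' i' j' m' hj'].
- have -> : forall u, pmul u 0 = 0 by move=> u; apply/ffunP=> g; rewrite !ffunE mulr0.
  exact: wpoly0.
- have -> : forall u, pmul u (a *: v + v') = a *: pmul u v + pmul u v'.
    by move=> u; apply/ffunP=> g; rewrite !ffunE mulrDr /GRing.scale /= mulrCA.
  exact: wpolyD.
have -> : (l + i + j.*2 + (l' + i' + j'.*2) = (l + l') + (i + i') + (j + j').*2)%N by lia.
have -> : pmul [ffun g => xc g ^+ l * yc g ^+ i * dc g ^+ j]
    [ffun g => xc g ^+ l' * yc g ^+ i' * dc g ^+ j'] =
    [ffun g => xc g ^+ (l + l') * yc g ^+ (i + i') * dc g ^+ (j + j')].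
  by apply/ffunP=> g; rewrite !ffunE !exprD; ring.
by apply: wpolyM; rewrite leq_add.
Qed.

Lemma wpoly_add n m u v : wpoly n m u -> wpoly n m v -> wpoly n m (u + v).
Proof. by move=> hu hv; rewrite -[u]scale1r; exact: wpolyD. Qed.

Lemma wpoly_scale n m a u : wpoly n m u -> wpoly n m (a *: u).
Proof. by move=> hu; rewrite -[_ *: _]addr0; apply: wpolyD => //; exact: wpoly0. Qed.

Lemma wpoly_exp n m (f : GL -> E) e : wpoly n m [ffun g => f g] ->
  wpoly (n * e) (m * e) [ffun g => f g ^+ e].
Proof.
move=> hu; elim: e => [|e IH].
  rewrite !muln0; have := @wpolyM 0 0 0 0 (leqnn _).
  by congr (wpoly _ _ _); apply/ffunP=> g; rewrite !ffunE !expr0 !mulr1.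
rewrite !mulnS; have := wpoly_mul hu IH.
by congr (wpoly _ _ _); apply/ffunP=> g; rewrite !ffunE exprS.
Qed.

Lemma wpolyX m : wpoly 1 m [ffun g => xc g].
Proof.
have := @wpolyM 1 0 0 m (leq0n m).
by congr (wpoly _ _ _); apply/ffunP=> g; rewrite !ffunE expr1 !expr0 !mulr1.
Qed.

Lemma wpolyY m : wpoly 1 m [ffun g => yc g].
Proof.
have := @wpolyM 0 1 0 m (leq0n m).
by congr (wpoly _ _ _); apply/ffunP=> g; rewrite !ffunE expr1 !expr0 mulr1 mul1r.
Qed.

Lemma wpolyDc m : (0 < m)%N -> wpoly 2 m [ffun g => dc g].
Proof.
move=> /(@wpolyM 0 0 1 m).
by congr (wpoly _ _ _); apply/ffunP=> g; rewrite !ffunE expr1 !expr0 !mul1r.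
Qed.

Lemma wpoly_lin a b : wpoly 1 0 [ffun g => a * xc g + b * yc g].
Proof.
have := wpoly_add (wpoly_scale a (wpolyX 0)) (wpoly_scale b (wpolyY 0)).
by congr (wpoly _ _ _); apply/ffunP=> g; rewrite !ffunE.
Qed.

Lemma wpoly_weaken n m m' u : (m <= m')%N -> wpoly n m u -> wpoly n m' u.
Proof.
move=> hm hu; elim: hu hm => {n m u} [n m|n m a u u' _ IH _ IH'|l i j m hj] hm.
- exact: wpoly0.
- by apply: wpolyD; [exact: IH|exact: IH'].
by apply: wpolyM; exact: leq_trans hm.
Qed.

(** A translation sends X and Y to linear forms and D to a multiple of D plus a quadratic form, so
    it preserves the weighted degree and does not raise the degree in D. *)
Lemma wpoly_rtrans (h : GL) l i j : wpoly (l + i + j.*2) j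
  [ffun g => xc (g * h)%g ^+ l * yc (g * h)%g ^+ i * dc (g * h)%g ^+ j].
Proof.
have hX := wpoly_exp l (wpoly_lin (iota (red (glmx h 0 0))) (iota (red (glmx h 1 0)))).
have hY := wpoly_exp i (wpoly_lin (iota (red (glmx h 0 1))) (iota (red (glmx h 1 1)))).
have eX := wpoly_lin (iota (eps red tau w (glmx h 0 0))) (iota (eps red tau w (glmx h 1 0))).
have eY := wpoly_lin (iota (eps red tau w (glmx h 0 1))) (iota (eps red tau w (glmx h 1 1))).
have rX := wpoly_lin (iota (red (glmx h 0 0))) (iota (red (glmx h 1 0))).
have rY := wpoly_lin (iota (red (glmx h 0 1))) (iota (red (glmx h 1 1))).
have Q := wpoly_weaken (leq0n 1)
  (wpoly_add (wpoly_mul rX eY) (wpoly_scale (-1) (wpoly_mul eX rY))).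
have hD : wpoly 2 1 [ffun g => dc (g * h)%g].
  have := wpoly_add (wpoly_scale (dt h) (wpolyDc (leqnn 1))) Q.
  congr (wpoly _ _ _); apply/ffunP=> g; rewrite !ffunE (DcM dA) /GRing.scale /=.
  by rewrite mulN1r.
have := wpoly_mul (wpoly_mul hX hY) (wpoly_exp j hD).
rewrite !mul1n mul2n !mul0n add0n; congr (wpoly _ _ _).
by apply/ffunP=> g; rewrite !ffunE XcM YcM.
Qed.

Definition twist (u : V) : V := [ffun g => dt g ^+ s * u g].

(** The bound [m.*2 < n] leaves a positive degree in X, Y in every monomial, so that [mono_bas]
    applies to it. *)
Lemma wpoly_sp n m u : (m < p)%N -> (m.*2 < n)%N -> (n = r %[mod p.-1])%N ->
  wpoly n m u -> twist u \in sp bs [set x : Th | (x.2 <= m)%N && (wd x <= n)%N].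
Proof.
move=> mp mn nr hu; elim: hu mp mn nr => {n m u} [n m|n m a u u' _ IH _ IH'|l i j m hj] mp mn nr.
- have -> : twist 0 = 0 by apply/ffunP=> g; rewrite !ffunE mulr0.
  exact: mem0v.
- have -> : twist (a *: u + u') = a *: twist u + twist u'.
    by apply/ffunP=> g; rewrite !ffunE mulrDr /GRing.scale /= mulrCA.
  by rewrite memvD ?memvZ ?IH ?IH'.
have hv : nord p j = j :> nat by rewrite val_nord //; lia.
have li : (0 < l + i)%N by lia.
have [|x hx [hx2 hxw]] := @mono_bas _ p_prime p_ge5 _ _ red tau w hk _ iota s _ r0 l i (nord p j) li.
  by rewrite hv.
have -> : twist [ffun g => xc g ^+ l * yc g ^+ i * dc g ^+ j] = bs x.
  by rewrite -hx hv; apply/ffunP=> g; rewrite !ffunE.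
by apply: mem_sp; rewrite inE hx2 hv hj /= -hv.
Qed.

(** Each spanning vector is first written as a monomial of weighted degree exactly [n]; its
    translates are then homogeneous of this degree too. *)
Lemma gstable_sp n m : (m < p)%N -> (m.*2 < n)%N -> (n = r %[mod p.-1])%N ->
  gstable (sp bs [set x : Th | (x.2 <= m)%N && (wd x <= n)%N]).
Proof.
move=> mp mn nr h u /(spP bs)[c -> hc]; rewrite rtrans_sum; apply: memv_suml => x _.
have [xS|/hc ->] := boolP (x \in [set x : Th | (x.2 <= m)%N && (wd x <= n)%N]); last first.
  by rewrite scale0r rtrans0 mem0v.
rewrite rtransZ memvZ //; move: xS; rewrite inE => /andP[xm xn].
have [l [i [lin ->]]] := bas_mono p_prime p_ge5 red tau w hk iota s r0 xn nr.
have -> : rtrans h (mon l i x.2) = dt h ^+ s *: twist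
    [ffun g => xc (g * h)%g ^+ l * yc (g * h)%g ^+ i * dc (g * h)%g ^+ x.2].
  apply/ffunP=> g; rewrite !ffunE detEM /GRing.scale /= exprMn; ring.
rewrite memvZ //; apply: wpoly_sp => //; apply: (wpoly_weaken xm).
by rewrite -lin; exact: wpoly_rtrans.
Qed.

Lemma glmx_antidiag (a : A) : glmx (antidiag a) = mx2 a 1 1 0.
Proof.
apply/matrixP=> i j; rewrite !mxE.
by case: i => [[|[|i]] hi] //; case: j => [[|[|j]] hj].
Qed.

Definition bigcell (i j : nat) : V :=
  \sum_(l0 : k) \sum_(l1 : k)
    tens red iota r (antidiag (tau l0 + tau l1 * w)) (iota (l0 ^+ i * l1 ^+ j)).

Lemma tensE (g : GL) a v : tens red iota r (antidiag a) v g =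
  if glmx g 1 0 * a + glmx g 1 1 == 0 then xc g ^+ r * v else 0.
Proof.
rewrite ffunE inE glmxM glmx_antidiag !mxE /= mulr1; case: ifP => // _.
by rewrite /chi_ /redE glmxM glmx_antidiag !mxE /= mulr1 mulr0 addr0.
Qed.

(** Where X is nonzero, only the summand at minus the quotient of the two bottom entries survives;
    that element reduces to -Y/X and has infinitesimal part -D/X^2. Where X = 0 no summand
    survives. *)
Lemma bigcellE i j (g : GL) : bigcell i j g =
  if xc g == 0 then 0 else (-1) ^+ (i + j) *
     (xc g ^+ r * (yc g / xc g) ^+ i * (dc g / xc g ^+ 2) ^+ j).
Proof.
rewrite /bigcell sum_ffunE; under eq_bigr do rewrite sum_ffunE.
under eq_bigr do under eq_bigr do rewrite tensE.
rewrite /Xc fmorph_eq0; have [x0|x0] := eqVneq (red (glmx g 1 0)) 0.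
  rewrite big1 // => l0 _; rewrite big1 // => l1 _; case: eqP => // h.
  have := congr1 red h; rewrite rmorphD rmorphM x0 mul0r add0r rmorph0 => y0.
  by have := bottom_row_neq0 dA g; rewrite x0 y0 eqxx.
have xU : glmx g 1 0 \is a GRing.unit by rewrite (unit_red dA).
set q := - (glmx g 1 1 / glmx g 1 0).
have qE a : (glmx g 1 0 * a + glmx g 1 1 == 0) = (a == q).
  rewrite addr_eq0 -[a == q](can_eq (mulKr xU)) /q mulrN [_ * (_ / _)]mulrCA.
  by rewrite divrr // mulr1.
have hq : glmx g 1 0 * q = - glmx g 1 1 by apply/eqP; rewrite -addr_eq0 qE.
have rq : red q = - red (glmx g 1 1) / red (glmx g 1 0).
  by rewrite -rmorphN -hq rmorphM mulrC mulKf.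
have eq : eps red tau w q = - (dcoord red tau w g / red (glmx g 1 0) ^+ 2).
  have := congr1 (eps red tau w) hq; rewrite (epsM dA) (epsN dA) rq => h.
  apply: (mulfI x0); move: h; rewrite /dcoord.
  move=> h; rewrite -[LHS](addrK (eps red tau w (glmx g 1 0) * (- red (glmx g 1 1) / red (glmx g 1 0)))) h.
  by field.
rewrite (bigD1 (red q)) //= (bigD1 (eps red tau w q)) //= qE -(epsE dA q) eqxx.
rewrite big1 ?addr0 => [|l1 hl1]; last first.
  rewrite qE ifN //; apply: contra hl1 => /eqP h.
  by rewrite (eps_uniq dA (esym h)).
rewrite big1 ?addr0 => [|l0 hl0]; last first.
  rewrite big1 // => l1 _; rewrite qE ifN //; apply: contra hl0 => /eqP <-.
  by rewrite rmorphD (red_tau dA) (red_tau_w dA) addr0.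
rewrite rq eq rmorphM !rmorphXn /= rmorphN !fmorph_div !rmorphN rmorphXn.
rewrite /Xc /Yc /Dc mulNr ![(- (_ / _)) ^+ _]exprNn exprD; ring.
Qed.

(** The exponent of X in [bigcellE] may be negative, but it is congruent to [xexp r x] modulo p - 1,
    which is enough where X is nonzero; positivity of [xexp r x] gives the value 0 elsewhere. For
    infinity, X and Y are exchanged. *)
Lemma fbasisE x : exists2 c : E, c != 0 &
  twist (fbasis_r red tau w iota r x) = c *: bs x.
Proof.
case: x => [[i|] j].
  exists ((-1) ^+ (i + j)); first by rewrite signr_eq0.
  apply/ffunP=> g; rewrite /twist /fbasis_r /= -/(bigcell i j) !ffunE bigcellE.
  have l0 := xexp_gt0 p_ge5 r0 i j.
  rewrite /GRing.scale /=; case: eqP => [->|/eqP x0].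
    by rewrite [0 ^+ xexp _ _]expr0n gtn_eqF // !mul0r !mulr0.
  rewrite mulrCA; congr (_ * (_ * _)).
  have c0 : red (glmx g 1 0) != 0 by move: x0; rewrite /Xc fmorph_eq0.
  have := expr_mod_card p_prime hk iota c0 (wdeg_mod p_ge5 r0 (Some i, j)).
  rewrite -/(xc g) => <-; rewrite /wdeg -[yexp r (Some i, j)]/(nat_of_ord i) -mul2n 2!exprD exprM /=.
  have hi : xc g ^+ i != 0 by rewrite expf_neq0.
  have hj : (xc g ^+ 2) ^+ j != 0 by rewrite !expf_neq0.
  rewrite !expr_div_n; field.
  by rewrite hi hj.
exists 1; first by rewrite oner_neq0.
apply/ffunP=> g; rewrite /twist /fbasis_r /= -/(bigcell 0 j) !ffunE bigcellE.
rewrite scale1r; congr (_ * _); rewrite X_swap // D_swap //.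
rewrite !expr0 !mulr1 mul1r add0n /yexp /=.
have a0 := aexp_gt0 p_ge5 r0 j.
case: eqP => [->|/eqP x0]; first by rewrite expr0n gtn_eqF // mul0r.
have c0 : red (glmx g 1 1) != 0 by move: x0; rewrite /Yc fmorph_eq0.
have := expr_mod_card p_prime hk iota c0 (wdeg_mod p_ge5 r0 (None, j)).
rewrite -/(yc g) wdegN => <-; rewrite -mul2n exprD exprM.
have hj : (yc g ^+ 2) ^+ j != 0 by rewrite !expf_neq0.
rewrite expr_div_n [(- dc g) ^+ j]exprNn.
transitivity (((-1) ^+ j) ^+ 2 * (yc g ^+ ae j * dc g ^+ j)); last first.
  by rewrite sqrr_sign mul1r.
move: (yc g ^+ 2 ^+ j) ((-1) ^+ j : E) hj => z e z0.
by field.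
Qed.

End Weighted.

(** * Submodules are sums of layers *)

Section Layers.
Variables (A : finComUnitRingType) (k : finFieldType) (red : {rmorphism A -> k}).
Variables (tau : k -> A) (w : A) (E : fieldType) (iota : {rmorphism k -> E}) (s : nat).
Local Notation V := {ffun {'GL_2[A]} -> E^o}.
Local Notation mon := (mono red tau w iota s).

Definition has_layer (n g : nat) (U : {vspace V}) : Prop :=
  forall l i, (l + i + g.*2 = n)%N -> mon l i g \in U.

(** The binary forms of degree n - 2 g times D^g. For n = 2 g this is the line of D^g, which
    contains no basis vector. *)
Definition layer (n g : nat) : {vspace V} :=
  (\sum_(i < (n - g.*2).+1) <[mon (n - g.*2 - i) i g]>)%VS.

Lemma mono_layer n g l i : (l + i + g.*2 = n)%N -> mon l i g \in layer n g.
Proof.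
move=> h; have hi : (i < (n - g.*2).+1)%N by lia.
have -> : l = (n - g.*2 - Ordinal hi)%N by rewrite /=; lia.
apply: (subvP (sumv_sup (Ordinal hi) _ (subvv _))) => //.
exact: memv_line.
Qed.

Lemma has_layerP n g U : (g.*2 <= n)%N -> has_layer n g U <-> (layer n g <= U)%VS.
Proof.
move=> gn; split=> [h|/subvP h l i hl]; last by apply: h; exact: mono_layer.
apply/subv_sumP => i _; rewrite -memvE; apply: h.
by have := ltn_ord i; lia.
Qed.

Lemma has_layerS n g (U U' : {vspace V}) : (U <= U')%VS -> has_layer n g U -> has_layer n g U'.
Proof. by move=> /subvP h hl l i /hl; exact: h. Qed.

End Layers.

Section Submodules.
Variables (p : nat) (p_prime : prime p) (p_ge5 : (5 <= p)%N).
Variables (A : finComUnitRingType) (k : finFieldType) (red : {rmorphism A -> k}).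
Variables (tau : k -> A) (w : A) (dA : dual_numbers red tau w) (hk : #|k| = p).
Variables (E : fieldType) (iota : {rmorphism k -> E}) (s : nat).
Variables (r : Ntilde p 1) (r0 : (0 < r)%N).

Local Notation GL := {'GL_2[A]}.
Local Notation V := {ffun GL -> E^o}.
Local Notation N := (Ntilde p 1).
Local Notation Th := (Theta p 1).
Local Notation mon := (mono red tau w iota s).
Local Notation wd := (wdeg r).
Local Notation ae := (aexp r).
Local Notation bs := (bas red tau w iota s r).

Definition layer_span (m : nat) : {vspace V} := sp bs [set x : Th | (x.2 < m)%N].

(** The degrees in the layer of [x] have the residue of [n] modulo p - 1, and the larger one exceeds
    [x.2.*2] by at most 2 (p - 1), so none of them is above [n]. *)
Lemma wdeg_le_large (x : Th) n : (n = r %[mod p.-1])%N -> (x.2.*2 + p <= n)%N -> (wd x <= n)%N.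
Proof.
move=> nr hn; have := wdeg_max p_ge5 r0 x.
have a0 := aexp_gt0 p_ge5 r0 x.2; have aP := aexp_le p_ge5 r x.2.
have [//|lt] := leqP (wd x) n => hw.
have : (n - x.2.*2 - p.-1 = ae x.2)%N.
  apply: (@modP_uniq p) => //; try lia.
  apply/eqP; rewrite -(eqn_modDr (x.2.*2 + p.-1)); apply/eqP.
  have -> : (n - x.2.*2 - p.-1 + (x.2.*2 + p.-1) = n)%N by lia.
  by rewrite nr addnA modnDr aexp_mod.
lia.
Qed.

Lemma gstable_layer_span m : (m <= p)%N -> gstable (layer_span m).
Proof.
case: m => [|m] mp.
  rewrite /layer_span; have -> : [set x : Th | (x.2 < 0)%N] = set0.
    by apply/setP=> x; rewrite !inE.
  by rewrite sp0; exact: gstable0.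
(* A degree so large that it imposes no condition, which makes [gstable_sp] applicable. *)
rewrite /layer_span; pose n := (r + 4 * p.-1)%N.
have nr : (n = r %[mod p.-1])%N by rewrite /n addnC modnMDl.
have -> : [set x : Th | (x.2 < m.+1)%N] = [set x : Th | (x.2 <= m)%N && (wd x <= n)%N].
  apply/setP=> x; rewrite !inE ltnS; case: leqP => //= xm; symmetry.
  by apply: wdeg_le_large => //; rewrite /n; lia.
by apply: gstable_sp => //; rewrite /n; lia.
Qed.

Lemma mono_layer_span l i j m : (0 < l + i)%N -> (l + i + j.*2 = r %[mod p.-1])%N ->
  (j < m)%N -> (m <= p)%N -> mon l i j \in layer_span m.
Proof.
move=> li h jm mp.
have hv : nord p j = j :> nat by rewrite val_nord //; lia.
have [|x hx [hx2 _]] := mono_bas p_prime p_ge5 red tau w hk iota s r0 (j := nord p j) li.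
  by rewrite hv.
by rewrite -hv hx; apply: mem_sp; rewrite inE hx2 hv.
Qed.

Local Notation has_layer n g U := (has_layer red tau w iota s n g U).
Section Submodule.
Variables (U : {vspace V}) (hU : gstable U).

Definition lowers (op : V -> V) : Prop := forall g, (g < p)%N ->
  (forall u, u \in U -> op u \in U) /\
  (forall u, u \in layer_span g.+1 -> op u \in layer_span g).

Lemma layer_span_op (op : V -> V) m (W : {vspace V}) :
  (forall u v, op (u + v) = op u + op v) -> (forall a u, op (a *: u) = a *: op u) ->
  (forall x : Th, (x.2 < m)%N -> op (bs x) \in W) ->
  forall u, u \in layer_span m -> op u \in W.
Proof.
move=> opD opZ h u /(spP bs)[c -> hc].
have op0 : op 0 = 0 by have := opZ 0 0; rewrite !scale0r.
rewrite (big_morph op opD op0); apply: memv_suml => x _; rewrite opZ.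
have [xm|/negPf xm] := boolP (x.2 < m)%N; first by rewrite memvZ // h.
by rewrite hc ?inE ?xm // scale0r mem0v.
Qed.

Lemma opXX_lowers : lowers (opXX p tau w iota).
Proof.
move=> g gp; split=> u; first exact: lin_coef_mem.
apply: layer_span_op => [||x xg]; [exact: galgD|exact: galgZ|].
have xp := ntilde_lt p_ge5 x.2; have := wdeg_mod p_ge5 r0 x.
rewrite /wdeg (opXX_mono p_prime) // => wx.
have [->|x0] := posnP x.2; first by rewrite scale0r mem0v.
rewrite memvZ //; apply: mono_layer_span; try lia.
by rewrite -wx; congr (_ %% _)%N; lia.
Qed.

Lemma opXY_lowers : lowers (opXY p tau w iota).
Proof.
move=> g gp; split=> u; first exact: lin_coef_mem.
apply: layer_span_op => [||x xg]; [exact: galgD|exact: galgZ|].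
have xp := ntilde_lt p_ge5 x.2; have := wdeg_mod p_ge5 r0 x.
rewrite /wdeg (opXY_mono p_prime) // => wx.
have [->|x0] := posnP x.2; first by rewrite scale0r mem0v.
rewrite memvZ //; apply: mono_layer_span; try lia.
by rewrite -wx; congr (_ %% _)%N; lia.
Qed.

Lemma lowers_mod op g u : (forall u v, op (u + v) = op u + op v) -> lowers op ->
  (g < p)%N -> u \in (U + layer_span g.+1)%VS -> op u \in (U + layer_span g)%VS.
Proof.
move=> opD h gp /memv_addP[a aU [b bW ->]]; have [h1 h2] := h g gp.
by rewrite opD memv_add ?h1 ?h2.
Qed.

(** X^2 d/dD and XY d/dD yield the monomials divisible by X^2 or by XY, and the swap yields the
    remaining power of Y. Both operators respect the filtration by the degree in D, so congruences
    suffice. *)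
Lemma has_layer_down n g : (g.+1 < p)%N -> (g.+1.*2 <= n)%N ->
  has_layer n g.+1 (U + layer_span g.+1) -> has_layer n g (U + layer_span g).
Proof.
move=> gp gn h.
have hUW : gstable (U + layer_span g)%VS.
  by apply: gstableD => //; apply: gstable_layer_span; lia.
have hxx l i : (l + i + g.+1.*2 = n)%N -> mon l.+2 i g \in (U + layer_span g)%VS.
  move=> /h /(lowers_mod (op := opXX p tau w iota) (@galgD _ _ _ _ _) opXX_lowers (ltnW gp)).
  rewrite (opXX_mono p_prime) //.
  by apply: (scale_nat_mem p_prime hk iota); rewrite ?gp.
have hxy l i : (l + i + g.+1.*2 = n)%N -> mon l.+1 i.+1 g \in (U + layer_span g)%VS.
  move=> /h /(lowers_mod (op := opXY p tau w iota) (@galgD _ _ _ _ _) opXY_lowers (ltnW gp)).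
  rewrite (opXY_mono p_prime) //.
  by apply: (scale_nat_mem p_prime hk iota); rewrite ?gp.
move=> l i hl; case: l hl => [|[|l]] hl; last by apply: hxx; lia.
  apply: (swap_mem dA) => //; case: i hl => [|[|i]] hl; try lia.
  by apply: hxx; lia.
by case: i hl => [|i] hl; [lia|apply: hxy; lia].
Qed.

(** The swap gives the pure power of Y, and X d/dY then runs through the other monomials; its
    coefficients are invertible since the degree is below p. *)
Lemma has_layer_gen n g : (g.*2 <= n)%N -> (n - g.*2 < p)%N -> mon (n - g.*2) 0 g \in U ->
  has_layer n g U.
Proof.
move=> gn np h l i; elim: l i => [|l IH] i hl.
  by apply: (swap_mem dA) => //; have -> : i = (n - g.*2)%N by lia.
have := IH i.+1; rewrite -addSnnS => /(_ hl).
by move/(opE_mem p_prime p_ge5 dA hk hU (i := i.+1)); apply; lia.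
Qed.

(* The lower terms are removed by weights: modulo the layers already known to be
   in [U], no basis vector of a layer [j < g] has the torus weight of
   [X ^ (n - 2 g) * D ^ g]. *)
Lemma has_layer_lift n g : (g < p)%N -> (g.*2 <= n)%N -> (n = r %[mod p.-1])%N ->
  has_layer n g (U + layer_span g) -> forall j, (j <= g)%N -> has_layer n j U.
Proof.
move=> gp; elim: g gp => [|g IH] gp gn nr h.
  move=> j; rewrite leqn0 => /eqP ->; move: h; rewrite /layer_span.
  have -> : [set x : Th | (x.2 < 0)%N] = set0 by apply/setP=> x; rewrite !inE.
  by rewrite sp0 addv0.
have {}IH : forall j, (j <= g)%N -> has_layer n j U.
  by apply: IH => //; try lia; apply: has_layer_down.
move=> j; rewrite leq_eqVlt => /orP[/eqP -> {j}|]; last exact: IH.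
have basU (x : Th) : (x.2 <= g)%N -> (wd x <= n)%N -> bs x \in U.
  move=> xg xn; have [l [i [hl ->]]] := bas_mono p_prime p_ge5 red tau w hk iota s r0 xn nr.
  exact: IH.
(* For large [n] all the lower layers already lie in U, so nothing has to be removed. Otherwise the
   forms have degree below p and one vector generates them. *)
have [big|small] := leqP (g.+1.*2 + p) n.
  have WU : (layer_span g.+1 <= U)%VS.
    apply: sp_subP => x; rewrite inE ltnS => xg; apply: basU => //.
    by apply: wdeg_le_large => //; lia.
  by apply: has_layerS h; rewrite subv_add subvv.
apply: has_layer_gen; try lia.
have /memv_addP[u uU [v vW e]] := h (n - g.+1.*2)%N 0%N (ltac:(lia)).
have := congr1 (weight_proj p tau iota (s + g.+1)) e.
rewrite (weight_proj_mono p_prime) // addn0 eqxx /weight_proj galgD => ->.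
apply: memvD; first exact: galg_mem.
move: v vW {e}; apply: (layer_span_op (op := weight_proj p tau iota (s + g.+1))) => [||x]; [exact: galgD|exact: galgZ|].
rewrite ltnS => xg; rewrite [X in weight_proj _ _ _ _ X]/(bs x) (weight_proj_mono p_prime) //.
case: ifP => [|_]; last exact: mem0v.
rewrite -/(bs x) => hw; apply: basU => //; move: hw.
have [big'|small'] := leqP (x.2.*2 + p) n; first by move=> _; exact: wdeg_le_large.
have aE : (n - x.2.*2 = ae x.2)%N.
  have a0 := aexp_gt0 p_ge5 r0 x.2; have aP := aexp_le p_ge5 r x.2.
  apply: (@modP_uniq p) => //; try lia.
  apply/eqP; rewrite -(eqn_modDr x.2.*2) subnK; last by lia.
  by apply/eqP; rewrite nr aexp_mod.
case: x xg small' aE => [[i|] j] /= xg small' aE; last by rewrite wdegN; lia.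
have ip := ntilde_lt p_ge5 i; rewrite /yexp /=.
(* From 2 (g + 1) <= n < 2 j + p the difference g + 1 - j is less than p / 2. So the congruence of
   weights has the single solution i = g + 1 - j, and this is below [ae j]: such a vector has degree
   n. *)
have d0 : (0 < g.+1 - j <= p.-1)%N by lia.
have d1 : (g.+1 - j < p.-1)%N by lia.
have wdE : nat_of_ord i = (g.+1 - j)%N -> (wd (Some i, j) <= n)%N.
  by move=> hi; rewrite wdegS // ifT; lia.
have jg : (j <= g.+1)%N by lia.
have iP : (i <= p.-1)%N by lia.
rewrite -{1}(subnK jg) addnA eqn_modDr eqn_modDl => /eqP hw; apply: wdE.
have [i0|i0] := posnP i.
  by move: hw d0; rewrite i0 mod0n modn_small // => <-.
by apply: (@modP_uniq p) => //; rewrite i0 iP.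
Qed.

End Submodule.
End Submodules.

(** * * Leading coefficients of elements of a submodule *)

Section Key.
Variables (p : nat) (p_prime : prime p) (p_ge5 : (5 <= p)%N).
Variables (A : finComUnitRingType) (k : finFieldType) (red : {rmorphism A -> k}).
Variables (tau : k -> A) (w : A) (dA : dual_numbers red tau w) (hk : #|k| = p).
Variables (E : fieldType) (iota : {rmorphism k -> E}) (s : nat).
Variables (r : Ntilde p 1) (r0 : (0 < r)%N).

Local Notation GL := {'GL_2[A]}.
Local Notation V := {ffun GL -> E^o}.
Local Notation N := (Ntilde p 1).
Local Notation Th := (Theta p 1).
Local Notation mon := (mono red tau w iota s).
Local Notation wd := (wdeg r).
Local Notation ae := (aexp r).
Local Notation bs := (bas red tau w iota s r).
Local Notation sw := (swap A).
Local Notation W m := (layer_span red tau w iota s r m).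
Local Notation HL n g U := (has_layer red tau w iota s n g U).
Local Notation Ly n g := (layer red tau w iota s n g).

Section Top.
Variables (Z : {vspace V}) (hZ : gstable Z) (g : nat) (gp : (g < p)%N).
Local Notation G := (nord p g).
Local Notation a := (ae g).

Definition topv (i : nat) : V := bs (Some (nord p i), G).
Definition topinf : V := bs (None, G).

Let gE : G = g :> nat. Proof. exact: val_nord. Qed.
Let aP := aexp_le p_ge5 r g.
Let a0 := aexp_gt0 p_ge5 r0 g.

Lemma xexp_top i : (i < p)%N ->
  xexp r (Some (nord p i), G) = if (i < a)%N then (a - i)%N else (a + p.-1 - i)%N.
Proof. by move=> ip; rewrite xexpE // !val_nord. Qed.

Lemma topvE i : (i < p)%N ->
  topv i = mon (if (i < a)%N then (a - i)%N else (a + p.-1 - i)%N) i g.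
Proof. by move=> ip; rewrite /topv /bas xexp_top // /yexp /= !val_nord. Qed.

Lemma topinfE : topinf = mon 0 a g.
Proof. by rewrite /topinf /bas /yexp /= gE. Qed.

Lemma mono_topv l i : (i < p)%N -> (0 < l)%N -> (l + i + g.*2 = r %[mod p.-1])%N ->
  mon l i g = topv i.
Proof.
move=> ip l0 h; rewrite /topv -[in LHS]gE; apply: (mono_Some p_prime) => //.
  by rewrite val_nord // red_exp_small //; lia.
by rewrite gE.
Qed.

Lemma topv_mod i : (i < p)%N ->
  (xexp r (Some (nord p i), G) + i + g.*2 = r %[mod p.-1])%N.
Proof.
move=> ip; have := wdeg_mod p_ge5 r0 (Some (nord p i), G).
by rewrite /wdeg /yexp /= !val_nord.
Qed.

Lemma opE_topv i : (i < p)%N -> opE p tau iota (topv i) = i%:R *: topv i.-1.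
Proof.
move=> ip; rewrite [in LHS]/topv /bas (opE_mono p_prime) //; last first.
  by rewrite /yexp /= val_nord.
rewrite /yexp /= !val_nord //; case: i ip => [|i] ip; first by rewrite !scale0r.
rewrite /= mono_topv //; first by lia.
by rewrite -(topv_mod ip); congr (_ %% _)%N; lia.
Qed.

(** This is also the image of [topv a], so [topinf - topv a] is killed; it is supported on X = 0. *)
Lemma opE_topinf : opE p tau iota topinf = a%:R *: topv a.-1.
Proof.
rewrite topinfE (opE_mono p_prime) //; last by lia.
rewrite mono_topv //; first by lia.
by rewrite -(aexp_mod p_ge5 r0 g); congr (_ %% _)%N; lia.
Qed.

Let oe := opE p tau iota.
Lemma opED u v : oe (u + v) = oe u + oe v. Proof. exact: galgD. Qed.
Lemma opEZ c u : oe (c *: u) = c *: oe u. Proof. exact: galgZ. Qed.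
Lemma opE_mem_gen u : u \in Z -> oe u \in Z. Proof. exact: lin_coef_mem. Qed.

Lemma opE_sum_topv n (h : nat -> E) : (n < p)%N ->
  oe (\sum_(i < n.+1) h i *: topv i) = \sum_(i < n) (h i.+1 * i.+1%:R) *: topv i.
Proof.
have oe0 : oe 0 = 0 by exact: galg0.
move=> np; rewrite (big_morph oe opED oe0) big_ord_recl opEZ [oe _]opE_topv /=; last by lia.
rewrite scale0r scaler0 add0r; apply: eq_bigr => j _.
by rewrite opEZ [oe _]opE_topv ?scalerA // /bump add1n; have := ltn_ord j; lia.
Qed.

Lemma big_ord_pred n (F : nat -> V) : (0 < n)%N ->
  \sum_(i < n) F i = F 0%N + \sum_(i < n.-1) F i.+1.
Proof. by case: n => // n _; rewrite big_ord_recl. Qed.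

Lemma sum_delta n j (c : E) (jn : (j < n)%N) :
  \sum_(i < n) (if i == j :> nat then c else 0) *: topv i = c *: topv j.
Proof.
rewrite (bigD1 (Ordinal jn)) //= eqxx big1 ?addr0 // => i hi.
by rewrite ifN ?scale0r.
Qed.

Lemma swap_top0 : topv 0 \in Z <-> topinf \in Z.
Proof.
rewrite topvE ?a0 ?subn0 ?topinfE; last by lia.
by split; apply: swap_mem.
Qed.

(** Iterating X d/dY lowers the leading index to [t] and multiplies its coefficient by integers
    prime to p. The remaining terms have index below [t] and lie in Z by assumption. *)
Lemma descent n t (h : nat -> E) : (n <= p)%N ->
  (forall i, (i < t)%N -> topv i \in Z) ->
  \sum_(i < n) h i *: topv i \in Z ->
  (exists2 i, (t <= i < n)%N & h i != 0) -> topv t \in Z.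
Proof.
elim: n h => [|n IH] h np low; first by move=> _ [i]; rewrite ltn0 andbF.
have [hn|hn] := eqVneq (h n) 0.
  rewrite big_ord_recr /= hn scale0r addr0 => hs [i /andP[ti]].
  rewrite ltnS leq_eqVlt => /orP[/eqP ->|ilt hi]; first by rewrite hn eqxx.
  by apply: (IH h) => //; [lia|exists i; rewrite ?ti].
move=> hs [i /andP[ti iN] _].
have [tn|nt|tn] := ltngtP t n; last 2 first.
- by lia.
- move: hs; rewrite big_ord_recr /= tn => hs.
  have low' : \sum_(i < n) h i *: topv i \in Z.
    by apply: memv_suml => j _; rewrite memvZ // low // tn.
  have := memvB hs low'; rewrite addrAC subrr add0r rpredZeq.
  by rewrite (negPf hn).
apply: (IH (fun i => h i.+1 * i.+1%:R)) => //; first by lia.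
  by rewrite -opE_sum_topv //; apply: opE_mem_gen.
exists n.-1; first by lia.
rewrite prednK ?mulf_neq0 //; last by lia.
by apply: (natr_iota_neq0 p_prime hk iota); lia.
Qed.

Lemma zero_from n t (h : nat -> E) :
  (exists2 i, (t <= i < n)%N & h i != 0) \/ (forall i, (t <= i < n)%N -> h i = 0).
Proof.
have [/existsP[i /andP[ti hi]]|/existsPn hn] :=
    boolP [exists i : 'I_n, (t <= i)%N && (h i != 0)].
  by left; exists i => //; rewrite ti ltn_ord.
right=> i /andP[ti iN]; have := hn (Ordinal iN); rewrite /= ti /=.
by move/negPn/eqP.
Qed.

(** X^(p-1) and Y^(p-1) are the indicators of X != 0 and Y != 0, and one of the two holds: this is
    inclusion-exclusion. *)
Lemma mono_const : a = p.-1 -> mon 0 0 g = topv 0 + topinf - topv p.-1.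
Proof.
move=> ap; have p1 : (p.-1 < p)%N by lia.
rewrite !topvE ?topinfE ?a0 ?ap ?ltnn ?subn0 ?addnK //; try lia.
have Xp c : iota c ^+ p.-1 = (c != 0)%:R.
  have [->|c0] := eqVneq c 0; first by rewrite rmorph0 expr0n gtn_eqF //; lia.
  by rewrite -rmorphXn (expf_prime_card p_prime hk) // rmorph1.
apply/ffunP=> h; rewrite !ffunE !expr0 /Xc /Yc !Xp.
have := bottom_row_neq0 dA h; move: (Dc _ _ _ _ _) (detE _ _ _) => d e.
by case: eqP => _; case: eqP => _ //= _; ring.
Qed.

(** The upper bound on [n] is there to leave finitely many layers, for
    [finitely_many_submodules]. *)
Definition in_layer (v : V) : Prop :=
  exists n, [/\ (g.*2 <= n)%N, (n <= g.*2 + 2 * p.-1)%N, (n = r %[mod p.-1])%N,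
    HL n g Z & v \in Ly n g].

Lemma in_layer_small (h : nat -> E) c : topv 0 \in Z ->
  (forall i, (a <= i < p)%N -> h i = 0) ->
  in_layer (\sum_(i < p) h i *: topv i + c *: topinf).
Proof.
move=> h0 ha; exists (a + g.*2)%N; split; try lia.
- by rewrite (aexp_mod p_ge5 r0).
- apply: (has_layer_gen p_prime p_ge5 dA hk r0 hZ); rewrite ?addnK; try lia.
  by move: h0; rewrite topvE ?a0 ?subn0 //; lia.
apply: memvD; last by rewrite memvZ // topinfE; apply: mono_layer; rewrite add0n.
apply: memv_suml => i _; have [ia|ai] := ltnP i a.
  by rewrite memvZ // topvE // ia; apply: mono_layer; lia.
by rewrite ha ?scale0r ?mem0v // ai ltn_ord.
Qed.

(** The swap turns [topv a] into [topv p.-1], whose degree is the largest in the layer; by [bas_le]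
    Z then contains every basis vector of the layer. *)
Lemma in_layer_full (h : nat -> E) c : topv a \in Z ->
  in_layer (\sum_(i < p) h i *: topv i + c *: topinf).
Proof.
move=> ha; have ap : (a < p)%N by lia.
have hp : topv p.-1 \in Z.
  move: ha; rewrite !topvE ?ltnn //; last by lia.
  rewrite addKn; case: ifP => pa; first by lia.
  rewrite addnK; exact: swap_mem.
have hall x : x.2 = G -> bs x \in Z.
  move=> x2; apply: (bas_le p_prime p_ge5 dA hk r0 hZ hp).
  rewrite /le_wdeg x2 leqnn wdegS // val_nord //; last by lia.
  have := wdeg_max p_ge5 r0 x; rewrite x2 gE.
  by case: ifP; lia.
have nr : (a + p.-1 + g.*2 = r %[mod p.-1])%N by rewrite addnAC modnDr (aexp_mod p_ge5 r0).
exists (a + p.-1 + g.*2)%N; split=> //; try lia.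
- move=> l i hl.
  have [||x hx [hx2 _]] := mono_bas p_prime p_ge5 red tau w hk iota s r0 (l := l) (i := i) (j := G).
  + by lia.
  + by rewrite gE hl.
  by rewrite -gE hx hall.
have Lb x : x.2 = G -> bs x \in Ly (a + p.-1 + g.*2) g.
  move=> x2; have hw : (wd x <= a + p.-1 + g.*2)%N.
    by have := wdeg_max p_ge5 r0 x; rewrite x2 gE.
  have [l [i [hl ->]]] := bas_mono p_prime p_ge5 red tau w hk iota s r0 hw nr.
  by rewrite x2 gE; apply: mono_layer; rewrite -hl x2 gE.
by apply: memvD; [apply: memv_suml => i _; rewrite memvZ // Lb|rewrite memvZ // Lb].
Qed.

Lemma in_layer_top (h : nat -> E) c : topv 0 \in Z ->
  \sum_(i < p) h i *: topv i + c *: topinf \in Z ->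
  in_layer (\sum_(i < p) h i *: topv i + c *: topinf).
Proof.
move=> h0 hv; have [ex|ha] := zero_from p a h; last exact: in_layer_small.
apply: in_layer_full.
have hinf : topinf \in Z by apply/swap_top0.
have hlow i : (i < a)%N -> topv i \in Z.
  move=> ia; apply: (bas_le p_prime p_ge5 dA hk r0 hZ hinf).
  rewrite /le_wdeg leqnn wdegN wdegS // val_nord //; last by lia.
  by rewrite gE ia /=.
apply: (@descent p a h) => //.
by rewrite -[X in X \in _](addrK (c *: topinf)) memvB // memvZ.
Qed.

(* [opE] is nilpotent and lowers the exponent of Y, so it reaches [topv 0] unless
   the element is supported at the two fixed points of the unipotent group; in that
   case [swap] moves it out of this support, except for a multiple of [D ^ g]. *)
Lemma top_cases (h : nat -> E) c (v := \sum_(i < p) h i *: topv i + c *: topinf) :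
  v \in Z -> v = 0 \/ in_layer v.
Proof.
move=> hv.
have [h0|h0] := boolP (topv 0 \in Z); first by right; exact: in_layer_top.
have low0 i : (i < 0)%N -> topv i \in Z by [].
have p1 : (p.-1.+1 = p)%N by lia.
(* The coefficients of X d/dY applied to [v]; [topinf] contributes at the index a - 1 only. *)
pose h1 i := h i.+1 * i.+1%:R + (if i == a.-1 then c * a%:R else 0).
have ap : (a.-1 < p.-1)%N by lia.
have s1 : \sum_(i < p.-1) h1 i *: topv i \in Z.
  under eq_bigr do rewrite scalerDl.
  rewrite big_split /= sum_delta // -opE_sum_topv; last by lia.
  by rewrite [in X in X + _]p1 -scalerA -opE_topinf -/oe -opEZ -opED; apply: opE_mem_gen.
have [ex|hz] := zero_from p.-1 0 h1.
  by case/negP: h0; apply: (descent (leq_pred _) low0 s1 ex).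
have an0 : a%:R != 0 :> E by apply: (natr_iota_neq0 p_prime hk iota); lia.
have ha : h a = - c.
  have := hz a.-1; rewrite /h1 prednK // eqxx -mulrDl => /(_ ltac:(lia)).
  by move/eqP; rewrite mulf_eq0 (negPf an0) orbF addr_eq0 => /eqP.
have hi i : (0 < i < p)%N -> i != a -> h i = 0.
  move=> ip ia; have := hz i.-1; rewrite /h1 prednK; last by lia.
  rewrite ifN ?addr0; last by lia.
  move=> /(_ ltac:(lia))/eqP; rewrite mulf_eq0 (negPf (natr_iota_neq0 p_prime hk iota ip)).
  by rewrite orbF => /eqP.
(* By [descent] and [h0] all the coefficients [h1] vanish. What is left is a multiple of X^a D^g
   plus one of Y^a (1 - X^(p-1)) D^g. *)
have vE : v = h 0%N *: topv 0 + c *: (topinf - topv a).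
  have p0 : (0 < p)%N by lia.
  rewrite /v (big_ord_pred (fun i => h i *: topv i) p0).
  rewrite (bigD1 (Ordinal ap)) //= prednK // ha big1 => [|j hj]; last first.
    rewrite hi ?scale0r //; first by have := ltn_ord j; lia.
    by apply: contra hj => /eqP hj; apply/eqP/val_inj; rewrite /= -hj.
  by rewrite addr0 scaleNr scalerBr -addrA; congr (_ + _); rewrite addrC.
have [c0|c0] := eqVneq c 0.
  move: hv; rewrite vE c0 scale0r addr0 rpredZeq (negPf h0) orbF => /eqP ->.
  by left; rewrite scale0r.
(* The swap exchanges [topv 0] with [topinf] and [topv a] with [topv p.-1], up to one common sign;
   the result is again tested with X d/dY. *)
have swv : h 0%N *: topinf + c *: (topv 0 - topv p.-1) \in Z.
  have := hZ sw hv; rewrite vE rtransD !rtransZ rtransD rtransN.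
  rewrite !topvE ?topinfE ?a0 ?ltnn ?subn0 ?addKn; try lia.
  rewrite !(rtrans_swap dA) -scalerBr !scalerA ![_ * (-1) ^+ _]mulrC -!scalerA -scalerDr rpredZsign.
  by rewrite ifN ?addnK //; lia.
pose h2 i := (if i == a.-1 then h 0%N * a%:R else 0) - (if i == p.-2 then c * p.-1%:R else 0).
have pp : (p.-2 < p.-1)%N by lia.
have s2 : \sum_(i < p.-1) h2 i *: topv i \in Z.
  under eq_bigr do rewrite scalerBl.
  rewrite sumrB !sum_delta // -!scalerA -opE_topinf -opE_topv; last by lia.
  have := opE_mem_gen swv; rewrite opED !opEZ opED -scaleN1r opEZ.
  by rewrite [oe (topv 0)]opE_topv ?scale0r ?add0r ?scaleN1r ?scalerN //; lia.
have [ex|hz2] := zero_from p.-1 0 h2.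
  by case/negP: h0; apply: (descent (leq_pred _) low0 s2 ex).
have pn0 : p.-1%:R != 0 :> E.
  by apply: (natr_iota_neq0 p_prime hk iota); move: p_ge5; clear; lia.
have p2 : (0 <= p.-2 < p.-1)%N by move: p_ge5; clear; lia.
(* The coefficient at p - 2 can vanish only if the indices a - 1 and p - 2 agree. Then a = p - 1 and
   [h 0 = c], and [v] is c D^g by [mono_const]. *)
have := hz2 p.-2 p2; rewrite /h2 eqxx.
case: eqP => [apq|_] /eqP; last by rewrite sub0r oppr_eq0 mulf_eq0 (negPf c0) (negPf pn0).
have {}apq : a = p.-1 by move: a0 apq p_ge5; clear; lia.
rewrite {1}apq -mulrBl mulf_eq0 (negPf pn0) orbF subr_eq0 => /eqP hc.
have vc : v = c *: mon 0 0 g.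
  by rewrite vE mono_const // hc apq -scalerDr addrA.
have cZ : mon 0 0 g \in Z by move: hv; rewrite vc rpredZeq (negPf c0).
right; exists g.*2; split=> //; first by rewrite leq_addr.
- by rewrite -(aexp_mod p_ge5 r0 g) apq modnDl.
- move=> l i hl; suff [-> ->] : l = 0%N /\ i = 0%N by [].
  by move: hl; clear; lia.
by rewrite vc memvZ //; apply: mono_layer.
Qed.

End Top.

(** Because Z contains everything of smaller degree in D, the leading part [v] of [u] is itself in
    Z, and [top_cases] applies to it alone. *)
Lemma classification Z g u : gstable Z -> (g < p)%N -> (W g <= Z)%VS ->
  u \in Z -> u \in W g.+1 -> exists2 v, u - v \in W g & v = 0 \/ in_layer Z g v.
Proof.
move=> hZ gp WZ uZ /(spP bs)[c uE hc].
have gE : nord p g = g :> nat by rewrite val_nord.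
pose h i := c (Some (nord p i), nord p g).
pose v := \sum_(i < p) h i *: topv g i + c (None, nord p g) *: topinf g.
have vE : v = \sum_x (if x.2 == nord p g then c x else 0) *: bs x.
  rewrite big_Theta addrC /v; congr (_ + _); last first.
    rewrite (bigD1 (nord p g)) //= eqxx big1 ?addr0 // => j /negPf ->.
    by rewrite scale0r.
  have hN m : m = p -> \sum_(i < p) h i *: topv g i = \sum_(i < m) h i *: topv g i by move=> ->.
  rewrite (hN (p ^ 1).-1.+1); last by rewrite expn1; lia.
  apply: eq_bigr => i _; rewrite /h /topv /= nordK //.
  rewrite (bigD1 (nord p g)) //= eqxx big1 ?addr0 // => j /negPf ->.
  by rewrite scale0r.
have huv : u - v \in W g.
  apply/spP; exists (fun x => if x.2 == nord p g then 0 else c x).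
    rewrite uE vE -sumrB; apply: eq_bigr => x _; rewrite -scalerBl.
    by case: eqP; rewrite ?subrr ?subr0.
  move=> x; rewrite inE -leqNgt => gx; case: eqP => // /eqP xg; apply: hc.
  rewrite inE ltnS -ltnNge ltn_neqAle gx andbT; apply: contra xg => /eqP xg.
  by apply/eqP/val_inj; rewrite /= gE.
exists v => //; apply: top_cases => //.
by rewrite -[X in X \in _](subKr u) memvB // (subvP WZ).
Qed.

(** Peel off the leading part of an element of U: it lies in a layer of U + [W g], which
    [has_layer_lift] moves into U. Stated as an inclusion test, this serves irreducibility,
    finiteness and the description of all submodules. *)
Lemma submodule_layers U (R : {vspace V}) : gstable U -> (U <= W p)%VS ->
  (forall g n, (g < p)%N -> (g.*2 <= n)%N -> (n <= g.*2 + 2 * p.-1)%N ->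
     (n = r %[mod p.-1])%N -> HL n g U -> HL n g R) ->
  (U <= R)%VS.
Proof.
move=> hU UW hR.
suff H m : (m <= p)%N -> (U :&: W m <= R)%VS.
  by have := H p (leqnn _); rewrite (capv_idPl UW).
elim: m => [|g IH] mp; apply/subvP => u; rewrite memv_cap => /andP[uU uW].
  move: uW; rewrite /layer_span; have -> : [set x : Th | (x.2 < 0)%N] = set0.
    by apply/setP=> x; rewrite !inE.
  by rewrite sp0 memv0 => /eqP ->; rewrite mem0v.
have gZ : gstable (U + W g)%VS.
  by apply: gstableD => //; apply: gstable_layer_span => //; exact: ltnW.
have WZ := addvSr U (W g).
have uZ : u \in (U + W g)%VS by apply: (subvP (addvSl _ _)).
have IH' := subvP (IH (ltnW mp)).
have [v uv [v0|]] := classification gZ mp WZ uZ uW.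
  by apply: IH'; rewrite memv_cap uU -[u]subr0 -v0.
case=> n [gn ng nr hl vn].
have hlU := has_layer_lift p_prime p_ge5 dA hk r0 hU mp gn nr hl (leqnn g).
have hlR := hR g n mp gn ng nr hlU.
have vU : v \in U by apply: (subvP _ _ vn); apply/has_layerP.
have vR : v \in R by apply: (subvP _ _ vn); apply/has_layerP.
by rewrite -(subrK v u) memvD // IH' // memv_cap uv memvB.
Qed.

End Key.

(** * Composition series *)

Section Lattice.
Variables (p : nat) (p_prime : prime p) (p_ge5 : (5 <= p)%N).
Variables (A : finComUnitRingType) (k : finFieldType) (red : {rmorphism A -> k}).
Variables (tau : k -> A) (w : A) (dA : dual_numbers red tau w) (hk : #|k| = p).
Variables (E : fieldType) (iota : {rmorphism k -> E}) (s : nat).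
Variables (r : Ntilde p 1) (r0 : (0 < r)%N).

Local Notation GL := {'GL_2[A]}.
Local Notation V := {ffun GL -> E^o}.
Local Notation N := (Ntilde p 1).
Local Notation Th := (Theta p 1).
Local Notation wd := (wdeg r).
Local Notation ae := (aexp r).
Local Notation bs := (bas red tau w iota s r).
Local Notation W m := (layer_span red tau w iota s r m).

Local Notation tc := (tcode p 1).
Local Notation ty x := (type_of r x).
Local Notation leq_ty T T' := (le_wdegT r T T').
Local Notation down_closed D := (down_closed r D).
Local Notation below_type T := (below_type r T).
Local Notation strictly_below T := (strictly_below r T).

Definition of_types (D : {pred tc}) : {set Th} := [set x | ty x \in D].
Definition types_span (D : {pred tc}) : {vspace V} := sp bs (of_types D).

Let bfree := bas_free p_prime p_ge5 dA hk r0 (iota := iota) (s := s).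

Lemma of_types_below T :
  of_types (below_type T) = [set x : Th | (x.2 <= T.2)%N && (wd x <= wdegT r T)%N].
Proof. by apply/setP=> x; rewrite !inE /le_wdegT wdegT_type_of. Qed.

Lemma gstable_below T : gstable (types_span (below_type T)).
Proof.
have a0 := aexp_gt0 p_ge5 r0 T.2; rewrite /types_span of_types_below; apply: gstable_sp => //.
- exact: ntilde_lt.
- by rewrite /wdegT; case: ifP; lia.
rewrite /wdegT; case: ifP => _; first by rewrite addn0 (aexp_mod p_ge5 r0).
by rewrite addnAC modnDr (aexp_mod p_ge5 r0).
Qed.

Lemma types_spanS (D D' : {pred tc}) : {subset D <= D'} -> (types_span D <= types_span D')%VS.
Proof. by move=> h; apply: spS; apply/subsetP=> x; rewrite !inE; exact: h. Qed.

Lemma types_span_eq (D D' : {pred tc}) : D =i D' -> types_span D = types_span D'.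
Proof. by move=> h; congr sp; apply/setP=> x; rewrite !inE h. Qed.

Lemma bas_types_span D x : (bs x \in types_span D) = (ty x \in D).
Proof. by rewrite sp_basis // inE. Qed.

Lemma types_span_le D D' : (types_span D <= types_span D')%VS -> {subset D <= D'}.
Proof.
move=> /subvP h T TD; have [x xT] := type_of_surj p_ge5 r0 T.
by have := h (bs x); rewrite !bas_types_span xT; apply.
Qed.

Lemma gstable_types_span D : down_closed D -> gstable (types_span D).
Proof.
move=> hD h u /(spP bs)[c -> hc]; rewrite rtrans_sum; apply: memv_suml => x _.
have [xD|/hc ->] := boolP (x \in of_types D); last by rewrite scale0r rtrans0 mem0v.
rewrite rtransZ memvZ //.
have : (types_span (below_type (ty x)) <= types_span D)%VS.
  by apply: types_spanS => T hT; apply: hD hT _; rewrite inE in xD.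
move/subvP; apply; apply: gstable_below.
by rewrite bas_types_span inE le_wdegT_refl.
Qed.

Lemma below_sub U x : gstable U -> bs x \in U -> (types_span (below_type (ty x)) <= U)%VS.
Proof.
move=> hU hx; apply: sp_subP => y; rewrite !inE => hy.
by apply: (bas_le p_prime p_ge5 dA hk r0 hU hx); rewrite le_wdegE.
Qed.

Lemma layer_spanT : W p = types_span predT.
Proof. by congr sp; apply/setP=> x; rewrite !inE ntilde_lt. Qed.

Section Factor.
Variables (D : {pred tc}) (T : tc).
Hypotheses (hD : down_closed D) (TD : T \notin D).
Hypothesis hT : {subset strictly_below T <= D}.

Let D' : {pred tc} := [pred T' | (T' == T) || (T' \in D)].

Lemma down_add : down_closed D'.
Proof.
move=> T1 T2 h /orP[/eqP e|h1]; rewrite inE; last by rewrite (hD h h1) orbT.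
have [//|ne] := eqVneq T2 T; apply: hT; rewrite inE ne -e.
exact: h.
Qed.

Lemma types_span_add_sub : (types_span D <= types_span D')%VS.
Proof. by apply: types_spanS => T' h; rewrite inE h orbT. Qed.

Lemma is_subquot_factor : is_subquot (types_span D', types_span D).
Proof.
split; first exact: gstable_types_span down_add.
by split; [exact: gstable_types_span|exact: types_span_add_sub].
Qed.

(* The only submodule layers which are not spanned by basis vectors consist of
   a multiple of [D ^ g]; it lies in the span of [T <= (setT, g)]. *)
Lemma irreducible_factor : irreducible (types_span D', types_span D).
Proof.
split; first exact: is_subquot_factor.
  apply/eqP => /= e; have /types_span_le/(_ T) : (types_span D' <= types_span D)%VS by rewrite e subvv.
  by rewrite inE eqxx (negPf TD) => /(_ isT).
move=> N [hN ND'] /= DN.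
have [x0 x0T] := type_of_surj p_ge5 r0 T.
have [x0N|x0N] := boolP (bs x0 \in N).
  right; apply/eqP; rewrite eqEsubv ND' /=; apply: sp_subP => y.
  rewrite !inE => /orP[/eqP yT|yD].
    by apply: (subvP (below_sub hN x0N)); rewrite bas_types_span inE x0T yT le_wdegT_refl.
  by apply: (subvP DN); rewrite bas_types_span.
have basN x : bs x \in N -> bs x \in types_span D.
  move=> xN; have := subvP ND' _ xN; rewrite !bas_types_span inE => /orP[/eqP xT|//].
  case/negP: x0N; apply: (subvP (below_sub hN xN)).
  by rewrite bas_types_span inE x0T xT le_wdegT_refl.
left; apply/eqP; rewrite eqEsubv DN andbT.
apply: (submodule_layers p_prime p_ge5 dA hk r0 (iota := iota) (s := s) hN).
  rewrite layer_spanT; apply: subv_trans ND' _; exact: types_spanS.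
move=> g n gp gn _ nr hl l i li.
have gE : nord p g = g :> nat by rewrite val_nord.
have mN := hl l i li.
have [li0|li0] := posnP (l + i).
  have [l0 i0] : l = 0%N /\ i = 0%N by move: li0; clear; lia.
  move: mN; rewrite l0 i0.
  have ap : ae g = p.-1.
    apply: (@modP_uniq p) => //.
    - by rewrite aexp_gt0 // aexp_le.
    - by rewrite leqnn andbT; move: p_ge5; clear; lia.
    by apply/eqP; rewrite -(eqn_modDr g.*2) aexp_mod // modnDl -nr -li li0.
  rewrite (mono_const p_prime p_ge5 dA hk iota s r0) //.
  rewrite /topv /topinf; set G := nord p g.
  set x1 := (Some (nord p 0), G); set xi := (None, G); set xl := (Some (nord p p.-1), G) => cN.
  have v0 : nord p 0 = 0%N :> nat by rewrite val_nord //; lia.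
  have vl : nord p p.-1 = p.-1 :> nat by rewrite val_nord //; lia.
  have wl : wd xl = (p.-1 + p.-1 + g.*2)%N by rewrite wdegS // vl gE ap ltnn.
  have w1 : wd x1 = (p.-1 + g.*2)%N by rewrite wdegS // v0 gE ap ifT //; lia.
  have wi : wd xi = (p.-1 + g.*2)%N by rewrite wdegN gE ap.
  have le1 : leq_ty (ty x1) (ty xl) by rewrite -le_wdegE // /le_wdeg leqnn wl w1 /= -addnA leq_addl.
  have lei : leq_ty (ty xi) (ty xl) by rewrite -le_wdegE // /le_wdeg leqnn wl wi /= -addnA leq_addl.
  have P0 : (0 < p.-1)%N by move: p_ge5; clear; lia.
  have lt1 : (wd x1 < wd xl)%N by rewrite wl w1 -addnA ltn_add2l -[X in (X < _)%N]add0n ltn_add2r.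
  have lti : (wd xi < wd xl)%N by rewrite wl wi -addnA ltn_add2l -[X in (X < _)%N]add0n ltn_add2r.
  have ne1 : ty x1 != ty xl.
    by apply/eqP => /(congr1 (wdegT r)); rewrite !wdegT_type_of // => e; rewrite e ltnn in lt1.
  have nei : ty xi != ty xl.
    by apply/eqP => /(congr1 (wdegT r)); rewrite !wdegT_type_of // => e; rewrite e ltnn in lti.
  (* D^g is the sum of the vectors of [x1] and [xi] minus that of [xl]. As [xl] has another type
     than [x1] and [xi], freeness forces its type to occur in D'. *)
  have xlD' : ty xl \in D'.
    have [//|hn] := boolP (ty xl \in D').
    pose S := of_types D' :|: [set x1; xi].
    have : bs xl \in sp bs S.
      have -> : bs xl = bs x1 + bs xi - (bs x1 + bs xi - bs xl) by rewrite subKr.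
      rewrite memvB //; first by rewrite memvD // mem_sp // !inE eqxx ?orbT.
      by apply: (subvP (spS _ (subsetUl _ _))); apply: (subvP ND').
    rewrite sp_basis // in_setU; case/orP; first by rewrite in_set (negPf hn).
    by rewrite !inE => /orP[] /eqP e; [move: ne1|move: nei]; rewrite e eqxx.
  have [xlD|xlD] := boolP (ty xl \in D).
    apply: memvB; last by rewrite bas_types_span.
    by apply: memvD; rewrite bas_types_span; [exact: hD le1 xlD|exact: hD lei xlD].
  move: xlD'; rewrite inE (negPf xlD) orbF => /eqP xlT.
  have b1 : bs x1 \in types_span D by rewrite bas_types_span; apply: hT; rewrite inE -xlT ne1 le1.
  have bi : bs xi \in types_span D by rewrite bas_types_span; apply: hT; rewrite inE -xlT nei lei.
  have xlN : bs xl \in N.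
    have -> : bs xl = bs x1 + bs xi - (bs x1 + bs xi - bs xl) by rewrite subKr.
    by rewrite memvB // memvD // (subvP DN).
  by have := basN _ xlN; rewrite bas_types_span (negPf xlD).
have [|x hx _] := mono_bas p_prime p_ge5 red tau w hk iota s r0 (j := nord p g) li0.
  by rewrite gE li.
by rewrite gE in hx; move: mN; rewrite hx; exact: basN.
Qed.

Definition type_subquot : subquot GL E := (types_span (below_type T), types_span (strictly_below T)).

Lemma is_subquot_type : is_subquot type_subquot.
Proof.
split; first exact: (gstable_types_span (@down_below p r T)).
split; first exact: (gstable_types_span (down_strict p_ge5 r0 (T := T))).
by apply: types_spanS => T' /andP[].
Qed.

Lemma factor_iso : subquot_iso (types_span D', types_span D) type_subquot.
Proof.
apply: second_iso; [exact: is_subquot_factor|exact: is_subquot_type| |] => /=.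
  rewrite -spU; congr sp; apply/setP=> x; rewrite !inE.
  have [->|ne] := eqVneq (ty x) T; first by rewrite le_wdegT_refl.
  rewrite /=; case: (boolP (leq_ty _ _)) => //= h.
  by apply: hT; rewrite inE ne.
rewrite spI //; congr sp; apply/setP=> x; rewrite !inE.
have [->|ne] := eqVneq (ty x) T; first by rewrite (negPf TD) andbF.
rewrite /=; case: (boolP (leq_ty _ _)) => //= h.
by symmetry; apply: hT; rewrite inE ne.
Qed.

End Factor.

(** In a list by increasing [rankT] every initial segment is closed downwards, so the spans of the
    segments are submodules, each obtained from the previous one by adding a single type. *)
Lemma JH_types_span (D : {pred tc}) : down_closed D ->
  JH_constituents (types_span D) [seq type_subquot T | T in D].
Proof.
move=> hD; pose q := sort (relpre (@rankT p) leq) (enum D).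
have qm T : (T \in q) = (T \in D) by rewrite mem_sort mem_enum.
have qu : uniq q by rewrite sort_uniq enum_uniq.
have qlt T T' : T \in D -> T' \in strictly_below T -> T' \in q /\ (index T' q < index T q)%N.
  move=> TD /andP[ne le]; have T'D := hD _ _ le TD; rewrite qm; split=> //.
  rewrite ltnNge; apply/negP => hi.
  have st : sorted (relpre (@rankT p) leq) q.
    by apply: sort_sorted => a b; exact: leq_total.
  have tr : transitive (relpre (@rankT p) leq) by move=> a b c; exact: leq_trans.
  have rf : reflexive (relpre (@rankT p) leq) by move=> a; exact: leqnn.
  have := sorted_leq_index tr rf st; move=> /(_ T T'); rewrite !qm => /(_ TD T'D hi) /= h.
  by case/eqP: ne; apply: (rankT_inj p_ge5 r0); apply/eqP; rewrite eqn_leq h (rankT_le p_ge5 r0).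
pose c := [seq types_span (mem (take i.+1 q)) | i <- seq.iota 0 (size q)].
have szc : size c = size q by rewrite size_map size_iota.
have nthc i : (i <= size q)%N -> nth 0%VS (0%VS :: c) i = types_span (mem (take i q)).
  case: i => [|i] iq /=; last by rewrite (nth_map 0%N) ?size_iota // nth_iota.
  rewrite take0 /types_span; have -> : of_types (mem [::]) = set0 by apply/setP=> x; rewrite !inE.
  by rewrite sp0.
pose d : tc := (set0, ord0).
have fac i : (i < size q)%N -> let T := nth d q i in
  [/\ down_closed (mem (take i q)), T \notin (mem (take i q)),
      {subset strictly_below T <= mem (take i q)} &
      factor c i = (types_span [pred T' | (T' == T) || (T' \in mem (take i q))], types_span (mem (take i q)))].
  move=> iq T.
  have Tq : T \in q by rewrite mem_nth.
  have memtake T' : (T' \in mem (take i q)) = (T' \in q) && (index T' q < i)%N.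
    rewrite [LHS](_ : _ = (T' \in take i q)) // in_take_leq ?(ltnW iq) // -index_mem.
    by rewrite andb_idl // => /ltn_trans; apply.
  split.
  - move=> T1 T2 h; rewrite !memtake => /andP[h1 h2].
    have [->|ne] := eqVneq T2 T1; first by rewrite h1.
    have [] := qlt T1 T2; rewrite -?qm //; first by rewrite inE ne.
    by move=> -> h3; rewrite (ltn_trans h3).
  - by rewrite memtake /T index_uniq // ltnn andbF.
  - move=> T' h; rewrite memtake; have [] := qlt T T' _ h; first by rewrite -qm.
    by move=> ->; rewrite /T index_uniq.
  rewrite /factor nthc // nthc; last exact: ltnW.
  congr (_, _); apply: types_span_eq => T'.
  by rewrite [LHS](_ : _ = (T' \in take i.+1 q)) // (take_nth d) // mem_rcons inE.
exists c, (map type_subquot q); split.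
- split.
    have -> : last 0%VS c = nth 0%VS (0%VS :: c) (size q) by rewrite -szc -last_nth.
    rewrite nthc //; apply: types_span_eq => T.
    by rewrite [LHS](_ : _ = (T \in take (size q) q)) // take_size qm.
  move=> i; rewrite szc => iq; have [h1 h2 h3 ->] := fac i iq.
  exact: irreducible_factor.
- by rewrite perm_map // perm_sym perm_sort.
- by rewrite size_map szc.
move=> i; rewrite szc => iq; rewrite (nth_map d) //.
by have [h1 h2 h3 ->] := fac i iq; exact: factor_iso.
Qed.

End Lattice.

(** * Submodules with irreducible cosocle *)

Section Cosocle.
Variables (p : nat) (p_prime : prime p) (p_ge5 : (5 <= p)%N).
Variables (A : finComUnitRingType) (k : finFieldType) (red : {rmorphism A -> k}).
Variables (tau : k -> A) (w : A) (dA : dual_numbers red tau w) (hk : #|k| = p).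
Variables (E : fieldType) (iota : {rmorphism k -> E}) (s : nat).
Variables (r : Ntilde p 1) (r0 : (0 < r)%N).

Local Notation GL := {'GL_2[A]}.
Local Notation V := {ffun GL -> E^o}.
Local Notation N := (Ntilde p 1).
Local Notation Ly n g := (layer red tau w iota s n g).

Local Notation tc := (tcode p 1).
Local Notation ty x := (type_of r x).
Local Notation leq_ty T T' := (le_wdegT r T T').
Local Notation mT D := (types_span red tau w iota s r D).
Local Notation VT T := (types_span red tau w iota s r (below_type r T)).
Local Notation RT T := (types_span red tau w iota s r (strictly_below r T)).

(** Every submodule is the sum of the layers it contains, including those spanned by a power of
    D. *)
Lemma finitely_many_submodules : exists S : seq {vspace V},
  forall U, gstable U -> (U <= mT predT)%VS -> U \in S.
Proof.
(* The layers that matter have g < p and n <= 2 g + 2 (p - 1) < 4 p. *)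
pose J : finType := ('I_p * 'I_(4 * p))%type.
exists [seq (\sum_(z in Z) Ly (z : J).2 z.1)%VS | Z : {set J}] => U hU UI.
pose Z := [set z : J | (Ly z.2 z.1 <= U)%VS].
apply/imageP; exists Z => //; apply/eqP; rewrite eqEsubv; apply/andP; split; last first.
  by apply/subv_sumP => z; rewrite inE.
apply: (submodule_layers p_prime p_ge5 dA hk r0 (iota := iota) (s := s) hU).
  by rewrite layer_spanT.
move=> g n gp gn ng nr hl.
have n4 : (n < 4 * p)%N by move: ng gp p_ge5; clear; lia.
pose z : J := (Ordinal gp, Ordinal n4).
apply/has_layerP => //; apply: (sumv_sup z) => //; rewrite inE.
by apply/(has_layerP red tau w iota s U gn).
Qed.

Hypothesis r_odd : odd r.

Definition types_in (U : {vspace V}) : {pred tc} := [pred T | (VT T <= U)%VS].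

Lemma down_types_in U : down_closed r (types_in U).
Proof.
move=> T T' h; rewrite !inE; apply: subv_trans; apply: types_spanS => T1 h1.
exact: le_wdegT_trans h1 h.
Qed.

(** Since p - 1 is even and r is odd, n = 2 g is impossible for n congruent to r. So no layer is the
    line of a power of D, and all of them are spanned by basis vectors. *)
Lemma submoduleE U : gstable U -> (U <= mT predT)%VS -> U = mT (types_in U).
Proof.
move=> hU UI; apply/eqP; rewrite eqEsubv; apply/andP; split; last first.
  apply: sp_subP => x; rewrite !inE => /subvP; apply.
  by rewrite (bas_types_span p_prime p_ge5 dA hk iota s r0) inE le_wdegT_refl.
apply: (submodule_layers p_prime p_ge5 dA hk r0 (iota := iota) (s := s) hU).
  by rewrite layer_spanT.
move=> g n gp gn _ nr hl l i li.
have gE : nord p g = g :> nat by rewrite val_nord.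
have li0 : (0 < l + i)%N.
  rewrite lt0n; apply/eqP => l0; rewrite l0 add0n in li.
  have P2 : ~~ odd p.-1.
    have := p_ge5; case: (even_prime p_prime) => [-> //|].
    by case: (p) => // m /=.
  have : odd (r %% p.-1) by rewrite odd_mod ?(negPf P2).
  by rewrite -nr odd_mod ?(negPf P2) // -li odd_double.
have [|x hx _] := mono_bas p_prime p_ge5 red tau w hk iota s r0 (j := nord p g) li0.
  by rewrite gE li.
have := hl l i li; rewrite gE in hx; rewrite hx => xU.
rewrite (bas_types_span p_prime p_ge5 dA hk iota s r0) inE.
exact: (below_sub p_prime p_ge5 dA hk r0 hU xU).
Qed.

Lemma irreducible_below T : irreducible (VT T, RT T).
Proof.
have := @irreducible_factor _ p_prime p_ge5 _ _ _ _ _ dA hk _ iota s _ r0 (strictly_below r T) T.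
have -> : mT [pred T' | (T' == T) || (T' \in strictly_below r T)] = VT T.
  apply: types_span_eq => T'; rewrite !inE; case: eqP => [->|] //=.
  by rewrite le_wdegT_refl.
apply; first exact: (down_strict p_ge5 r0).
  by rewrite inE eqxx.
by [].
Qed.

Lemma proper_sub_below T N : gstable N -> (N <= VT T)%VS -> N != VT T -> (N <= RT T)%VS.
Proof.
move=> hN NV ne; have NI : (N <= mT predT)%VS by apply: subv_trans NV _; exact: types_spanS.
rewrite (submoduleE hN NI).
apply: types_spanS => T'; rewrite !inE => hT'.
have le : leq_ty T' T.
  have := types_span_le p_prime p_ge5 dA hk r0 (subv_trans hT' NV); apply.
  by rewrite inE le_wdegT_refl.
rewrite le andbT; apply: contra ne => /eqP e; rewrite e in hT'.
by rewrite eqEsubv NV hT'.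
Qed.

(** By [proper_sub_below] the span of the types strictly below [T] contains every proper submodule,
    so it is the only maximal one and hence the radical. *)
Lemma cosocle_below T : irreducible_cosocle (VT T).
Proof.
have hI := irreducible_below T; have [[hV [hR RV]] /= neq hmax] := hI.
exists (RT T) => // x; split=> [xR|[_ /(_ _ hI)] //].
split; first exact: (subvP RV).
move=> N [[_ [hN NV]] /= nNV maxN].
have NR := proper_sub_below hN NV nNV.
have [<- //|e] := maxN (RT T) (conj hR RV) NR.
by rewrite e eqxx in neq.
Qed.

(** If U is no [VT T], then for each basis vector x in U some maximal type of U is not below the
    type of x. Omitting it gives a maximal submodule that contains x and the radical R, hence equals
    R. So R contains every such x, which is absurd. *)
Lemma cosocle_is_below U : gstable U -> (U <= mT predT)%VS -> irreducible_cosocle U ->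
  exists T, U = VT T.
Proof.
move=> hU UI [R radR [[_ [hR RU]] /= neq hmax]].
have [/existsP[T /eqP ->]|/existsPn hn] := boolP [exists T, U == VT T]; first by exists T.
have UE := submoduleE hU UI.
suff UR : (U <= R)%VS by move/eqP: neq; case; apply/eqP; rewrite eqEsubv RU UR.
rewrite {1}UE; apply: sp_subP => x; rewrite in_set => xU.
have hVU : (VT (ty x) <= U)%VS by [].
suff h : (VT (ty x) <= R)%VS.
  by apply: (subvP h); rewrite (bas_types_span p_prime p_ge5 dA hk iota s r0) inE le_wdegT_refl.
pose Q := [pred T | (T \in types_in U) && ~~ leq_ty T (ty x)].
have [T0 hT0] : exists T, Q T.
  apply/existsP; apply: contraR (hn (ty x)) => /existsPn h.
  rewrite eqEsubv hVU andbT {1}UE; apply: types_spanS => T TU; rewrite inE.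
  by have := h T; rewrite /Q /= TU /= negbK.
(* Maximal rank makes T maximal among all types of U: a type above T also fails to be below the type
   of x. Hence omitting T leaves a set closed downwards. *)
case: (@arg_maxnP _ T0 Q (fun T => rankT T) hT0) => T /andP[TU Tx] Tmax.
pose D := [pred T' | (T' \in types_in U) && (T' != T)].
have hD : down_closed r D.
  move=> T1 T2 le /andP[h1 h2]; rewrite inE (down_types_in le h1) /=.
  apply/eqP => e; rewrite e in le.
  have : (rankT T1 <= rankT T)%N.
    apply: Tmax; rewrite /Q /= h1 /=; apply: contra Tx; exact: le_wdegT_trans le.
  have := rankT_le p_ge5 r0 le => r1 r2; case/eqP: h2.
  by apply: (rankT_inj p_ge5 r0); apply/eqP; rewrite eqn_leq r1 r2.
have TD : T \notin D by rewrite inE eqxx andbF.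
have subD : {subset strictly_below r T <= D}.
  by move=> T' /andP[h1 h2]; rewrite inE h1 (down_types_in h2 TU).
have := irreducible_factor p_prime p_ge5 dA hk iota s r0 hD TD subD.
have -> : mT [pred T' | (T' == T) || (T' \in D)] = U.
  rewrite [RHS]UE; apply: types_span_eq => T'; rewrite !inE.
  by have [->|] := eqVneq T' T; rewrite /= ?andbT //; symmetry.
move=> hirr; have [[_ [hN NU]] /= nNU _] := hirr.
have RN : (R <= mT D)%VS.
  by apply/subvP => y /radR[_ /(_ _ hirr)].
have [/= e|/= e] := hmax _ (conj hN NU) RN; last by case/eqP: nNU.
rewrite -e; apply: types_spanS => T' hT'; rewrite !inE.
rewrite -[(_ <= U)%VS]/(T' \in types_in U) (down_types_in hT' xU) /=.
by apply: contra Tx => /eqP <-.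
Qed.

End Cosocle.

(** * The quotient O/m^2 and its characters *)

Section Quotient.
Variables (p : nat) (p_prime : prime p).
Variables (Qp : fieldType) (vp : valuation Qp) (hQp : is_padic_field p vp).
Variables (F : fieldExtType Qp) (vF : valuation F).
Variables (e : nat) (hram : forall x : Qp, x != 0 -> vF (x%:A) = e%:Z * vp x).
Hypothesis e_gt1 : (1 < e)%N.
Variables (A : finComUnitRingType) (pi : {rmorphism valring vF -> A}).
Hypothesis hpi : is_quotient_by_power 2 pi.
Variables (k : finFieldType) (red : {rmorphism A -> k}).
Hypothesis hred : is_quotient_by_power 1 (red \o pi).
Hypothesis hk : #|k| = p.
Variables (varpi : valring vF) (hvarpi : is_uniformizer vF (val varpi)).
Variables (teich : k -> valring vF) (hteich : is_teichmuller (red \o pi) teich).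

Local Notation tau := (pi \o teich).
Local Notation w := (pi varpi).

Lemma val_valring_nat n : val (n%:R : valring vF) = n%:R.
Proof. by elim: n => [|n IH] //; rewrite -addn1 !natrD -IH. Qed.

(** The valuation of p in F is e, which is at least 2. *)
Lemma valring_pchar : p%:R = 0 :> A.
Proof.
rewrite -(rmorph_nat pi); apply/(hpi.2).
rewrite val_valring_nat.
case: hQp => ch0 hv _ _.
have p0 : (p%:R : Qp) != 0.
  have := ch0 p; rewrite !inE p_prime /= => /negbT //.
have -> : (p%:R : F) = (p%:R : Qp)%:A by rewrite scaler_nat.
rewrite /val_ge hram //.
have -> : (p%:R : Qp) = ratr p%:R by rewrite ratr_nat.
have q0 : (p%:R : rat) != 0 by rewrite pnatr_eq0 -lt0n prime_gt0.
rewrite hv // /padic_val.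
have -> : (p%:R : rat) = (p%:Z)%:~R by [].
rewrite numq_int denq_int /= logn_prime // eqxx logn1 subr0 mulr1.
by rewrite lez_nat e_gt1 orbT.
Qed.

Lemma uniformizer_div y : val_ge vF 1 (val y) -> exists z, y = varpi * z.
Proof.
have [v0 v1] := hvarpi.
have [-> _|y0 hy] := eqVneq y 0; first by exists 0; rewrite mulr0.
have y0' : val y != 0 by rewrite -(inj_eq val_inj) in y0.
have q0 : val y / val varpi != 0 by rewrite mulf_neq0 ?invr_neq0.
have yE : val y = val varpi * (val y / val varpi) by rewrite mulrC divfK.
have hz : val y / val varpi \in valring_pred vF.
  rewrite inE /val_ge (negPf q0) /=.
  move: hy; rewrite /val_ge (negPf y0') /= {1}yE vfunM // v1.
  by rewrite lerDl.
by exists (Valring hz); apply: val_inj; rewrite /= -yE.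
Qed.

Lemma sqr_uniformizer : w * w = 0.
Proof.
have [v0 v1] := hvarpi.
by rewrite -rmorphM; apply/(hpi.2); rewrite -[val _]/(val varpi * val varpi) /val_ge vfunM // v1 orbT.
Qed.

Lemma red_teich c : red (tau c) = c.
Proof. by case: hteich => _ _ _; exact. Qed.

Lemma teich_uniformizer_inj c : tau c * w = 0 -> c = 0.
Proof.
have [v0 v1] := hvarpi.
move=> h; apply/eqP/negPn/negP => c0.
have tc : ~ val_ge vF 1 (val (teich c)).
  by move/(hred.2); rewrite /= red_teich; apply/eqP.
have [t0 t1] : val (teich c) != 0 /\ vF (val (teich c)) < 1.
  by move/negP: tc; rewrite /val_ge negb_or -ltNge => /andP.
move: h; rewrite /= -rmorphM => /(hpi.2).
rewrite -[val _]/(val (teich c) * val varpi) /val_ge mulf_eq0 (negPf t0) (negPf v0) /=.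
by rewrite vfunM // v1 -lerBlDr => h; have := le_lt_trans h t1.
Qed.

Lemma teich_decomp a : exists c, a = tau (red a) + tau c * w.
Proof.
have [x <-] := hpi.1 a.
have redB y : exists z, y - teich (red (pi y)) = varpi * z.
  apply: uniformizer_div; apply/(hred.2).
  by rewrite /= !rmorphB /= -[red (pi (teich _))]/(red (tau _)) red_teich subrr.
have [y hy] := redB x; have [z hz] := redB y.
exists (red (pi y)); rewrite /= -[x in LHS](subrK (teich (red (pi x)))) hy.
rewrite -[y in LHS](subrK (teich (red (pi y)))) hz !(rmorphD, rmorphM) mulrDr mulrA.
by rewrite sqr_uniformizer mul0r add0r addrC mulrC.
Qed.

(** In characteristic p the p-th power map is additive; it fixes Teichmueller representatives
    because k has p elements, and it kills [w]. Applied to the expansion of [tau x + tau y], it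
    removes the term in [w]. *)
Lemma teichD : {morph tau : x y / x + y}.
Proof.
have [t0 t1 tM _] := hteich.
have chA : p \in [pchar A] by rewrite inE p_prime valring_pchar eqxx.
have tX c : tau c ^+ p = tau c.
  have tXn n : tau (c ^+ n) = tau c ^+ n.
    elim: n => [|n IH]; first by rewrite !expr0 /= t1 rmorph1.
    by rewrite !exprS -IH /= tM rmorphM.
  by rewrite -tXn -hk expf_card.
move=> x y; have [c hc] := teich_decomp (tau x + tau y).
rewrite rmorphD !red_teich in hc.
have wp : w ^+ p = 0.
  by case: (p) (prime_gt1 p_prime) => [|[|m]] // _; rewrite !exprS mulrA sqr_uniformizer mul0r.
have := congr1 (fun a => a ^+ p) hc.
rewrite /= -!(pFrobenius_autE chA) !rmorphD /= !pFrobenius_autE.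
rewrite -!/(tau _) !tX exprMn wp mulr0 addr0.
by move=> ->.
Qed.

Lemma quotient_dual_numbers : dual_numbers red tau w.
Proof.
have [t0 t1 tM _] := hteich.
split.
- by rewrite /= t1 rmorph1.
- by move=> x y; rewrite /= tM rmorphM.
- exact: teichD.
- exact: red_teich.
- exact: sqr_uniformizer.
- exact: teich_uniformizer_inj.
- exact: teich_decomp.
Qed.

End Quotient.

(** * * Characters of the Borel subgroup *)

(** The value at a generator is a root of X^p - X, whose roots in E are the elements of k. It is
    therefore a power of that generator. *)
Lemma units_character p (p_prime : prime p) (k : finFieldType) (hk : #|k| = p)
    (E : fieldType) (iota : {rmorphism k -> E}) (phi : k -> E) :
  phi 1 = 1 -> (forall x y, x != 0 -> y != 0 -> phi (x * y) = phi x * phi y) ->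
  exists n, forall x, x != 0 -> phi x = iota x ^+ n.
Proof.
move=> phi1 phiM.
have phiX x n : x != 0 -> phi (x ^+ n) = phi x ^+ n.
  by move=> x0; elim: n => [|n IH]; rewrite ?expr0 // !exprS phiM ?IH // expf_neq0.
have [g g0 hg] : exists2 g : k, g != 0 & forall x, x != 0 -> exists m, x = g ^+ m.
  have /cyclicP[u hu] := field_unit_group_cyclic [set: {unit k}]%G.
  exists (val u); first by rewrite -unitfE (valP u).
  move=> x; rewrite -unitfE => xU.
  have : FinRing.unit k xU \in <[u]>%g by rewrite -hu inE.
  by case/cycleP => m hm; exists m; rewrite -FinRing.val_unitX -hm.
have : \prod_(c : k) (phi g - iota c) = 0.
  have := congr1 (fun P => (map_poly iota P).[phi g]) (finField_genPoly k).
  rewrite /= rmorphB /= map_polyXn map_polyX !hornerE rmorph_prod horner_prod hk => h.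
  transitivity (phi g ^+ p - phi g).
    rewrite h; apply: eq_bigr => c _.
    by rewrite rmorphB /= map_polyX map_polyC /= !hornerE.
  by rewrite -phiX // -hk expf_card subrr.
move/eqP/prodf_eq0 => [c _]; rewrite subr_eq0 => /eqP hc.
have c0 : c != 0.
  rewrite -(fmorph_eq0 iota) -hc; apply/eqP => h.
  have := phi1; rewrite -(mulfV g0) phiM ?invr_eq0 // h mul0r.
  by move/eqP; rewrite eq_sym oner_eq0.
have [n hn] := hg c c0; exists n => x /hg[m ->].
by rewrite phiX // hc hn !rmorphXn -!exprM mulnC.
Qed.

Section Character.
Variables (p : nat) (p_prime : prime p) (p_ge5 : (5 <= p)%N).
Variables (A : finComUnitRingType) (k : finFieldType) (red : {rmorphism A -> k}).
Variables (tau : k -> A) (w : A) (dA : dual_numbers red tau w) (hk : #|k| = p).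
Hypothesis pA : p%:R = 0 :> A.
Variables (E : fieldType) (iota : {rmorphism k -> E}).
Variables (chi : {'GL_2[A]} -> E) (hchi : is_character chi).
Local Notation GL := {'GL_2[A]}.

(** A group of exponent p has no nontrivial character into a field of characteristic p. *)
Lemma character_eq1 (h : A -> GL) : (forall x, h x \in borel A) ->
  h 0 = 1%g -> (forall x y, h (x + y) = h x * h y)%g -> forall x, chi (h x) = 1.
Proof.
move=> hB h0 hD x.
have hX n : chi (h (x *+ n)) = chi (h x) ^+ n.
  elim: n => [|n IH]; first by rewrite mulr0n h0 hchi.1.
  by rewrite mulrS hD hchi.2 // IH exprS.
have := hX p; rewrite -mulr_natr pA mulr0 h0 hchi.1 => hp.
have chE : p \in [pchar E].
  by rewrite (fmorph_pchar iota) (pchar_prime_card p_prime hk).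
have : (chi (h x) - 1) ^+ p = 0.
  by rewrite -(pFrobenius_autE chE) rmorphB /= pFrobenius_autE -hp pFrobenius_aut1 subrr.
by move/eqP; rewrite expf_eq0 subr_eq0 => /andP[_ /eqP].
Qed.

Let red2 a b c d := @glmx_gl2 A k red tau w dA a b c d.

Lemma gl2E (g : GL) a b c d : red a * red d - red b * red c != 0 ->
  glmx g 0 0 = a -> glmx g 0 1 = b -> glmx g 1 0 = c -> glmx g 1 1 = d ->
  g = gl2 a b c d.
Proof. by move=> h h1 h2 h3 h4; apply: glmx_eq; rewrite red2 // mxE. Qed.

Lemma borel_gl2 a b d : red a != 0 -> red d != 0 -> gl2 a b 0 d \in borel A.
Proof.
by move=> a0 d0; rewrite inE red2 ?mxE // rmorph0 mulr0 subr0 mulf_neq0.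
Qed.

Lemma gl2_mul a b d a' b' d' : red a != 0 -> red d != 0 -> red a' != 0 -> red d' != 0 ->
  (gl2 a b 0 d * gl2 a' b' 0 d')%g = gl2 (a * a') (a * b' + b * d') 0 (d * d').
Proof.
move=> a0 d0 a0' d0'.
have h1 : red a * red d - red b * red 0 != 0 by rewrite rmorph0 mulr0 subr0 mulf_neq0.
have h2 : red a' * red d' - red b' * red 0 != 0 by rewrite rmorph0 mulr0 subr0 mulf_neq0.
apply: gl2E; rewrite ?glmxM ?red2 ?mxE //=; try ring.
by rewrite rmorph0 mulr0 subr0 !rmorphM !mulf_neq0.
Qed.

Lemma gl2_1 : gl2 1 0 0 1 = 1%g :> GL.
Proof.
by apply/esym/gl2E; rewrite ?glmx1 ?rmorph1 ?rmorph0 // mulr0 subr0 mulr1 oner_neq0.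
Qed.

Let r1 : red 1 != 0. Proof. by rewrite rmorph1 oner_neq0. Qed.
Let rw x : red (1 + w * x) != 0.
Proof. by rewrite rmorphD rmorphM (red_w dA) mul0r addr0. Qed.

Lemma character_unip x : chi (gl2 1 x 0 1) = 1.
Proof.
apply: (@character_eq1 (fun x => gl2 1 x 0 1)).
- by move=> y; exact: borel_gl2.
- exact: gl2_1.
by move=> y z; rewrite gl2_mul // !mulr1 mul1r addrC.
Qed.

Lemma one_wD x y : 1 + w * (x + y) = (1 + w * x) * (1 + w * y).
Proof.
have h : w * x * (w * y) = 0 by rewrite mulrACA (sqr_w dA) mul0r.
have -> : (1 + w * x) * (1 + w * y) = 1 + w * (x + y) + w * x * (w * y) by ring.
by rewrite h addr0.
Qed.

Lemma character_diag1 x : chi (gl2 (1 + w * x) 0 0 1) = 1.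
Proof.
apply: (@character_eq1 (fun x => gl2 (1 + w * x) 0 0 1)).
- by move=> y; exact: borel_gl2.
- by rewrite mulr0 addr0 gl2_1.
by move=> y z; rewrite gl2_mul // one_wD mulr0 mul0r addr0 mulr1.
Qed.

Lemma character_diag2 x : chi (gl2 1 0 0 (1 + w * x)) = 1.
Proof.
apply: (@character_eq1 (fun x => gl2 1 0 0 (1 + w * x))).
- by move=> y; exact: borel_gl2.
- by rewrite mulr0 addr0 gl2_1.
by move=> y z; rewrite gl2_mul // one_wD mulr0 mul0r addr0 mulr1.
Qed.

Lemma unit_factor a : red a != 0 -> exists x, a = tau (red a) * (1 + w * x).
Proof.
move=> a0; exists (tau (eps red tau w a / red a)); rewrite mulrDr mulr1 mulrCA -(tauM dA).
by rewrite mulrCA mulfV // mulr1 mulrC -(epsE dA).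
Qed.

Lemma character_red (b : GL) : b \in borel A ->
  chi b = chi (gl2 (tau (red (glmx b 0 0))) 0 0 1) * chi (gl2 1 0 0 (tau (red (glmx b 1 1)))).
Proof.
move=> bB; have [a0 d0] := borel_diag_neq0 dA bB.
have b10 : glmx b 1 0 = 0 by move: bB; rewrite inE => /eqP.
have [x hx] := unit_factor a0; have [y hy] := unit_factor d0.
set a := glmx b 0 0 in a0 hx *; set d := glmx b 1 1 in d0 hy *.
have aU : a \is a GRing.unit by rewrite (unit_red dA).
have ta0 : red (tau (red a)) != 0 by rewrite (red_tau dA).
have td0 : red (tau (red d)) != 0 by rewrite (red_tau dA).
pose z := glmx b 0 1 / a.
pose t1 : GL := gl2 (tau (red a)) 0 0 1; pose t2 : GL := gl2 1 0 0 (tau (red d)).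
pose u1 : GL := gl2 (1 + w * x) 0 0 1; pose u2 : GL := gl2 1 0 0 (1 + w * y).
pose u3 : GL := gl2 1 z 0 1.
have -> : b = (t1 * t2 * u1 * u2 * u3)%g.
  rewrite /t1 /t2 /u1 /u2 /u3 !gl2_mul ?(rmorphM, mulf_neq0, rmorph1, oner_neq0) //.
  rewrite !(mulr0, mul0r, addr0, mulr1, mul1r, add0r) -hx -hy.
  apply: gl2E => //; first by rewrite rmorph0 mulr0 subr0 mulf_neq0.
  by rewrite /z mulrCA divrr // mulr1.
have bB1 : t1 \in borel A by exact: borel_gl2.
have bB2 : t2 \in borel A by exact: borel_gl2.
have bB3 : u1 \in borel A by exact: borel_gl2.
have bB4 : u2 \in borel A by exact: borel_gl2.
have bB5 : u3 \in borel A by exact: borel_gl2.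
have bM (g h : GL) : g \in borel A -> h \in borel A -> (g * h)%g \in borel A.
  by rewrite !inE => /eqP h1 /eqP h2; rewrite glmxM h1 h2 mul0r mulr0 addr0.
by rewrite !hchi.2 ?bM // character_unip character_diag1 character_diag2 !mulr1.
Qed.

Lemma det_borel (b : GL) : b \in borel A ->
  detE red iota b = iota (red (glmx b 0 0)) * iota (red (glmx b 1 1)).
Proof. by rewrite inE => /eqP h; rewrite dt_det2 h rmorph0 rmorph0 mulr0 subr0. Qed.

(** The point is that the search in [char_exponents] succeeds; its default value has zero
    exponents. *)
Lemma char_exponentsP :
  [/\ (0 < char_s p 1 red iota chi)%N,
      (0 < char_r p 1 red iota chi)%N &
      {in borel A, forall b, chi b = detE red iota b ^+ char_s p 1 red iota chi *
         chi_ red iota (char_r p 1 red iota chi) b}].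
Proof.
rewrite /char_s /char_r /char_exponents; case: pickP => [sr /and3P[s0 r0 /forall_inP h]|].
  split; first by rewrite lt0n.
    by rewrite lt0n.
  by move=> b /h /eqP.
move=> hn; exfalso.
have [n1 h1] : exists n, forall x, x != 0 -> chi (gl2 (tau x) 0 0 1) = iota x ^+ n.
  apply: (@units_character p p_prime k hk E iota (fun x => chi (gl2 (tau x) 0 0 1))) => [|x y x0 y0].
    by rewrite (tau1 dA) gl2_1 hchi.1.
  rewrite -hchi.2 ?borel_gl2 ?gl2_mul ?(red_tau dA) //.
  by rewrite (tauM dA) mulr0 mul0r addr0 mulr1.
have [n2 h2] : exists n, forall x, x != 0 -> chi (gl2 1 0 0 (tau x)) = iota x ^+ n.
  apply: (@units_character p p_prime k hk E iota (fun x => chi (gl2 1 0 0 (tau x)))) => [|x y x0 y0].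
    by rewrite (tau1 dA) gl2_1 hchi.1.
  rewrite -hchi.2 ?borel_gl2 ?gl2_mul ?(red_tau dA) //.
  by rewrite (tauM dA) mulr0 mul0r addr0 mulr1.
have P0 : (0 < p.-1)%N by move: p_ge5; clear; lia.
(* Matching a^n1 d^n2 with (a d)^s d^r requires s = n1 and r = n2 - s modulo p - 1; the added
   multiples of p - 1 keep both arguments positive. *)
pose s := red_exp p (n1 + p.-1); pose r := red_exp p (n2 + 2 * p.-1 - s).
have s0 : (0 < s <= p.-1)%N by rewrite red_exp_gt0 // red_exp_max // addn_gt0 P0 orbT.
have r0 : (0 < r <= p.-1)%N by rewrite red_exp_gt0 // red_exp_max // andbT; lia.
have hs : nord p s = s :> nat by rewrite val_nord //; lia.
have hr : nord p r = r :> nat by rewrite val_nord //; lia.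
have n0 (x : Ntilde p 1) : (0 < x)%N -> x != ord0.
  by move=> x0; apply/eqP => xE; rewrite xE in x0.
move/negP: (hn (nord p s, nord p r)); case; apply/and3P; split.
- by apply: n0; rewrite /= hs; case/andP: s0.
- by apply: n0; rewrite /= hr; case/andP: r0.
apply/forall_inP => b bB; apply/eqP.
have [a0 d0] := borel_diag_neq0 dA bB.
rewrite character_red // h1 // h2 // det_borel // /chi_ /redE hs hr.
rewrite exprMn -mulrA -exprD.
congr (_ * _); apply: (expr_mod_card p_prime hk) => //.
  by rewrite red_exp_mod // modnDr.
rewrite -modnDmr red_exp_mod // modnDmr subnKC; last by lia.
by rewrite addnC modnMDl.
Qed.

(** If r = 2 m, then (a d)^s d^(2 m) (a / d)^m = (a d)^(s + m), so twisting by the m-th power of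
    [eta] gives a character of the determinant. *)
Lemma odd_char_r : odd_character red iota chi -> odd (char_r p 1 red iota chi).
Proof.
have [_ _ hc] := char_exponentsP.
move: (char_s _ _ _ _ _) (char_r _ _ _ _ _) hc => s r hc hodd; apply/negPn/negP => hr.
apply: (hodd (r./2)); exists (fun a => redE red iota a ^+ (s + r./2)) => b bB.
have [a0 d0] := borel_diag_neq0 dA bB.
have ha : iota (red (glmx b 0 0)) != 0 by rewrite fmorph_eq0.
have hd : iota (red (glmx b 1 1)) != 0 by rewrite fmorph_eq0.
rewrite hc // -[redE red iota (\det _)]/(detE red iota b) det_borel // /chi_ /eta /redE.
rewrite exprD -mulrA; congr (_ * _).
have rE : (r : nat) = (r./2 + r./2)%N by rewrite addnn -[LHS]odd_double_half (negPf hr).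
rewrite [in X in X * _]rE; move: (r./2) => m; rewrite exprD expr_div_n exprMn; field.
by rewrite expf_neq0.
Qed.

End Character.

(** * * The modules of the statement in the monomial basis *)

Section Identification.
Variables (p : nat) (p_prime : prime p) (p_ge5 : (5 <= p)%N).
Variables (A : finComUnitRingType) (k : finFieldType) (red : {rmorphism A -> k}).
Variables (tau : k -> A) (w : A) (dA : dual_numbers red tau w) (hk : #|k| = p).
Variables (E : fieldType) (iota : {rmorphism k -> E}).
Variables (chi : {'GL_2[A]} -> E).
Local Notation s := (char_s p 1 red iota chi).
Local Notation r := (char_r p 1 red iota chi).
Hypothesis r0 : (0 < r)%N.

Lemma VsubE (T : tcode p 1) :
  Vsub red tau w iota chi T = types_span red tau w iota s r (below_type r T).
Proof.
have inP x : (x \in [pred x : Theta p 1 | [exists T', has_type r x T' &&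
    le_chi red iota chi T' T]]) = (type_of r x \in below_type r T).
  rewrite !inE; apply/existsP/idP => [[T']|h].
    by rewrite has_typeE // => /andP[/eqP->]; rewrite /le_chi le_typeE.
  by exists (type_of r x); rewrite has_typeE // eqxx /le_chi le_typeE.
apply/eqP; rewrite eqEsubv; apply/andP; split.
  apply/span_subvP => u /mapP[x xP ->]; move: xP; rewrite mem_enum inP => hx.
  have [c c0 e] := fbasisE p_prime p_ge5 dA hk iota s r0 x.
  rewrite -[fbasis _ _ _ _ _ _]/(twist red iota s (fbasis_r red tau w iota r x)) e.
  by rewrite memvZ // mem_sp // in_set.
apply: sp_subP => x; rewrite in_set => hx.
have [c c0 e] := fbasisE p_prime p_ge5 dA hk iota s r0 x.
have : c *: bas red tau w iota s r x \in Vsub red tau w iota chi T.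
  rewrite -e; apply/memv_span/mapP; exists x => //.
  by rewrite mem_enum inP.
by rewrite rpredZeq (negPf c0).
Qed.

Lemma LsubE (T : tcode p 1) : Lsub red tau w iota chi T = type_subquot red tau w iota s r T.
Proof.
rewrite /Lsub VsubE /type_subquot; congr (_, _).
under eq_bigr do rewrite VsubE.
have ltE T' : lt_chi red iota chi T' T = (T' \in strictly_below r T).
  by rewrite /lt_chi /lt_type le_typeE.
rewrite /types_span -sp_bigcup; congr sp; apply/setP=> x; rewrite in_set.
apply/bigcupP/idP => [[T']|h].
  rewrite ltE in_set => hT' hx; exact: (down_strict p_ge5 r0 hx hT').
exists (type_of r x); first by rewrite ltE.
by rewrite in_set inE le_wdegT_refl.
Qed.

End Identification.

Theorem theorem1p3
  (p : nat) (p_prime : prime p) (p_ge5 : (5 <= p)%N)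
  (* Q_p and a finite extension F, totally ramified with e > 1 *)
  (Qp : fieldType) (vp : valuation Qp) (hQp : is_padic_field p vp)
  (F : fieldExtType Qp) (vF : valuation F)
  (e : nat) (hram : forall x : Qp, x != 0 -> vF (x%:A) = e%:Z * vp x)
  (e_gt1 : (1 < e)%N)
  (* A is O/m^2, k is O/m = A/(m/m^2), of cardinality p *)
  (A : finComUnitRingType) (pi : {rmorphism valring vF -> A})
  (hpi : is_quotient_by_power 2 pi)
  (k : finFieldType) (red : {rmorphism A -> k})
  (hred : is_quotient_by_power 1 (red \o pi)) (hk : #|k| = p)
  (varpi : valring vF) (hvarpi : is_uniformizer vF (val varpi))
  (teich : k -> valring vF) (hteich : is_teichmuller (red \o pi) teich)
  (E : fieldType) (iota : {rmorphism k -> E})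
  (chi : {'GL_2[A]} -> E) (hchi : is_character chi) :
  let I2 := principal_series chi in
  let V := Vsub (p := p) (f := 1) red (pi \o teich) (pi varpi) iota chi in
  let L := Lsub (p := p) (f := 1) red (pi \o teich) (pi varpi) iota chi in
  let le := le_chi (p := p) (f := 1) red iota chi in
  [/\ (* all pairs (I, gamma) are types, and there are 2p of them *)
      forall T : tcode p 1, is_type red iota chi T,
      #|{: tcode p 1}| = (2 * p)%N,
      (* the Jordan-Hoelder constituents of I_2(chi) *)
      JH_constituents I2 [seq L T | T : tcode p 1],
      (* finitely many submodules *)
      (exists S : seq {vspace {ffun {'GL_2[A]} -> E^o}},
         forall U, submodule_of I2 U -> U \in S)
    & odd_character red iota chi ->
        (forall U, submodule_of I2 U /\ irreducible_cosocle U <->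
                   exists T, U = V T) /\
        (forall T, JH_constituents (V T) [seq L T' | T' in [pred T' | le T' T]])].
Proof.
move=> I2 V L le.
have dA := quotient_dual_numbers p_prime hQp hram e_gt1 hpi hred hk hvarpi hteich.
have pA := valring_pchar p_prime hQp hram e_gt1 hpi.
have [s0 r0 chiE] := char_exponentsP p_prime p_ge5 dA hk pA iota hchi.
pose s := char_s p 1 red iota chi; pose r := char_r p 1 red iota chi.
have VE T : V T = types_span red (pi \o teich) (pi varpi) iota s r (below_type r T).
  exact: (VsubE p_prime p_ge5 dA hk r0).
have LE T : L T = type_subquot red (pi \o teich) (pi varpi) iota s r T.
  exact: (LsubE p_prime p_ge5 dA hk r0).
have leE T T' : le T T' = le_wdegT r T T' by exact: le_typeE.
have IE : I2 = types_span red (pi \o teich) (pi varpi) iota s r predT.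
  rewrite /I2 (principal_seriesE p_prime p_ge5 dA hk r0 chiE).
  by rewrite /types_span; congr sp; apply/setP=> x; rewrite !inE.
split.
- move=> T; have [x <-] := type_of_surj p_ge5 r0 T.
  by exists x; rewrite has_typeE.
- rewrite card_prod card_ord -cardsT -powersetT card_powerset cardsT card_ord.
  by rewrite expn1 prednK //; lia.
- rewrite IE /image_mem (eq_map LE).
  exact: (JH_types_span p_prime p_ge5 dA hk iota s r0 (D := predT)).
- have [S hS] := finitely_many_submodules p_prime p_ge5 dA hk iota s r0.
  by exists S => U [hU]; rewrite IE; exact: hS.
move=> hodd; have r_odd := odd_char_r p_prime p_ge5 dA hk pA hchi hodd.
split=> [U|T].
  split=> [[[hU UI] hc]|[T ->]].
    rewrite IE in UI.
    have [T UT] := cosocle_is_below p_prime p_ge5 dA hk r0 r_odd hU UI hc.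
    by exists T; rewrite VE.
  rewrite VE; split; last exact: (cosocle_below p_prime p_ge5 dA hk iota s r0 r_odd).
  split; first exact: (gstable_below p_prime p_ge5 dA hk r0).
  by rewrite IE; apply: types_spanS.
have -> : [seq L T' | T' in [pred T' | le T' T]] =
    [seq type_subquot red (pi \o teich) (pi varpi) iota s r T' | T' in below_type r T].
  rewrite /image_mem (eq_map LE); congr map; apply: eq_enum => T'.
  by rewrite !inE leE.
rewrite VE; apply: (JH_types_span p_prime p_ge5 dA hk) => //.
exact: down_below.
Qed.
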